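(* Let $\mathcal{Z}$ be a $\tau$-periodic orbit of the conservative system $\dot x=JDH(x)$ satisfying the following three assumptions (terms defined in the context), where $m,l$ are relatively prime positive integers, $z\in\mathcal{Z}$ and $\Pi=X_0(m\tau;z)$: (A.1) $\mathcal{Z}$ is $m$-normal and its Melnikov function has a simple zero at $0$, i.e. $M_{m:l}(0)=0$ and $M_{m:l}'(0)\neq 0$; (A.2) all eigenvalues of $\Pi$ lie on the unit circle in $\mathbb{C}$; (A.3) the algebraic and geometric multiplicities of the eigenvalue $+1$ of $\Pi$ are $2$ and $1$, respectively. Let $\mathcal{Z}_\varepsilon$ be the $l\delta(\varepsilon)$-periodic orbit of $\dot x=JDH(x)+\varepsilon g(x,t;\delta,\varepsilon)$ that perturbs from $\mathcal{Z}$, let $T(h)$ be the minimal-period function of the family $\mathcal{F}$ with $h=H(z)$, and let $\mathcal{T}$ be the tangent space of $\mathcal{F}$ at $z$. Then $\mathcal{Z}_\varepsilon$ is unstable for $\varepsilon>0$ small enough if one of the following conditions is satisfied: (i) (instabilities in $\mathcal{T}$) either $T'(h)M_{m:l}'(0)<0$, or both $T'(h)M_{m:l}'(0)>0$ and $C_{\mathcal{T}}<0$; (ii) (further instabilities, $n>1$) $C_{\mathcal{V}}<0$ for some strongly invariant subspace $\mathcal{V}$ for $\Pi$.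
   Context: System. Let $n\ge 1$, $x=(q,p)\in\mathbb{R}^{2n}$, $J=\begin{bmatrix}0&I\\-I&0\end{bmatrix}$. Consider $$\dot x=JDH(x)+\varepsilon g(x,t;\delta,\varepsilon),\qquad \varepsilon\ge 0,$$ on a subset $\mathcal{U}\subseteq\mathbb{R}^{2n}$, where $H(q,p)=\frac12\langle p-G_1(q),M^{-1}(q)(p-G_1(q))\rangle-G_0(q)+V(q)$ with $M(q)$ symmetric positive definite, and $g(x,t;\delta,\varepsilon)=(0,\,Q(q,F(q,p),t;\delta,\varepsilon))$ with $F(q,p)=M^{-1}(q)(p-G_1(q))$. The perturbation $Q$ is periodic in $t$ with period $\delta$. $H$ is $C^{r_0+1}$ with $r_0\ge 3$, and $g$ is $C^{r_0-1}$ in $t$ and $C^{r_0}$ in its other arguments. Let $x(t;\xi,\delta,\varepsilon)$ be the solution with initial condition $\xi$ at $t=0$, and $x_0(t;\xi)=x(t;\xi,\delta,0)$. Let $X(t;\xi,\delta,\varepsilon)$ solve the variational equation $\dot X=(JD^2H(x(t;\xi,\delta,\varepsilon))+\varepsilon\partial_xg(x(t;\xi,\delta,\varepsilon),t;\delta,\varepsilon))X$, $X(0)=I$, and $X_0(t;\xi)=X(t;\xi,\delta,0)$. Conservative orbit. $\mathcal{Z}\subset\mathcal{U}$ is a periodic orbit of the system for $\varepsilon=0$ with minimal period $\tau>0$; $z\in\mathcal{Z}$; $m,l$ are relatively prime positive integers; $\Pi=X_0(m\tau;z)$. $\mathcal{Z}$ is called $m$-normal if either (a) the geometric multiplicity of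 the eigenvalue $+1$ of $\Pi$ is $1$, or (b) this geometric multiplicity is $2$ and $JDH(z)\notin\mathrm{range}(\Pi-I)$. An $m$-normal orbit lies in a one-parameter family $\mathcal{F}$ of periodic orbits, parametrized by the values of a scalar function $r$ of a point of an orbit and its period (e.g. $r(z,m\tau)=m\tau$ or $r(z,m\tau)=H(z)$). The Melnikov function is $$M_{m:l}(s)=\int_0^{m\tau}\langle DH(x_0(t+s;z)),\,g(x_0(t+s;z),t;\tau m/l,0)\rangle\,dt.$$ Perturbed orbit. It is known that, under (A.1), for small $\varepsilon>0$ there is an $l\delta(\varepsilon)$-periodic orbit $\mathcal{Z}_\varepsilon$ of the perturbed system, depending smoothly on $\varepsilon$, with initial condition $\xi(\varepsilon)=z+O(\varepsilon)$ and $l\delta(\varepsilon)=m\tau+O(\varepsilon)$, subject to the resonance condition $r(\xi(\varepsilon),l\delta(\varepsilon))=r(z,m\tau)$. Its Floquet multipliers are the eigenvalues of $X(l\delta(\varepsilon);\xi(\varepsilon),\delta(\varepsilon),\varepsilon)$; the orbit is asymptotically stable if all of them lie inside the open unit disk and unstable if at least one lies outside the closed unit disk. Under (A.3), $\mathcal{F}$ is locally parametrized by the value of $H$; $T$ denotes the function giving the minimal period of the orbits of $\mathcal{F}$ near $\mathcal{Z}$ as a function of the value of $H$, so $\tau=T(h)$, $h=H(z)$, and $T'(h)\ne0$. Invariant subspaces and contraction. Let $\mathcal{V}\subseteq\mathbb{R}^{2n}$ be a $2v$-dimensional invariant subspace of $\Pi$, $R_{\mathcal{V}}\in\mathbb{R}^{2n\times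 2v}$ a matrix whose columns form a basis of $\mathcal{V}$, and $B_{\mathcal{V}}$ the unique matrix with $\Pi R_{\mathcal{V}}=R_{\mathcal{V}}B_{\mathcal{V}}$. $\mathcal{V}$ is strongly invariant for $\Pi$ if $\det B_{\mathcal{V}}=1$ and the eigenvalues of $B_{\mathcal{V}}$ are not repeated in the rest of the spectrum of $\Pi$ (each eigenvalue of $B_{\mathcal{V}}$ has the same algebraic multiplicity for $B_{\mathcal{V}}$ and for $\Pi$). The symplectic left inverse of $R_{\mathcal{V}}$ is $S_{\mathcal{V}}=(R_{\mathcal{V}}^\top JR_{\mathcal{V}})^{-1}R_{\mathcal{V}}^\top J$. The volume contraction is $$C_{\mathcal{V}}=-\frac{1}{m\tau v}\int_0^{m\tau}\mathrm{trace}\big(S_{\mathcal{V}}X_0^{-1}(t;z)\,\partial_xg(x_0(t;z),t;m\tau/l,0)\,X_0(t;z)R_{\mathcal{V}}\big)\,dt,$$ which does not depend on the choice of basis. The tangent space $\mathcal{T}$ of $\mathcal{F}$ at $z$ is the two-dimensional strongly invariant subspace for $\Pi$ associated with its eigenvalues equal to $+1$. *)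

(* Defs.v *)
From HB Require Import structures.
From mathcomp Require Import all_boot all_order all_algebra.
From mathcomp Require Import all_classical all_reals all_analysis.
From mathcomp Require Import complex.
Set Implicit Arguments.
Unset Strict Implicit.
Unset Printing Implicit Defensive.
Import Order.TTheory GRing.Theory Num.Theory.
Import numFieldNormedType.Exports.
Local Open Scope classical_set_scope.
Local Open Scope ring_scope.

Section Calculus.
Context {R : realType}.

(* Class C^r with respect to the directions in D, on an open set A: all iterated
   derivatives of order at most r along directions of D exist and are continuous
   in all the variables.  The spaces are finite-dimensional in every use, so
   that D = setT is the usual class C^r; a proper subspace D gives
   "C^r in some of the arguments". *)
Fixpoint Cr {V W : normedModType R} (D A : set V) (r : nat) (f : V -> W) : Prop :=
  (forall x, A x -> {for x, continuous f}) /\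
  if r is r'.+1 then
    forall v, D v ->
      (forall x, A x -> derivable f x v) /\ Cr D A r' (fun x => 'D_v f x)
  else True.

(* On a set that need not be open (a parameter ranging over a half-open
   interval), being of class C^r means extending to a C^r function on an open
   neighbourhood. *)
Definition Cr_on {V W : normedModType R} (D A : set V) (r : nat) (f : V -> W) :=
  exists (O : set V) (f' : V -> W),
    [/\ open O, A `<=` O, Cr D O r f' & forall x, A x -> f' x = f x].

Definition dot {k} (u v : 'cV[R]_k) : R := (u^T *m v) 0 0.

Definition grad {k} (f : 'cV[R]_k -> R) (x : 'cV[R]_k) : 'cV[R]_k :=
  \col_i 'D_(delta_mx i 0) f x.

(* The library's 'J is the transposed convention, for row vectors. *)
Definition jac {k l} (f : 'cV[R]_k -> 'cV[R]_l) (x : 'cV[R]_k) : 'M[R]_(l, k) :=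
  \matrix_(i, j) ('D_(delta_mx j 0) f x) i 0.

Definition hessian {k} (f : 'cV[R]_k -> R) (x : 'cV[R]_k) : 'M[R]_k :=
  jac (grad f) x.

Definition solution {k} (U : set 'cV[R]_k) (f : 'cV[R]_k -> R -> 'cV[R]_k)
    (x : R -> 'cV[R]_k) :=
  forall t, U (x t) /\ is_derive t (1 : R) x (f (x t) t).

Definition fundamental {k} (A : R -> 'M[R]_k) (X : R -> 'M[R]_k) :=
  X 0 = 1%:M /\ forall t, is_derive t (1 : R) X (A t *m X t).

Definition periodic_fun {T : Type} (P : R) (x : R -> T) := forall t, x (t + P) = x t.

Definition minimal_period {T : Type} (P : R) (x : R -> T) :=
  [/\ 0 < P, periodic_fun P x & forall s, 0 < s < P -> ~ periodic_fun s x].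

End Calculus.

Section Spectrum.
Context {R : realType}.

Definition cmx {k} (A : 'M[R]_k) : 'M[R[i]]_k := map_mx (real_complex R) A.

Definition alg_mult {F : fieldType} {k} (a : F) (A : 'M[F]_k) : nat :=
  mup a (char_poly A).

(* The transpose is there because eigenspace consists of row vectors. *)
Definition geo_mult {F : fieldType} {k} (a : F) (A : 'M[F]_k) : nat :=
  \rank (eigenspace A^T a).

Definition spectrum_on_circle {k} (A : 'M[R]_k) :=
  forall lam : R[i], eigenvalue (cmx A) lam -> `|lam| = 1.

Definition basis_mx {k d} (V : {vspace 'cV[R]_k}) (RV : 'M[R]_(k, d)) :=
  \rank RV = d /\ forall x, x \in V <-> exists y : 'cV[R]_d, x = RV *m y.

Definition strongly_invariant {k v} (Pi : 'M[R]_k) (V : {vspace 'cV[R]_k})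
    (RV : 'M[R]_(k, v + v)) (BV : 'M[R]_(v + v)) :=
  [/\ basis_mx V RV, Pi *m RV = RV *m BV, \det BV = 1
    & forall lam : R[i], eigenvalue (cmx BV) lam ->
        alg_mult lam (cmx BV) = alg_mult lam (cmx Pi)].

Definition tangent_space {k} (Pi : 'M[R]_k) (V : {vspace 'cV[R]_k})
    (RV : 'M[R]_(k, 1 + 1)) (BV : 'M[R]_(1 + 1)) :=
  strongly_invariant Pi V RV BV /\
  forall lam : R[i], eigenvalue (cmx BV) lam -> lam = 1.

End Spectrum.

Section Mechanics.
Context {R : realType} {n : nat}.
Local Notation cV := 'cV[R]_n.
Local Notation phase := 'cV[R]_(n + n).

Definition Jmx : 'M[R]_(n + n) := block_mx 0 1%:M (- 1%:M) 0.

(* The arguments of forcing are q, dq/dt, t, delta, epsilon. *)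
Record mech := Mech {
  mass : cV -> 'M[R]_n;
  gyro : cV -> cV;
  gyro0 : cV -> R;
  potential : cV -> R;
  forcing : cV -> cV -> R -> R -> R -> cV }.

Variable S : mech.

Definition velocity (x : phase) : cV :=
  invmx (mass S (usubmx x)) *m (dsubmx x - gyro S (usubmx x)).

Definition ham (x : phase) : R :=
  2^-1 * dot (dsubmx x - gyro S (usubmx x)) (velocity x)
  - gyro0 S (usubmx x) + potential S (usubmx x).

Definition pert (x : phase) (t delta eps : R) : phase :=
  col_mx 0 (forcing S (usubmx x) (velocity x) t delta eps).

Definition cons_field (x : phase) : phase := Jmx *m grad ham x.

Definition forced_field (delta eps : R) (x : phase) (t : R) : phase :=
  cons_field x + eps *: pert x t delta eps.

Definition jac_pert (x : phase) (t delta eps : R) : 'M[R]_(n + n) :=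
  jac (fun y => pert y t delta eps) x.

Definition var_matrix (delta eps : R) (x : R -> phase) (t : R) :
    'M[R]_(n + n) :=
  Jmx *m hessian ham (x t) + eps *: jac_pert (x t) t delta eps.

Definition pert_uncurried (y : phase * R^o * R^o * R^o) : phase :=
  let: (x, t, delta, eps) := y in pert x t delta eps.

Definition admissible (U : set phase) (r0 : nat) :=
  [/\ open U,
      forall x, U x -> let A := mass S (usubmx x) in
        A^T = A /\ forall u : cV, u != 0 -> 0 < dot u (A *m u),
      forall x t delta eps, U x -> 0 < delta -> 0 <= eps ->
        forcing S (usubmx x) (velocity x) (t + delta) delta eps =
        forcing S (usubmx x) (velocity x) t delta eps,
      Cr setT U r0.+1 ham
    & let A := [set y : phase * R^o * R^o * R^o |
                 [/\ U y.1.1.1, 0 < y.1.2 & 0 <= y.2]] in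
      Cr_on [set v | [/\ v.1.1.1 = 0, v.1.2 = 0 & v.2 = 0]] A r0.-1
        pert_uncurried /\
      Cr_on [set v | v.1.1.2 = 0] A r0 pert_uncurried].

Definition conservative_orbit (U : set phase) (tau : R) (Z : set phase) :=
  exists x : R -> phase,
    [/\ solution U (fun y _ => cons_field y) x, minimal_period tau x
      & Z = range x].

Definition m_normal (Pi : 'M[R]_(n + n)) (z : phase) :=
  geo_mult 1 Pi = 1%N \/
  geo_mult 1 Pi = 2%N /\
    ~ exists u : phase, cons_field z = (Pi - 1%:M) *m u.

(* x0 is the conservative solution with x0(0) = z, and P = m tau = l delta. *)
Definition melnikov (x0 : R -> phase) (P delta s : R) : R :=
  \int[lebesgue_measure]_(t in `[0, P])
    dot (grad ham (x0 (t + s))) (pert (x0 (t + s)) t delta 0).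

Definition sympl_linv {v} (RV : 'M[R]_(n + n, v + v)) : 'M[R]_(v + v, n + n) :=
  invmx (RV^T *m Jmx *m RV) *m RV^T *m Jmx.

Definition vol_contraction {v} (x0 : R -> phase) (X0 : R -> 'M[R]_(n + n))
    (P delta : R) (RV : 'M[R]_(n + n, v + v)) : R :=
  - (P * v%:R)^-1 * \int[lebesgue_measure]_(t in `[0, P])
    \tr (sympl_linv RV *m invmx (X0 t) *m jac_pert (x0 t) t delta 0
         *m X0 t *m RV).

(* A one-parameter family of periodic orbits near z, parametrized by the value of
   H: gam h' is a point of the orbit at the energy level h', and T h' is the
   minimal period of this orbit. *)
Definition orbit_family (U : set phase) (z : phase) (gam : R -> phase)
    (T : R -> R) :=
  gam (ham z) = z /\
  exists O : set R,
    [/\ open O, O (ham z), Cr setT O 1 (gam : R^o -> phase),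
        Cr setT O 1 (T : R^o -> R^o)
      & forall h, O h -> ham (gam h) = h /\
          exists2 y : R -> phase,
            solution U (fun u _ => cons_field u) y /\ y 0 = gam h
            & minimal_period (T h) y].

(* The values of r, at a point of an orbit and m times its minimal period,
   parametrize the same family: r is constant along each orbit and distinguishes
   the orbits. *)
Definition parametrizes (U : set phase) (m : nat) (z : phase)
    (gam : R -> phase) (T : R -> R) (r : phase -> R -> R) :=
  exists O : set R,
    [/\ open O, O (ham z),
        forall h, O h -> forall y : R -> phase,
          solution U (fun u _ => cons_field u) y -> y 0 = gam h ->
          forall t, r (y t) (m%:R * T h) = r (gam h) (m%:R * T h),
        forall h, O h ->
          {for h, continuous (fun h' => r (gam h') (m%:R * T h'))}
      & forall h1 h2, O h1 -> O h2 ->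
          r (gam h1) (m%:R * T h1) = r (gam h2) (m%:R * T h2) -> h1 = h2].

(* xe eps and Xe eps are x(.; xi(eps), delta(eps), eps) and the fundamental
   solution of its variational equation. *)
Definition perturbed_branch (U : set phase) (r : phase -> R -> R) (l : nat)
    (z : phase) (P e0 : R) (xi : R -> phase) (delta : R -> R)
    (xe : R -> R -> phase) (Xe : R -> R -> 'M[R]_(n + n)) :=
  [/\ 0 < e0,
      Cr_on setT (`[0, e0[ : set R) 1 (xi : R^o -> phase) /\
      Cr_on setT (`[0, e0[ : set R) 1 (delta : R^o -> R^o),
      exists K : R, \forall e \near 0^'+, `|xi e - z| <= K * e,
      exists K : R, \forall e \near 0^'+, `|l%:R * delta e - P| <= K * e
    & forall e, 0 < e < e0 ->
        [/\ 0 < delta e, r (xi e) (l%:R * delta e) = r z P,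
            solution U (forced_field (delta e) e) (xe e) /\ xe e 0 = xi e,
            periodic_fun (l%:R * delta e) (xe e)
          & fundamental (var_matrix (delta e) e (xe e)) (Xe e)]].

(* To be used with A the monodromy matrix of a periodic orbit, whose eigenvalues
   are the Floquet multipliers. *)
Definition floquet_unstable (A : 'M[R]_(n + n)) :=
  exists2 lam : R[i], eigenvalue (cmx A) lam & 1 < `|lam|.

End Mechanics.
Arguments mech : clear implicits.

(* Main.v *)
From HB Require Import structures.
Require Import Defs.
From mathcomp Require Import all_boot all_order all_algebra fingroup perm.
From mathcomp Require Import all_classical all_reals all_analysis.
From mathcomp Require Import complex ring lra.
From mathcomp Require polyrcf.
Set Implicit Arguments.
Unset Strict Implicit.
Unset Printing Implicit Defensive.
Import Order.TTheory GRing.Theory Num.Theory.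
Import numFieldNormedType.Exports.
Local Open Scope classical_set_scope.
Local Open Scope ring_scope.

(** The monodromy matrix of the perturbed orbit is a small perturbation Phi of Pi,
and each alternative of the theorem forces an eigenvalue of Phi out of the closed
unit disk.  Write f = J DH(z) for the flow direction.

First alternative of (i).  Since H(gam h) = h and the orbit through gam h has
period T h, the vector g = gam'(H z) satisfies <DH(z), g> = 1 and
(1 - Pi) g = m T' f, while Pi f = f.  So chi = det (x - Pi) has a double root at 1
with g above f in the Jordan chain, and
adj (1 - Pi) g = - m T' q(1) f, where chi = (x - 1)^2 q and q(1) > 0 because the
other eigenvalues are on the circle.  On the other side the covector DH(x(t))^T X(t)
is a first integral of the conservative variational flow and drifts at rate eps
under the perturbation: over one period, w Phi - w = eps be with w -> DH(z)^T, and
differentiating the Melnikov integral shows that be f -> M'(0).  Applying the row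
w (1 - Phi) = - eps be to adj (1 - Phi) g gives
    det (1 - Phi) <w, g> = - eps be adj (1 - Phi) g,
whose right-hand side divided by eps tends to m T' M'(0) q(1) < 0.  The characteristic
polynomial of Phi is thus negative at 1 and has a real root beyond 1
([unstable_of_real_multiplier], fed by [family_monodromy], [family_energy_transverse]
and [covector_limit]).

Negative volume contraction, on T or on another strongly invariant V.  The form
X^T J X is conserved for eps = 0 and drifts at rate eps, so that
Phi^T J Phi = J + eps G with G -> G0, an integral of X^T (q^T J + J q) X with
q = d_x g.  Strong invariance separates the spectrum of V from the rest of the
spectrum of Pi; hence J is nondegenerate on V and V persists as an invariant
subspace V + Y of Phi, with Phi (V + Y) = (V + Y) B' and Y -> 0
([strongly_invariant_split], [invariant_subspace_persists]).  Restricting the form to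
V + Y and taking determinants,
    (det B')^2 = 1 + eps tr (Om^-1 V^T G0 V) + o(eps),  Om = V^T J V,
and this trace is - 2 P v C_V > 0 ([form_limit]).  So |det B'| > 1 and some
eigenvalue of B', hence of Phi, lies outside the disk
([unstable_of_expanding_form]).  The second alternative of (i) is the case V = T.

The limits rest on elementary calculus for ordinary differential equations: a
Gronwall estimate in a tube around the unperturbed orbit, and the notion [jcvg] of
convergence jointly in the parameter and in the time. *)

(** * Limits and derivatives of matrix-valued functions *)

Section MatrixTopology.
Context {R : realType}.

Lemma mx_norm_le_iff m n (A : 'M[R]_(m, n)) (c : R) : 0 <= c ->
  (`|A| <= c) <-> (forall i j, `|A i j| <= c).
Proof.
move=> c0; rewrite [`|A|]/Num.Def.normr/= mx_normrE; split.
  by move=> /bigmax_leP[_ h] i j; apply: (h (i, j)).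
by move=> h; apply/bigmax_leP; split => // -[i j] _; apply: h.
Qed.

Lemma mx_entry_le m n (A : 'M[R]_(m, n)) i j : `|A i j| <= `|A|.
Proof. by move: i j; apply/(mx_norm_le_iff A (normr_ge0 A)). Qed.

Lemma mulmx_norm_le m n p (A : 'M[R]_(m, n)) (B : 'M[R]_(n, p)) :
  `|A *m B| <= n%:R * `|A| * `|B|.
Proof.
apply/mx_norm_le_iff => [|i j]; first by rewrite !mulr_ge0.
rewrite mxE (le_trans (ler_norm_sum _ _ _)) //.
rewrite (@le_trans _ _ (\sum_(k < n) `|A| * `|B|)) //.
  by apply: ler_sum => k _; rewrite normrM ler_pM ?mx_entry_le.
by rewrite sumr_const card_ord -mulrA mulr_natl.
Qed.

Lemma trmx_norm m n (A : 'M[R]_(m, n)) : `|A^T| = `|A|.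
Proof.
by apply/eqP; rewrite eq_le; apply/andP; split; apply/mx_norm_le_iff => // i j;
  [rewrite mxE | have := mx_entry_le A^T j i; rewrite mxE]; rewrite ?mx_entry_le.
Qed.

Lemma cvg_mxP (T : Type) {F : set_system T} {FF : Filter F} m n
    (f : T -> 'M[R]_(m, n)) (l : 'M[R]_(m, n)) :
  (f x @[x --> F] --> l) <-> (forall i j, f x i j @[x --> F] --> l i j).
Proof.
split=> [fl i j|fl].
  by apply: (cvg_comp _ (fun M : 'M[R]_(m, n) => M i j) fl); exact: coord_continuous.
apply/cvgrPdist_le => /= e e0.
have H : \forall x \near F, forall ij : 'I_m * 'I_n, `|l ij.1 ij.2 - f x ij.1 ij.2| <= e.
  apply: filter_forall => -[i j] /=.
  by have /cvgrPdist_le := fl i j; apply.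
apply: filterS H => x H; apply/mx_norm_le_iff; first exact: ltW.
by move=> i j; rewrite !mxE; apply: (H (i, j)).
Qed.

Lemma cvg_entry (T : Type) {F : set_system T} {FF : Filter F} m n
    (f : T -> 'M[R]_(m, n)) (l : 'M[R]_(m, n)) :
  f x @[x --> F] --> l -> forall i j, f x i j @[x --> F] --> l i j.
Proof. by move/cvg_mxP. Qed.

Lemma cvg_mx (T : Type) {F : set_system T} {FF : Filter F} m n
    (f : T -> 'M[R]_(m, n)) (l : 'M[R]_(m, n)) :
  (forall i j, f x i j @[x --> F] --> l i j) -> f x @[x --> F] --> l.
Proof. by move=> H; apply/cvg_mxP. Qed.

Lemma cvg_sum (V : normedModType R) (T : Type) {F : set_system T} {FF : Filter F}
    (I : Type) (r : seq I) (P : pred I) (f : I -> T -> V) (a : I -> V) :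
  (forall i, P i -> f i x @[x --> F] --> a i) ->
  \sum_(i <- r | P i) f i x @[x --> F] --> \sum_(i <- r | P i) a i.
Proof.
move=> fa; elim: r => [|i r IH].
  by under eq_fun do rewrite big_nil; rewrite big_nil; apply: cvg_cst.
under eq_fun do rewrite big_cons; rewrite big_cons.
by case: ifPn => // Pi; apply: cvgD => //; apply: fa.
Qed.

Lemma cvg_mulmx (T : Type) {F : set_system T} {FF : Filter F} m n p
    (f : T -> 'M[R]_(m, n)) (g : T -> 'M[R]_(n, p)) (a : 'M[R]_(m, n)) (b : 'M[R]_(n, p)) :
  f x @[x --> F] --> a -> g x @[x --> F] --> b ->
  f x *m g x @[x --> F] --> a *m b.
Proof.
move=> /cvg_mxP fa /cvg_mxP gb; apply/cvg_mxP => i j.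
under eq_fun do rewrite mxE; rewrite mxE.
by apply: cvg_sum => k _; apply: cvgM.
Qed.

Lemma cvg_trmx (T : Type) {F : set_system T} {FF : Filter F} m n
    (f : T -> 'M[R]_(m, n)) (a : 'M[R]_(m, n)) :
  f x @[x --> F] --> a -> (f x)^T @[x --> F] --> a^T.
Proof.
move=> /cvg_mxP fa; apply/cvg_mxP => i j; rewrite mxE.
by under eq_fun do rewrite mxE; apply: fa.
Qed.

Lemma cvg_prod_ord (T : Type) {F : set_system T} {FF : Filter F}
    (I : Type) (r : seq I) (P : pred I)
    (f : I -> T -> R) (a : I -> R) :
  (forall i, P i -> f i x @[x --> F] --> a i) ->
  \prod_(i <- r | P i) f i x @[x --> F] --> \prod_(i <- r | P i) a i.
Proof.
move=> fa; elim: r => [|i r IH].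
  by under eq_fun do rewrite big_nil; rewrite big_nil; apply: cvg_cst.
under eq_fun do rewrite big_cons; rewrite big_cons.
by case: ifPn => // Pi; apply: cvgM => //; apply: fa.
Qed.

Lemma cvg_det (T : Type) {F : set_system T} {FF : Filter F} n
    (f : T -> 'M[R]_n) (a : 'M[R]_n) :
  f x @[x --> F] --> a -> \det (f x) @[x --> F] --> \det a.
Proof.
move=> /cvg_mxP fa; apply: cvg_sum => s _.
by apply: cvgM; [exact: cvg_cst | apply: cvg_prod_ord => i _; apply: fa].
Qed.

Lemma cvg_adj (T : Type) {F : set_system T} {FF : Filter F} n
    (f : T -> 'M[R]_n) (a : 'M[R]_n) :
  f x @[x --> F] --> a -> \adj (f x) @[x --> F] --> \adj a.
Proof.
move=> /cvg_mxP fa; apply/cvg_mxP => i j; rewrite mxE.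
under eq_fun do rewrite mxE; apply: cvgM; first exact: cvg_cst.
apply: cvg_det; apply/cvg_mxP => k l; rewrite !mxE.
by under eq_fun do rewrite !mxE; apply: fa.
Qed.

Lemma cvg_mxtrace (T : Type) {F : set_system T} {FF : Filter F} n
    (f : T -> 'M[R]_n) (a : 'M[R]_n) :
  f x @[x --> F] --> a -> \tr (f x) @[x --> F] --> \tr a.
Proof. by move=> /cvg_mxP fa; apply: cvg_sum => s _; apply: fa. Qed.

Lemma cvg_invmx (T : Type) {F : set_system T} {FF : Filter F} n
    (f : T -> 'M[R]_n) (a : 'M[R]_n) : a \in unitmx ->
  f x @[x --> F] --> a -> invmx (f x) @[x --> F] --> invmx a.
Proof.
move=> ua fa.
have da : \det (f x) @[x --> F] --> \det a by exact: cvg_det.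
have a0 : \det a != 0 by rewrite -unitfE -unitmxE.
have H : \forall x \near F, (\det (f x))^-1 *: \adj (f x) = invmx (f x).
  near=> x; rewrite /invmx ifT// unitmxE unitfE; near: x.
  exact: (cvgr_neq0 _ da a0).
apply: cvg_trans.
  by apply: (@near_eq_cvg _ _ F FF (fun x => (\det (f x))^-1 *: \adj (f x))).
rewrite /invmx ua; apply: cvgZ; last exact: cvg_adj.
exact: cvgV.
Unshelve. all: by end_near. Qed.

Lemma is_derive_mxP m n (M : R -> 'M[R]_(m, n)) (t : R) (D : 'M[R]_(m, n)) :
  is_derive t (1 : R) M D <->
  (forall i j, is_derive t (1 : R) (fun s => M s i j) (D i j)).
Proof.
split=> [[dM DM] i j|H].
  have /derivable_mxP dM' := dM; apply: DeriveDef; first exact: dM'.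
  by rewrite -DM derive_mx// mxE.
have dM : derivable M t 1 by apply/derivable_mxP => i j; have [] := H i j.
apply: DeriveDef => //; rewrite derive_mx//; apply/matrixP => i j.
by rewrite mxE; apply: derive_val.
Qed.

Lemma is_derive_mulmx m n p (A : R -> 'M[R]_(m, n)) (B : R -> 'M[R]_(n, p)) t
    (A' : 'M[R]_(m, n)) (B' : 'M[R]_(n, p)) :
  is_derive t (1 : R) A A' -> is_derive t (1 : R) B B' ->
  is_derive t (1 : R) (fun s => A s *m B s) (A' *m B t + A t *m B').
Proof.
move=> /is_derive_mxP dA /is_derive_mxP dB; apply/is_derive_mxP => i j.
rewrite (_ : (fun s => _) = \sum_(k < n) (fun s => A s i k * B s k j)); last first.
  by apply/funext => s; rewrite mxE fct_sumE.
have H k : is_derive t (1 : R) (fun s => A s i k * B s k j)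
    (A t i k *: B' k j + B t k j *: A' i k).
  exact: is_deriveM.
apply: is_derive_eq (is_derive_sum H) _.
rewrite !mxE -big_split/=; apply: eq_bigr => k _.
by rewrite /GRing.scale/= addrC (mulrC (B t k j)).
Qed.

Lemma is_derive_trmx m n (A : R -> 'M[R]_(m, n)) t (A' : 'M[R]_(m, n)) :
  is_derive t (1 : R) A A' -> is_derive t (1 : R) (fun s => (A s)^T) A'^T.
Proof.
move=> /is_derive_mxP dA; apply/is_derive_mxP => i j; rewrite mxE.
by under eq_fun do rewrite mxE; apply: dA.
Qed.

Lemma is_derive_cont m n (A : R -> 'M[R]_(m, n)) t (A' : 'M[R]_(m, n)) :
  is_derive t (1 : R) A A' -> {for t, continuous A}.
Proof. by case=> /derivable1_diffP/differentiable_continuous. Qed.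

End MatrixTopology.

(** * Maps of class C1: strict differentiability, chain rule, symmetry of the Hessian *)

Section StrictDifferentiability.
Context {R : realType}.

Lemma is_derive_line (V W : normedModType R) (f : V -> W) (a v : V) (s : R) :
  derivable f (s *: v + a) v ->
  is_derive s (1 : R) (fun r => f (r *: v + a)) ('D_v f (s *: v + a)).
Proof.
move=> df.
have E : (fun h : R => h^-1 *: (f ((h *: 1 + s) *: v + a) - f (s *: v + a))) =
    (fun h => h^-1 *: (f (h *: v + (s *: v + a)) - f (s *: v + a))).
  by apply/funext => h; rewrite scalerDl -addrA /GRing.scale/= mulr1.
by apply: DeriveDef; rewrite /derivable /derive /= E.
Qed.

Lemma line_mvt (V : normedModType R) (f : V -> R) (a v : V) (c : R) :
  (forall s, 0 <= s <= c \/ c <= s <= 0 -> derivable f (s *: v + a) v) ->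
  exists2 s, 0 <= s <= c \/ c <= s <= 0 &
    f (c *: v + a) - f a = 'D_v f (s *: v + a) * c.
Proof.
move=> df.
have E0 : f a = f (0 *: v + a) by rewrite scale0r add0r.
pose phi r := f (r *: v + a).
have dphi s : 0 <= s <= c \/ c <= s <= 0 -> is_derive s (1 : R) phi ('D_v f (s *: v + a)).
  by move=> hs; apply: is_derive_line; apply: df.
have cphi s : 0 <= s <= c \/ c <= s <= 0 -> {for s, continuous phi}.
  by move=> /dphi[/derivable1_diffP/differentiable_continuous].
have [c0|c0] := leP 0 c.
  have [||s] := @MVT_segment R phi (fun s => 'D_v f (s *: v + a)) 0 c c0.
  - by move=> s /[!in_itv]/= /andP[s0 sc]; apply: dphi; left; rewrite !ltW.
  - by apply: continuous_in_subspaceT => s /[!inE]/= /[!in_itv]/= hs; apply: cphi; left.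
  rewrite in_itv/= subr0 => hs E; exists s; first by left.
  by rewrite E0 -E.
have [||s] := @MVT_segment R phi (fun s => 'D_v f (s *: v + a)) c 0 (ltW c0).
- by move=> s /[!in_itv]/= /andP[s0 sc]; apply: dphi; right; rewrite !ltW.
- by apply: continuous_in_subspaceT => s /[!inE]/= /[!in_itv]/= hs; apply: cphi; right.
rewrite in_itv/= sub0r => hs E; exists s; first by right.
by rewrite E0 -[LHS]opprB [X in - X]E mulrN opprK.
Qed.

(** Telescoping along the coordinates, from y' to y, reduces the claim to the
mean value theorem on segments parallel to the axes; continuity of the partial
derivatives at x alone then gives an estimate uniform in both points. *)
Lemma strict_derivative k (U : set 'cV[R]_k) (f : 'cV[R]_k -> R) x :
  open U -> U x ->
  (forall y, U y -> forall i, derivable f y (delta_mx i 0)) ->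
  (forall i, {for x, continuous (fun y => 'D_(delta_mx i 0) f y)}) ->
  forall eta, 0 < eta -> exists2 rho, 0 < rho &
    forall y y', `|y - x| < rho -> `|y' - x| < rho ->
      `|f y - f y' - dot (grad f x) (y - y')| <= eta * `|y - y'|.
Proof.
move=> oU Ux df cf eta eta0.
pose eta' := eta / k.+1%:R.
have eta'0 : 0 < eta' by rewrite divr_gt0.
have H : \forall y \near x, U y /\
    forall i, `|'D_(delta_mx i 0) f x - 'D_(delta_mx i 0) f y| <= eta'.
  have H2 : \forall y \near x,
    forall i, `|'D_(delta_mx i 0) f x - 'D_(delta_mx i 0) f y| <= eta'.
    have H3 i : \forall y \near x, `|'D_(delta_mx i 0) f x - 'D_(delta_mx i 0) f y| <= eta'.
      by have /cvgrPdist_le := cf i; apply.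
    exact: (@filter_forall _ _ (fun i y => `|'D_(delta_mx i 0) f x - 'D_(delta_mx i 0) f y| <= eta') (nbhs x) _ H3).
  by apply: filterI => //; exact: open_nbhs_nbhs.
have [rho /= rho0 Hrho] := (@nbhs_normP _ _ _ _).1 H.
exists rho => // y y' hy hy'.
(* mix j has the first j coordinates of y and the others of y'. *)
pose mix (j : nat) : 'cV[R]_k := \col_i (if (i < j)%N then y i 0 else y' i 0).
have mix0 : mix 0%N = y' by apply/colP => i; rewrite mxE.
have mixk : mix k = y by apply/colP => i; rewrite mxE ltn_ord.
have step (j : 'I_k) : mix j.+1 = (y j 0 - y' j 0) *: delta_mx j 0 + mix j.
  apply/colP => i; rewrite !mxE ltnS leq_eqVlt eqxx andbT.
  have [->|ne] := eqVneq i j; first by rewrite eqxx ltnn mulr1 subrK.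
  by rewrite (inj_eq val_inj) (negbTE ne) mulr0 add0r.
have seg (j : 'I_k) s : 0 <= s <= y j 0 - y' j 0 \/ y j 0 - y' j 0 <= s <= 0 ->
    U (s *: delta_mx j 0 + mix j) /\ forall i, `|'D_(delta_mx i 0) f x -
        'D_(delta_mx i 0) f (s *: delta_mx j 0 + mix j)| <= eta'.
  move=> hs; apply: Hrho; rewrite /= -normrN opprB.
  have hi i : `|y i 0 - x i 0| < rho.
    by apply: le_lt_trans hy; have := mx_entry_le (y - x) i 0; rewrite !mxE.
  have hi' i : `|y' i 0 - x i 0| < rho.
    by apply: le_lt_trans hy'; have := mx_entry_le (y' - x) i 0; rewrite !mxE.
  pose r := Num.max `|y - x| `|y' - x|.
  suff : `|s *: delta_mx j 0 + mix j - x| <= r.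
    by move=> /le_lt_trans; apply; rewrite /r gt_max hy.
  apply/mx_norm_le_iff => [|i l]; first by rewrite /r le_max normr_ge0.
  rewrite (ord1 l) !mxE eqxx andbT {l}.
  have A1 : `|y i 0 - x i 0| <= r.
    by rewrite /r le_max; have := mx_entry_le (y - x) i 0; rewrite !mxE => ->.
  have A2 : `|y' i 0 - x i 0| <= r.
    by rewrite /r le_max; have := mx_entry_le (y' - x) i 0; rewrite !mxE => ->; rewrite orbT.
  move: A1 A2; have [->|ne] := eqVneq i j; last first.
    by move=> A1 A2; rewrite mulr0 add0r; case: ifP.
  rewrite ltnn mulr1 !ler_norml => /andP[a1 a2] /andP[a3 a4].
  by apply/andP; split; case: hs => /andP[] *; lra.
have -> : f y - f y' = \sum_(j < k) (f (mix j.+1) - f (mix j)).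
  rewrite -(big_mkord xpredT (fun j => f (mix j.+1) - f (mix j))).
  by rewrite telescope_sumr// mixk mix0.
rewrite /dot mxE -sumrB.
apply: le_trans (ler_norm_sum _ _ _) _.
apply: (@le_trans _ _ (\sum_(j < k) eta' * `|y - y'|)).
  apply: ler_sum => j _; rewrite !mxE step.
  have [|s hs ->] := @line_mvt _ f (mix j) (delta_mx j 0) (y j 0 - y' j 0).
    by move=> s hs; apply: df; have [] := seg j s hs.
  rewrite -mulrBl normrM ler_pM//.
    by rewrite -normrN opprB; have [_] := seg j s hs; apply.
  by have := mx_entry_le (y - y') j 0; rewrite !mxE.
rewrite sumr_const card_ord -mulr_natl mulrA ler_wpM2r// /eta' mulrCA ger_pMr//.
by rewrite ler_pdivrMr// mul1r ler_nat.
Qed.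

(** The difference quotient with the increment written h + t, the form in which
the limits below are taken. *)
Lemma is_derive_cvgP (W : normedModType R) (c : R -> W) (t : R) (d : W) :
  is_derive t (1 : R) c d <-> h^-1 *: (c (h + t) - c t) @[h --> 0^'] --> d.
Proof.
have E : (fun h : R => h^-1 *: ((c \o shift t) (h *: 1) - c t)) =
    (fun h => h^-1 *: (c (h + t) - c t)).
  by apply/funext => h; rewrite /= /GRing.scale/= mulr1.
split=> [[dc <-]|H].
  by move: dc; rewrite /derivable /derive E.
by apply: DeriveDef; rewrite /derivable /derive E; [apply/cvg_ex; exists d | apply/cvg_lim].
Qed.

Lemma dotZr k (u v : 'cV[R]_k) a : dot u (a *: v) = a * dot u v.
Proof. by rewrite /dot -scalemxAr mxE. Qed.

(** Existence and continuity of partial derivatives suffice, by strict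
differentiability at the point of the curve. *)
Lemma chain_rule k (U : set 'cV[R]_k) (f : 'cV[R]_k -> R) (c : R -> 'cV[R]_k) t c' :
  open U -> U (c t) ->
  (forall y, U y -> forall i, derivable f y (delta_mx i 0)) ->
  (forall i, {for c t, continuous (fun y => 'D_(delta_mx i 0) f y)}) ->
  is_derive t (1 : R) c c' ->
  is_derive t (1 : R) (fun s => f (c s)) (dot (grad f (c t)) c').
Proof.
move=> oU Uc df cf dc.
have /is_derive_cvgP qc := dc.
pose q h := h^-1 *: (c (h + t) - c t).
apply/is_derive_cvgP/cvgrPdist_le => e e0.
pose B := `|c'| + 1.
have B0 : 0 < B by rewrite ltr_pwDr.
have [|rho rho0 Hr] := strict_derivative oU Uc df cf (eta := e / 2 / B).
  by rewrite !divr_gt0.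
pose g := grad f (c t).
have cct : c (h + t) @[h --> (0 : R)^'] --> c t.
  have : {for t, continuous c} := is_derive_cont dc.
  rewrite /continuous_at => cc.
  apply: (@cvg_trans _ (c (h + t) @[h --> (0 : R)])).
    by move=> A HA; apply: nbhs_dnbhs; exact: HA.
  have : h + t @[h --> (0 : R)] --> t.
    by rewrite -[X in _ --> X]add0r; apply: cvgD; [exact: cvg_id | exact: cvg_cst].
  by move/cvg_comp; apply.
have dq : dot g (q h) @[h --> (0 : R)^'] --> dot g c'.
  rewrite /dot; have : g^T *m q h @[h --> (0 : R)^'] --> g^T *m c'.
    by apply: cvg_mulmx => //; exact: cvg_cst.
  by move/cvg_entry; apply.
near=> h.
have h0 : h != 0 by near: h; exact: nbhs_dnbhs_neq.
rewrite -(subrKA (dot g (q h))) (splitr e) (le_trans (ler_normD _ _))// lerD//.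
  by near: h; move/cvgrPdist_le : dq; apply; rewrite divr_gt0.
rewrite /q dotZr -mulrBr normrM distrC.
have Hh := Hr (c (h + t)) (c t).
apply: (@le_trans _ _ (`|h^-1| * (e / 2 / B * `|c (h + t) - c t|))).
  rewrite ler_wpM2l// Hh// ?subrr ?normr0// distrC.
  by near: h; move/cvgrPdist_lt : cct; apply.
rewrite mulrCA -normrZ -/(q h) -[leRHS](@divfK _ B) ?gt_eqF// ler_wpM2l ?divr_ge0 ?ltW//.
rewrite -(subrK c' (q h)) (le_lt_trans (ler_normD _ _))// /B addrC ltrD2l.
by rewrite distrC; near: h; move/cvgrPdist_lt : qc => /(_ 1 ltr01).
Unshelve. all: by end_near. Qed.

(** Only the partial derivatives are mentioned: this is what the iterated
directional derivatives of the regularity hypotheses provide. *)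
Definition C1 k l (U : set 'cV[R]_k) (f : 'cV[R]_k -> 'cV[R]_l) :=
  open U /\ forall x, U x -> forall i, derivable f x (delta_mx i 0) /\ {for x, continuous (fun y => 'D_(delta_mx i 0) f y)}.

Lemma C1_coord k l (U : set 'cV[R]_k) (f : 'cV[R]_k -> 'cV[R]_l) (i : 'I_l) :
  C1 U f ->
  (forall y, U y -> forall j, derivable (fun y => f y i 0) y (delta_mx j 0)) /\
  (forall x, U x -> forall j, {for x, continuous (fun y => 'D_(delta_mx j 0) (fun y => f y i 0) y)}).
Proof.
move=> [oU H]; split=> [y Uy j|x Ux j].
  by have [/derivable_mxP + _] := H y Uy j; apply.
have [_ cf] := H x Ux j.
have E : \forall y \near x, 'D_(delta_mx j 0) f y i 0 = 'D_(delta_mx j 0) (fun y => f y i 0) y.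
  have : \forall y \near x, U y by exact: open_nbhs_nbhs.
  apply: filterS => y Uy; have [dfy _] := H y Uy j.
  by rewrite derive_mx// mxE.
have cc : 'D_(delta_mx j 0) f y i 0 @[y --> x] --> 'D_(delta_mx j 0) f x i 0.
  exact: (@cvg_entry _ _ (nbhs x) (nbhs_filter x) _ _ _ _ cf).
rewrite (nbhs_singleton E) in cc.
exact: cvg_trans (near_eq_cvg E) cc.
Qed.

Lemma jac_row k l (U : set 'cV[R]_k) (f : 'cV[R]_k -> 'cV[R]_l) x (i : 'I_l) :
  C1 U f -> U x -> (grad (fun y => f y i 0) x)^T = row i (jac f x).
Proof.
move=> [oU H] Ux; apply/rowP => j; rewrite !mxE; have [dfx _] := H x Ux j.
by rewrite derive_mx// mxE.
Qed.

Lemma C1_strict k l (U : set 'cV[R]_k) (f : 'cV[R]_k -> 'cV[R]_l) x :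
  C1 U f -> U x ->
  forall eta, 0 < eta -> exists2 rho, 0 < rho &
    forall y y', `|y - x| < rho -> `|y' - x| < rho ->
      `|f y - f y' - jac f x *m (y - y')| <= eta * `|y - y'|.
Proof.
move=> H Ux eta eta0; have [oU _] := H.
have H1 (i : 'I_l) : \forall rho \near (0 : R)^'+,
    forall y y', `|y - x| < rho -> `|y' - x| < rho ->
      `|f y i 0 - f y' i 0 - dot (grad (fun y => f y i 0) x) (y - y')| <= eta * `|y - y'|.
  have [d c] := C1_coord i H.
  have [rho rho0 Hr] := strict_derivative oU Ux d (c x Ux) eta0.
  near=> r => y y' hy hy'.
  by apply: Hr; apply: (lt_trans (_ : _ < r)) => //; near: r; exact: nbhs_right_lt.
have H2 := filter_forall (at_right_proper_filter 0) H1.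
have [rho [H3 rho0]] := filter_ex (filterI H2 (nbhs_right_gt (0 : R))).
exists rho => // y y' hy hy'.
apply/mx_norm_le_iff => [|i j]; first by rewrite mulr_ge0// ltW.
have := H3 i y y' hy hy'.
by rewrite (ord1 j) /dot (jac_row _ H Ux) -row_mul !mxE.
Unshelve. all: by end_near. Qed.

Lemma C1_chain k l (U : set 'cV[R]_k) (f : 'cV[R]_k -> 'cV[R]_l) c t c' :
  C1 U f -> U (c t) -> is_derive t (1 : R) c c' ->
  is_derive t (1 : R) (fun s => f (c s)) (jac f (c t) *m c').
Proof.
move=> H Uc dc; have [oU _] := H; apply/is_derive_mxP => i j; rewrite (ord1 j).
have [d cc] := C1_coord i H.
have := chain_rule oU Uc d (cc _ Uc) dc.
by rewrite /dot (jac_row _ H Uc) -row_mul mxE.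
Qed.

Lemma C1_jac_continuous k l (U : set 'cV[R]_k) (f : 'cV[R]_k -> 'cV[R]_l) x :
  C1 U f -> U x -> {for x, continuous (jac f)}.
Proof.
move=> [_ H] Ux; suff : jac f y @[y --> x] --> jac f x by [].
apply: (@cvg_mx _ _ (nbhs x) (nbhs_filter x)) => i j; rewrite /jac !mxE.
under eq_fun do rewrite mxE.
have [_ cf] := H x Ux j.
have {}cf : 'D_(delta_mx j 0) f y @[y --> x] --> 'D_(delta_mx j 0) f x by [].
exact: (@cvg_entry _ _ (nbhs x) (nbhs_filter x) _ _ _ _ cf).
Qed.

Lemma C1_continuous k l (U : set 'cV[R]_k) (f : 'cV[R]_k -> 'cV[R]_l) x :
  C1 U f -> U x -> {for x, continuous f}.
Proof.
move=> H Ux; have [rho rho0 Hr] := C1_strict H Ux ltr01.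
suff : f y @[y --> x] --> f x by [].
apply/(@cvgrPdist_le _ _ _ _ (nbhs_filter x)) => e e0.
pose B := k%:R * `|jac f x| + 1.
have B0 : 0 < B by rewrite ltr_pwDr// mulr_ge0.
have eB : 0 < e / B by exact: divr_gt0.
near=> y.
have yx : `|x - y| <= e / B.
  by near: y; exact: (@cvgr_dist_le _ _ _ _ (nbhs_filter x) id x cvg_id _ eB).
have yr : `|y - x| < rho.
  by rewrite distrC; near: y; exact: (@cvgr_dist_lt _ _ _ _ (nbhs_filter x) id x cvg_id).
apply: (@le_trans _ _ (B * `|x - y|)); last by rewrite mulrC -ler_pdivlMr.
rewrite -(subrK (jac f x *m (x - y)) (f x - f y)) (le_trans (ler_normD _ _))//.
rewrite /B mulrDl addrC lerD//; first exact: mulmx_norm_le.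
by apply: le_trans (Hr _ _ _ yr) _; rewrite ?mul1r// subrr normr0.
Unshelve. all: by end_near. Qed.

Lemma is_derive_translate (V W : normedModType R) (f : V -> W) (b p v : V) :
  derivable f (b + p) v ->
  is_derive p v (fun y => f (b + y)) ('D_v f (b + p)).
Proof.
move=> df.
have E : (fun h : R => h^-1 *: (f (b + (h *: v + p)) - f (b + p))) =
    (fun h => h^-1 *: (f (h *: v + (b + p)) - f (b + p))).
  by apply/funext => h; rewrite addrCA.
by apply: DeriveDef; rewrite /derivable /derive /= E.
Qed.

Lemma delta_norm k (i : 'I_k) (a : R) : `|a *: (delta_mx i 0 : 'cV[R]_k)| <= `|a|.
Proof.
apply/mx_norm_le_iff => // p q; rewrite !mxE normrM.
by case: (_ && _); rewrite ?normr1 ?mulr1// normr0 mulr0.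
Qed.

(** Schwarz's theorem.  The mixed second difference of f with steps h in both
directions is symmetric in the two directions, and each order of differencing
approximates it by h^2 times one of the two mixed entries, up to o(h^2). *)
Lemma hessian_sym k (U : set 'cV[R]_k) (f : 'cV[R]_k -> R) x :
  C1 U (grad f) -> (forall y, U y -> forall i, derivable f y (delta_mx i 0)) -> U x ->
  (hessian f x)^T = hessian f x.
Proof.
move=> H df Ux; have [oU _] := H; apply/matrixP => i j; rewrite mxE.
have key (i' j' : 'I_k) eta : 0 < eta -> \forall h \near (0 : R)^'+,
  `|f (h *: delta_mx j' 0 + (h *: delta_mx i' 0 + x)) - f (h *: delta_mx i' 0 + x)
   - (f (h *: delta_mx j' 0 + x) - f x) - hessian f x i' j' * h ^+ 2| <= eta * h ^+ 2.
  move=> eta0; have [rho rho0 Hr] := C1_strict H Ux eta0.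
  have [r0 /= r00 Hr0] := (@nbhs_normP _ _ _ _).1 (open_nbhs_nbhs (conj oU Ux)).
  near=> h.
  have h0 : 0 < h by [].
  have hr : h + h < rho.
    have : h < rho / 2 by near: h; apply: nbhs_right_lt; rewrite divr_gt0.
    by rewrite ltr_pdivlMr// mulr_natr.
  have hr0 : h + h < r0.
    have : h < r0 / 2 by near: h; apply: nbhs_right_lt; rewrite divr_gt0.
    by rewrite ltr_pdivlMr// mulr_natr.
  (* The mean value theorem in direction i' is applied to the difference in
     direction j'. *)
  pose g y := f (h *: delta_mx j' 0 + y) - f y.
  have pts s : 0 <= s <= h \/ h <= s <= 0 ->
     `|s *: delta_mx i' 0 + x - x| <= h /\
     `|h *: delta_mx j' 0 + (s *: delta_mx i' 0 + x) - x| <= h + h.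
    move=> hs; have sh : `|s| <= h by rewrite ler_norml; case: hs => /andP[]; lra.
    rewrite addrK addrA addrK; split; first exact: le_trans (delta_norm _ _) _.
    apply: le_trans (ler_normD _ _) _; apply: lerD.
      by apply: le_trans (delta_norm _ _) _; rewrite ger0_norm// ltW.
    exact: le_trans (delta_norm _ _) _.
  have ptU s : 0 <= s <= h \/ h <= s <= 0 -> U (s *: delta_mx i' 0 + x) /\
      U (h *: delta_mx j' 0 + (s *: delta_mx i' 0 + x)).
    move=> /pts[p1 p2]; split; apply: Hr0; rewrite /= distrC.
      by apply: le_lt_trans p1 _; apply: lt_trans hr0; rewrite ltrDl.
    exact: le_lt_trans p2 _.
  have dg s : 0 <= s <= h \/ h <= s <= 0 -> is_derive (s *: delta_mx i' 0 + x)
      (delta_mx i' 0) g ((grad f (h *: delta_mx j' 0 + (s *: delta_mx i' 0 + x))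
                    - grad f (s *: delta_mx i' 0 + x)) i' 0).
    move=> /ptU[u1 u2]; rewrite !mxE; apply: is_deriveB.
      exact/is_derive_translate/df.
    exact/derivableP/df.
  have [|s hs] := @line_mvt _ g x (delta_mx i' 0) h.
    by move=> s /dg[].
  rewrite /g => ->; have -> := @derive_val _ _ _ _ _ _ _ (dg s hs).
  have [p1 p2] := pts s hs.
  have := Hr _ _ (le_lt_trans p2 hr) (le_lt_trans p1 (lt_trans (_ : h < h + h) hr)).
  rewrite ltrDl => /(_ h0); rewrite addrK -scalemxAr => B.
  have -> : hessian f x i' j' * h ^+ 2 = (h *: (hessian f x *m (delta_mx j' 0 : 'cV[R]_k))) i' 0 * h.
    by rewrite -colE [X in _ = X * _]mxE [X in _ = _ * X * _]mxE; ring.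
  rewrite -mulrBl normrM (ger0_norm (ltW h0)) expr2 mulrA ler_wpM2r ?(ltW h0)//.
  rewrite (_ : _ - _ = (grad f (h *: delta_mx j' 0 + (s *: delta_mx i' 0 + x))
      - grad f (s *: delta_mx i' 0 + x) - h *: (hessian f x *m delta_mx j' 0)) i' 0); last first.
    by rewrite [RHS]mxE [X in _ = _ + X]mxE.
  apply: le_trans (mx_entry_le _ _ _) _; apply: le_trans B _.
  by rewrite ler_wpM2l ?(ltW eta0)// (le_trans (delta_norm _ _))// ger0_norm// ltW.
apply/eqP; rewrite -subr_eq0 -normr_le0; apply/ler_addgt0Pr => e e0; rewrite add0r.
have e2 : 0 < e / 2 by exact: divr_gt0.
have [h [[A1 A2] h0]] :=
  filter_ex (filterI (filterI (key i j _ e2) (key j i _ e2)) (nbhs_right_gt (0 : R))).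
rewrite -(@ler_pM2r _ (h ^+ 2)) ?exprn_gt0// -{1}(@ger0_norm _ (h ^+ 2)) ?sqr_ge0//.
rewrite -normrM mulrBl.
move: A1 A2; rewrite !ler_norml (addrCA (h *: delta_mx i 0)).
by move=> /andP[a1 a2] /andP[a3 a4]; apply/andP; split; lra.
Unshelve. all: by end_near. Qed.

End StrictDifferentiability.

(** * Convergence jointly in a parameter and in the time *)

Section JointConvergence.
Context {R : realType}.

(** Compactness of [0, L]: a property that holds near every time, for all
parameters far enough along the filter, holds at all times at once. *)
Lemma near_segment (L : R) (I : Type) (F : set_system I) (FF : Filter F)
    (P : I -> R -> Prop) :
  (forall t, 0 <= t <= L -> \forall s \near t & i \near F, 0 <= s <= L -> P i s) ->
  \forall i \near F, forall t, 0 <= t <= L -> P i t.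
Proof.
move=> H.
have /compact_near_coveringP/near_covering_withinP cv := @segment_compact R 0 L.
have {}cv := cv I F (fun i t => P i t) FF.
have H2 : forall t, `[0, L]%classic t -> \forall s \near t & i \near F,
    `[0, L]%classic s -> P i s.
  move=> t /=; rewrite in_itv/= => /H; apply: filterS => -[s i] /= Hs.
  by rewrite in_itv/=.
apply: filterS (cv H2) => i Hi t tL; apply: Hi.
by rewrite /= in_itv.
Qed.

(** Convergence f i t -> f0 t0 as i runs along F and t -> t0 within [0, L], at every
t0.  For continuous f0 this is uniform convergence on [0, L], but in this form it
passes through sums, products and composition with continuous maps without any
estimate. *)
Definition jcvg (L : R) (I : Type) (F : set_system I) (V : normedModType R)
    (f : I -> R -> V) (f0 : R -> V) :=
  forall t, 0 <= t <= L ->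
    f p.1 p.2 @[p --> filter_prod F (within [set s | 0 <= s <= L] (nbhs t))] --> f0 t.

Lemma jcvg_uniform (L : R) I (F : set_system I) (FF : Filter F) (V : normedModType R)
    (f : I -> R -> V) (f0 : R -> V) :
  (forall t, 0 <= t <= L -> {for t, continuous f0}) -> jcvg L F f f0 ->
  forall eta, 0 < eta -> \forall i \near F, forall t, 0 <= t <= L ->
    `|f i t - f0 t| <= eta.
Proof.
move=> cf0 H eta eta0; apply: near_segment => t tL.
have e2 : 0 < eta / 2 by exact: divr_gt0.
have /cvgrPdist_le/(_ _ e2) [[A B] /= [FA wB] AB] := H t tL.
have {}cf0 : f0 s @[s --> t] --> f0 t := cf0 t tL.
have /cvgrPdist_le/(_ _ e2) ct := cf0.
have wB' : \forall s \near t, 0 <= s <= L -> B s by exact: wB.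
exists ([set s | 0 <= s <= L -> B s] `&` [set s | `|f0 t - f0 s| <= eta / 2], A).
  by split => //; exact: filterI.
move=> [s i] /= [[Bs fs] Ai] sL.
have /= := AB (i, s) (conj Ai (Bs sL)) => fi.
rewrite -(subrKA (f0 t)) (le_trans (ler_normD _ _))// (splitr eta) lerD//.
by rewrite distrC.
Qed.

Lemma uniform_jcvg (L : R) I (F : set_system I) (FF : Filter F) (V : normedModType R)
    (f : I -> R -> V) (f0 : R -> V) :
  (forall t, 0 <= t <= L -> {for t, continuous f0}) ->
  (forall eta, 0 < eta -> \forall i \near F, forall t, 0 <= t <= L ->
    `|f i t - f0 t| <= eta) -> jcvg L F f f0.
Proof.
move=> cf0 H t tL; apply/cvgrPdist_le => eta eta0.
have e2 : 0 < eta / 2 by exact: divr_gt0.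
have {}cf0 : f0 s @[s --> t] --> f0 t := cf0 t tL.
have /cvgrPdist_le/(_ _ e2) ct := cf0.
exists ([set i | forall t, 0 <= t <= L -> `|f i t - f0 t| <= eta / 2],
        [set s | 0 <= s <= L /\ `|f0 t - f0 s| <= eta / 2]).
  split => /=; first exact: H.
  rewrite /within/=; apply: filterS ct => s fs sL; split => //.
move=> [i s] /= [Hi [sL fs]].
rewrite -(subrKA (f0 s)) (le_trans (ler_normD _ _))// (splitr eta) lerD//.
by rewrite distrC Hi.
Qed.

(** Evaluation at a time that depends on the parameter, such as the period of
the perturbed orbit. *)
Lemma jcvg_at L I (F : set_system I) (FF : Filter F) (V : normedModType R)
    (f : I -> R -> V) (f0 : R -> V) (s : I -> R) s0 :
  jcvg L F f f0 -> 0 < s0 < L -> s i @[i --> F] --> s0 ->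
  f i (s i) @[i --> F] --> f0 s0.
Proof.
move=> H /andP[s1 s2] ss.
have sL : 0 <= s0 <= L by rewrite !ltW.
have {}H := H s0 sL.
apply: (@cvg_comp _ _ _ (fun i => (i, s i)) (fun p => f p.1 p.2)); last exact: H.
have key : s i @[i --> F] --> within [set s | 0 <= s <= L] (nbhs s0); last first.
  exact: (@cvg_pair _ _ _ F F (within [set s | 0 <= s <= L] (nbhs s0)) _ _ _ id s cvg_id key).
move=> A wA.
have HL : \forall i \near F, 0 <= s i <= L.
  near=> i; apply/andP; split; apply: ltW.
  - by near: i; exact: cvgr_gt ss _ s1.
  - by near: i; exact: cvgr_lt ss _ s2.
have wA' : \forall s \near s0, 0 <= s <= L -> A s by exact: wA.
have := ss _ wA'; rewrite /= /nbhs /=; apply: filterS2 HL.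
by move=> i hi; apply.
Unshelve. all: by end_near. Qed.

Lemma jcvg_comp (L : R) I (F : set_system I) (FF : Filter F) (V : normedModType R)
    (W : normedModType R) (f : I -> R -> V) (f0 : R -> V) (g : V -> W) :
  jcvg L F f f0 -> (forall t, 0 <= t <= L -> {for f0 t, continuous g}) ->
  jcvg L F (fun i t => g (f i t)) (fun t => g (f0 t)).
Proof.
move=> H cg t tL; have cg' : g y @[y --> f0 t] --> g (f0 t) := cg t tL.
exact: (cvg_comp _ _ (H t tL) cg').
Qed.

Lemma jcvg_cst (L : R) I (F : set_system I) (FF : Filter F) (V : normedModType R)
  (f0 : R -> V) : (forall t, 0 <= t <= L -> {for t, continuous f0}) ->
  jcvg L F (fun _ => f0) f0.
Proof.
move=> cf0; apply: uniform_jcvg => // eta eta0.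
by apply: nearW => i t _; rewrite subrr normr0 ltW.
Qed.

Lemma jcvg_mulmx L I (F : set_system I) (FF : Filter F) m n p
    (f : I -> R -> 'M[R]_(m, n)) (g : I -> R -> 'M[R]_(n, p)) f0 g0 :
  jcvg L F f f0 -> jcvg L F g g0 ->
  jcvg L F (fun i t => f i t *m g i t) (fun t => f0 t *m g0 t).
Proof. by move=> H1 H2 t tL; apply: cvg_mulmx; [exact: H1|exact: H2]. Qed.

Lemma jcvg_trmx L I (F : set_system I) (FF : Filter F) m n
    (f : I -> R -> 'M[R]_(m, n)) f0 :
  jcvg L F f f0 ->
  jcvg L F (fun i t => (f i t)^T) (fun t => (f0 t)^T).
Proof. by move=> H1 t tL; apply: cvg_trmx; exact: H1. Qed.

Lemma jcvgD L I (F : set_system I) (FF : Filter F) (V : normedModType R)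
    (f g : I -> R -> V) f0 g0 :
  jcvg L F f f0 -> jcvg L F g g0 ->
  jcvg L F (fun i t => f i t + g i t) (fun t => f0 t + g0 t).
Proof. by move=> H1 H2 t tL; apply: cvgD; [exact: H1|exact: H2]. Qed.

Lemma segment_bounded (L : R) (V : normedModType R) (f0 : R -> V) :
  (forall t, 0 <= t <= L -> {for t, continuous f0}) ->
  exists2 B, 0 < B & forall t, 0 <= t <= L -> `|f0 t| <= B.
Proof.
move=> cf0.
have : \forall M \near +oo, forall t, 0 <= t <= L -> `|f0 t| <= M.
  apply: near_segment => t tL.
  have {}cf0 : f0 s @[s --> t] --> f0 t := cf0 t tL.
  exists ([set s | `|f0 s| < `|f0 t| + 1], [set M | `|f0 t| + 1 <= M]).
    split => /=; last exact: nbhs_pinfty_ge.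
    by apply: cvgr_norm_lt cf0 _ _; rewrite ltrDl.
  by move=> [s M] /= [h1 h2] _; rewrite ltW// (lt_le_trans h1).
move=> H; have [B [HB B0]] := filter_ex (filterI H (nbhs_pinfty_gt (num_real (0 : R)))).
by exists B.
Qed.

End JointConvergence.

(** * Gronwall estimates *)

Section Gronwall.
Context {R : realType}.

(** Entrywise mean value theorem; the sup norm on matrices makes the constant 1. *)
Lemma mean_value_ineq m n (U U' : R -> 'M[R]_(m, n)) (L B : R) :
  (forall t, 0 <= t <= L -> is_derive t (1 : R) U (U' t)) ->
  (forall t, 0 <= t <= L -> `|U' t| <= B) ->
  forall t, 0 <= t <= L -> `|U t - U 0| <= B * t.
Proof.
move=> dU HB t /andP[t0 tL].
have h0L : (0 : R) <= 0 <= L by rewrite lexx (le_trans t0 tL).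
have B0 : 0 <= B := le_trans (normr_ge0 _) (HB 0 h0L).
apply/mx_norm_le_iff => [|i j]; first exact: mulr_ge0.
have sub s : 0 <= s <= t -> 0 <= s <= L.
  by move=> /andP[-> /le_trans]; apply.
have dij s : 0 <= s <= t -> is_derive s (1 : R) (fun s => U s i j) (U' s i j).
  by move=> /sub/dU/is_derive_mxP.
have [||s] := @MVT_segment R (fun s => U s i j) (fun s => U' s i j) 0 t t0.
- by move=> s /[!in_itv]/= /andP[s0 st]; apply: dij; rewrite !ltW.
- apply: continuous_in_subspaceT => s /[!inE]/= /[!in_itv]/= hs.
  by have [/derivable1_diffP/differentiable_continuous] := dij s hs.
rewrite in_itv/= subr0 => hs E; rewrite !mxE E normrM (ger0_norm t0).
by rewrite ler_wpM2r// (le_trans (mx_entry_le _ _ _))// HB// sub.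
Qed.

(** The differential inequality is only assumed while E stays below rho.  At the
first time where E reaches rho it has held so far, and the resulting bound, which is
below rho, contradicts the choice of that time. *)
Lemma gronwall_scalar (E E' : R -> R) (L rho c a : R) : 0 <= c -> 0 <= a -> 0 <= L ->
  (forall t, is_derive t (1 : R) E (E' t)) -> 0 <= E 0 ->
  (forall t, 0 <= t <= L -> E t < rho -> E' t <= c * E t + a) ->
  (E 0 + a * L) * expR (c * L) < rho ->
  forall t, 0 <= t <= L -> E t <= (E 0 + a * L) * expR (c * L).
Proof.
move=> c0 a0 L0 dE E00 hE' hrho.
have cE : continuous E.
  by move=> t; have [/derivable1_diffP/differentiable_continuous] := dE t.
have step s : 0 <= s <= L -> (forall t, 0 <= t < s -> E t < rho) ->
    E s <= (E 0 + a * L) * expR (c * L).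
  move=> /andP[s0 sL] hs.
  (* The integrating factor makes phi nonincreasing as long as E < rho. *)
  pose phi t := expR (- c * t) * E t - a * t.
  have dphi t : is_derive t (1 : R) phi (expR (- c * t) * (E' t - c * E t) - a).
    have d1 : is_derive t (1 : R) ( *%R (- c)) (- c).
      by apply: is_derive_eq; rewrite /GRing.scale/= mulr1.
    have d2 := @is_derive1_comp _ expR ( *%R (- c)) t _ _ (is_derive_expR _) d1.
    have d3 : is_derive t (1 : R) ( *%R a) a.
      by apply: is_derive_eq; rewrite /GRing.scale/= mulr1.
    have d4 := is_deriveB (is_deriveM d2 (dE t)) d3.
    apply: is_derive_eq d4 _.
    by rewrite /GRing.scale/=; ring.
  have cphi : continuous phi.
    by move=> t; have [/derivable1_diffP/differentiable_continuous] := dphi t.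
  have : phi s <= phi 0.
    apply: (@ler0_derive1_le_cc R phi 0 s); rewrite ?in_itv/= ?lexx ?s0//.
    - move=> t /[!in_itv]/= /andP[t0 ts].
      rewrite derive1E (@derive_val _ _ _ _ _ _ _ (dphi t)) subr_le0.
      have h1 : E' t - c * E t <= a.
        by rewrite lerBlDl hE' ?hs ?ltW ?(lt_le_trans ts)//= !ltW.
      apply: (@le_trans _ _ (expR (- c * t) * a)).
        by rewrite ler_wpM2l// expR_ge0.
      by rewrite ler_piMl// expR_le1 mulNr oppr_le0 mulr_ge0// ltW.
    - exact: continuous_subspaceT.
  rewrite /phi !mulr0 expR0 mul1r subr0 lerBlDr mulNr expRN => h.
  have ep : 0 < expR (c * s) by exact: expR_gt0.
  move: h; rewrite ler_pdivrMl// => h; apply: le_trans h _.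
  rewrite mulrC ler_pM ?addr_ge0 ?mulr_ge0 ?expR_ge0// ?lerD2l ?ler_wpM2l//.
  by rewrite ler_expR ler_wpM2l.
have Elt t : 0 <= t <= L -> E t < rho.
  move=> tL; rewrite ltNge; apply/negP => rt.
  (* The first time at which E reaches rho is the minimum of this compact set. *)
  pose A := `[0, L]%classic `&` [set s | rho <= E s].
  have cA : compact A.
    apply: (@subclosed_compact _ A `[0, L]%classic); [|exact: segment_compact|by move=> ? []].
    apply: closedI; first exact: interval_closed.
    have -> : [set s | rho <= E s] = E @^-1` [set y | rho <= y] by [].
    by apply: preimage_closed; [move=> ? _; exact: cE | exact: closed_ge].
  have A0 : A !=set0 by exists t; split; rewrite //= in_itv.
  have cid : {within A, continuous (id : R -> R)}.
    by apply: continuous_subspaceT; move=> ?; exact: cvg_id.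
  have [s] := @compact_EVT_min _ R id A A0 cA cid.
  rewrite inE => -[]; rewrite /= in_itv/= => sL rs smin.
  have := step s sL; move=> /(_ _)/le_lt_trans-/(_ _ _ hrho).
  rewrite ltNge rs => H; suff : false by []; apply: H => r /andP[r0 rs'].
  rewrite ltNge; apply/negP => rr.
  have : s <= r.
    apply: smin; rewrite inE; split => //=; rewrite in_itv/= r0 /=.
    by case/andP: sL => _; apply: le_trans; exact: ltW.
  by rewrite leNgt rs'.
move=> t tL; apply: step => // s /andP[s0 st]; apply: Elt; rewrite s0/=.
by case/andP: tL => _; apply: le_trans; exact: ltW.
Qed.

(** The square of the Euclidean norm, equivalent to the square of the sup norm and,
unlike it, differentiable. *)
Definition sum_sqr m n (U : 'M[R]_(m, n)) : R := \sum_i \sum_j U i j ^+ 2.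

Lemma sum_sqr_ge0 m n (U : 'M[R]_(m, n)) : 0 <= sum_sqr U.
Proof. by apply: sumr_ge0 => i _; apply: sumr_ge0 => j _; exact: sqr_ge0. Qed.

Lemma norm_le_sum_sqr m n (U : 'M[R]_(m, n)) : `|U| ^+ 2 <= sum_sqr U.
Proof.
have : `|U| <= Num.sqrt (sum_sqr U).
  apply/mx_norm_le_iff => [|i j]; first exact: sqrtr_ge0.
  rewrite -sqrtr_sqr ler_wsqrtr// /sum_sqr (bigD1 i)//= (bigD1 j)//= -addrA lerDl.
  by rewrite addr_ge0// ?sumr_ge0// => k _; rewrite ?sumr_ge0// ?sqr_ge0// => ? _; rewrite sqr_ge0.
rewrite -(@ler_pXn2r _ 2)// ?nnegrE ?sqrtr_ge0// => /le_trans; apply.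
by rewrite sqr_sqrtr// sum_sqr_ge0.
Qed.

Lemma sum_sqr_le_norm m n (U : 'M[R]_(m, n)) : sum_sqr U <= (m * n)%:R * `|U| ^+ 2.
Proof.
rewrite /sum_sqr (@le_trans _ _ (\sum_(i < m) \sum_(j < n) `|U| ^+ 2))//.
  apply: ler_sum => i _; apply: ler_sum => j _.
  by rewrite -real_normK ?num_real// ler_pXn2r ?nnegrE// mx_entry_le.
by rewrite !sumr_const !card_ord -mulrnA mulr_natl mulnC.
Qed.

Lemma is_derive_sum_sqr m n (U : R -> 'M[R]_(m, n)) t (D : 'M[R]_(m, n)) :
  is_derive t (1 : R) U D ->
  is_derive t (1 : R) (fun s => sum_sqr (U s)) (\sum_i \sum_j 2 * (U t i j * D i j)).
Proof.
move=> /is_derive_mxP dU.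
have d2 i j : is_derive t (1 : R) (fun s => U s i j * U s i j) (2 * (U t i j * D i j)).
  apply: is_derive_eq (is_deriveM (dU i j) (dU i j)) _.
  by rewrite /GRing.scale/=; ring.
rewrite (_ : (fun s => _) = \sum_(i < m) \sum_(j < n) (fun s => U s i j * U s i j)).
  apply: is_derive_sum => i; exact: is_derive_sum.
apply/funext => s; rewrite fct_sumE; apply: eq_bigr => i _.
by rewrite fct_sumE; apply: eq_bigr => j _; rewrite expr2.
Qed.

(** The constant C depends on K and L only, so that one C serves all the
perturbed solutions.  The estimate of U' is assumed in the tube |U| < rho only: a
vector field is controlled near the reference orbit, and nowhere else. *)
Lemma gronwall_tube m n (K L : R) : 0 <= K -> 0 <= L ->
  exists2 C, 0 < C & forall (U U' : R -> 'M[R]_(m, n)) (rho eta : R), 0 <= eta ->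
    (forall t, is_derive t (1 : R) U (U' t)) ->
    (forall t, 0 <= t <= L -> `|U t| < rho -> `|U' t| <= K * `|U t| + eta) ->
    C * (`|U 0| + eta) < rho ->
    forall t, 0 <= t <= L -> `|U t| <= C * (`|U 0| + eta).
Proof.
move=> K0 L0.
pose N : R := (m * n)%:R.
have N0 : 0 <= N by exact: ler0n.
(* 2 N |U| (K |U| + eta) <= c |U|^2 + a, by 2 |U| eta <= |U|^2 + eta^2. *)
pose c := 2 * N * (K + 1).
have c0 : 0 <= c by rewrite !mulr_ge0// addr_ge0.
pose C2 := (N + 2 * N * L + 1) * expR (c * L).
have C20 : 0 < C2 by rewrite mulr_gt0 ?expR_gt0// ltr_wpDl// addr_ge0// !mulr_ge0.
exists (Num.sqrt C2); first by rewrite sqrtr_gt0.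
move=> U U' rho eta eta0 dU hU' hrho.
have rho0 : 0 < rho.
  by apply: le_lt_trans hrho; rewrite mulr_ge0 ?sqrtr_ge0// addr_ge0.
pose a := 2 * N * eta ^+ 2.
have a0 : 0 <= a by rewrite !mulr_ge0// sqr_ge0.
have bnd : (sum_sqr (U 0) + a * L) * expR (c * L) <= (Num.sqrt C2 * (`|U 0| + eta)) ^+ 2.
  rewrite exprMn sqr_sqrtr ?(ltW C20)// /C2 [leRHS]mulrAC ler_wpM2r ?expR_ge0//.
  apply: (@le_trans _ _ ((N + 2 * N * L) * (`|U 0| + eta) ^+ 2)); last first.
    by rewrite ler_wpM2r ?sqr_ge0// lerDl.
  rewrite mulrDl lerD//.
    apply: le_trans (sum_sqr_le_norm _) _; rewrite ler_wpM2l//.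
    by rewrite ler_pXn2r ?nnegrE ?addr_ge0// lerDl.
  rewrite /a [leLHS]mulrAC ler_wpM2l ?mulr_ge0//.
  by rewrite ler_pXn2r ?nnegrE ?addr_ge0// lerDr.
have hE : forall t, 0 <= t <= L -> sum_sqr (U t) <= (sum_sqr (U 0) + a * L) * expR (c * L).
  apply: (@gronwall_scalar (fun t => sum_sqr (U t))
    (fun t => \sum_i \sum_j 2 * (U t i j * U' t i j)) L (rho ^+ 2) c a) => //.
  - by move=> t; exact: is_derive_sum_sqr.
  - exact: sum_sqr_ge0.
  - move=> t tL Ert.
    have Ur : `|U t| < rho.
      rewrite -(@ltr_pXn2r _ 2)// ?nnegrE ?(ltW rho0)//.
      exact: le_lt_trans (norm_le_sum_sqr _) Ert.
    have h := hU' t tL Ur.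
    apply: (@le_trans _ _ (\sum_(i < m) \sum_(j < n) 2 * (`|U t| * `|U' t|))).
      apply: ler_sum => i _; apply: ler_sum => j _; rewrite ler_wpM2l//.
      by rewrite (le_trans (ler_norm _))// normrM ler_pM// mx_entry_le.
    rewrite !sumr_const !card_ord -mulrnA mulnC -[leLHS]mulr_natl -/N.
    apply: (@le_trans _ _ (N * (2 * (`|U t| * (K * `|U t| + eta))))).
      by rewrite !ler_wpM2l.
    apply: (@le_trans _ _ (c * `|U t| ^+ 2 + a)); last first.
      by rewrite lerD2r ler_wpM2l// norm_le_sum_sqr.
    have -> : c * `|U t| ^+ 2 + a = N * (2 * (K * `|U t| ^+ 2 + `|U t| ^+ 2 + eta ^+ 2)).
      by rewrite /c /a; ring.
    rewrite !ler_wpM2l// mulrDr -addrA lerD ?expr2 ?(mulrCA `|U t|)//.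
    have := sqr_ge0 (`|U t| - eta); have := sqr_ge0 (`|U t|); have := sqr_ge0 eta; nra.
  - apply: le_lt_trans bnd _; rewrite ltr_pXn2r ?nnegrE ?(ltW rho0)//.
    by rewrite mulr_ge0 ?sqrtr_ge0// addr_ge0.
move=> t tL; rewrite -(@ler_pXn2r _ 2)// ?nnegrE//; last first.
  by rewrite mulr_ge0 ?sqrtr_ge0// addr_ge0.
exact: le_trans (norm_le_sum_sqr _) (le_trans (hE t tL) bnd).
Qed.

End Gronwall.

(** * Primitives and their limits *)

Section Primitives.
Context {R : realType}.
Local Notation mu := (@lebesgue_measure R).

(** The integral starts at -1 so that 0 is interior and the derivative exists at
t = 0 from both sides. *)
Lemma primitive_exists (g : R -> R) (L : R) : continuous g ->
  exists2 G : R -> R, G 0 = 0 & forall t, 0 <= t <= L -> is_derive t (1 : R) G (g t).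
Proof.
move=> cg.
pose F (x : R) := \int[mu]_(t in `[-1, x]) g t.
exists (fun x => F x - F 0); first by rewrite subrr.
move=> t /andP[t0 tL].
have ig : mu.-integrable `[-1, L + 1] (EFin \o g).
  by apply: continuous_compact_integrable; [exact: segment_compact | exact: continuous_subspaceT].
have tL1 : t < L + 1 by rewrite (le_lt_trans tL)// ltrDl.
have t1 : -1 < t by rewrite (lt_le_trans _ t0)// oppr_lt0.
have [dF dFE] := continuous_FTC1_closed tL1 ig t1 (cg t).
have dF' : is_derive t (1 : R) F (g t) by apply: DeriveDef; rewrite -?derive1E.
apply: is_derive_eq (is_deriveB dF' (is_derive_cst (F 0) t 1)) _.
by rewrite subr0.
Qed.

Lemma Rintegral_FTC2 (f F : R -> R) (P : R) : 0 < P -> continuous f ->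
  (forall t, 0 <= t <= P -> is_derive t (1 : R) F (f t)) ->
  \int[mu]_(t in `[0, P]) f t = F P - F 0.
Proof.
move=> P0 cf dF.
have cF t : 0 <= t <= P -> {for t, continuous F}.
  by move=> /dF[/derivable1_diffP/differentiable_continuous].
rewrite /Rintegral (@continuous_FTC2 R f F 0 P P0)//.
- exact: continuous_subspaceT.
- split.
  + by move=> t /[!in_itv]/= /andP[t0 tP]; have [] := dF t; rewrite ?ltW.
  + by apply: cvg_at_right_filter; apply: cF; rewrite lexx ltW.
  + by apply: cvg_at_left_filter; apply: cF; rewrite lexx ltW.
- move=> t /[!in_itv]/= /andP[t0 tP].
  have h : 0 <= t <= P by rewrite !ltW.
  by rewrite derive1E (@derive_val _ _ _ _ _ _ _ (dF t h)).
Qed.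

Lemma primitive_mx_exists m n (g : R -> 'M[R]_(m, n)) (L : R) : continuous g ->
  exists2 G : R -> 'M[R]_(m, n), G 0 = 0 &
    forall t, 0 <= t <= L -> is_derive t (1 : R) G (g t).
Proof.
move=> cg.
have cg' i j : continuous (fun t => g t i j).
  move=> t; have c : g s @[s --> t] --> g t := cg t.
  exact: (cvg_entry c).
have H (ij : 'I_m * 'I_n) : exists G : R -> R, G 0 = 0 /\
    forall t, 0 <= t <= L -> is_derive t (1 : R) G (g t ij.1 ij.2).
  by have [G G0 dG] := primitive_exists L (cg' ij.1 ij.2); exists G.
have [G HG] := choice H.
exists (fun t => \matrix_(i, j) G (i, j) t).
  by apply/matrixP => i j; rewrite !mxE; have [] := HG (i, j).
move=> t tL; apply/is_derive_mxP => i j.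
under eq_fun do rewrite mxE.
by have [_] := HG (i, j); apply.
Qed.

Lemma jcvg_primitive (L : R) I (F : set_system I) (FF : Filter F) m n
    (G g : I -> R -> 'M[R]_(m, n)) (G0 g0 : R -> 'M[R]_(m, n)) : 0 <= L ->
  (forall t, 0 <= t <= L -> {for t, continuous g0}) -> jcvg L F g g0 ->
  (forall t, 0 <= t <= L -> is_derive t (1 : R) G0 (g0 t)) ->
  (\forall i \near F, G i 0 = G0 0 /\
    forall t, 0 <= t <= L -> is_derive t (1 : R) (G i) (g i t)) ->
  jcvg L F G G0.
Proof.
move=> L0 cg0 jg dG0 HG.
apply: uniform_jcvg.
  by move=> t tL; apply: is_derive_cont; exact: dG0.
move=> eta eta0.
have L1 : 0 < L + 1 by rewrite ltr_wpDl.
have HU := jcvg_uniform FF cg0 jg (divr_gt0 eta0 L1).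
near=> i => t tL.
have [Gi0 dGi] : G i 0 = G0 0 /\
    forall t, 0 <= t <= L -> is_derive t (1 : R) (G i) (g i t) by near: i.
have Hi : forall t, 0 <= t <= L -> `|g i t - g0 t| <= eta / (L + 1) by near: i.
have := @mean_value_ineq R _ _ (fun t => G i t - G0 t) (fun t => g i t - g0 t) L
   (eta / (L + 1)) _ Hi t tL.
rewrite Gi0 subrr subr0 => H; apply: le_trans (H _) _.
  by move=> s sL; apply: is_deriveB; [exact: dGi | exact: dG0].
rewrite mulrAC ler_pdivrMr// ler_wpM2l ?(ltW eta0)//.
by case/andP: tL => _ tL; rewrite (le_trans tL)// lerDl.
Unshelve. all: by end_near. Qed.

End Primitives.

(** * Invariant subspaces and intertwining *)

Section LinearAlgebra.
Context {F : fieldType}.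

(** [horner_mx] for square matrices of any size, 0 included: quotients and
complements of invariant subspaces may be zero-dimensional. *)
Definition horner_sqmx n : 'M[F]_n -> {poly F} -> 'M[F]_n :=
  if n is n'.+1 return 'M[F]_n -> {poly F} -> 'M[F]_n then @horner_mx F n' else fun _ _ => 0.

Lemma horner_sqmxM n (A : 'M[F]_n) p q : horner_sqmx A (p * q) = horner_sqmx A p *m horner_sqmx A q.
Proof. by case: n A => [|n] A; [rewrite mul0mx | exact: rmorphM]. Qed.

Lemma horner_sqmxD n (A : 'M[F]_n) p q : horner_sqmx A (p + q) = horner_sqmx A p + horner_sqmx A q.
Proof. by case: n A => [|n] A; [rewrite addr0 | exact: rmorphD]. Qed.

Lemma horner_sqmx1 n (A : 'M[F]_n) : horner_sqmx A 1 = 1%:M.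
Proof. by case: n A => [|n] A; [by rewrite [LHS]thinmx0 [RHS]thinmx0 | exact: rmorph1]. Qed.

Lemma horner_sqmx_char n (A : 'M[F]_n) : horner_sqmx A (char_poly A) = 0.
Proof. by case: n A => [|n] A //; exact: Cayley_Hamilton. Qed.

(** Intertwining A Y = Y B passes to all polynomials; with Cayley-Hamilton and
[horner_sqmx_unit] it makes Y = 0 when the characteristic polynomials of A and B are
coprime. *)
Lemma horner_sqmx_intertwine n d (A : 'M[F]_n) (B : 'M[F]_d) (Y : 'M[F]_(n, d)) p :
  A *m Y = Y *m B -> horner_sqmx A p *m Y = Y *m horner_sqmx B p.
Proof.
case: n A Y => [|n] A Y; first by move=> _; rewrite flatmx0 [RHS]flatmx0.
case: d B Y => [|d] B Y; first by move=> _; rewrite thinmx0 [RHS]thinmx0.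
move=> AY; rewrite /horner_sqmx; elim/poly_ind: p => [|p c IH].
  by rewrite !rmorph0 mul0mx mulmx0.
rewrite !rmorphD !rmorphM /= !horner_mx_X !horner_mx_C mulmxDl mulmxDr.
by rewrite -mulmxA AY mulmxA IH -mulmxA mul_scalar_mx mul_mx_scalar.
Qed.

Lemma horner_sqmx_unit n (A : 'M[F]_n) p : coprimep p (char_poly A) -> horner_sqmx A p \in unitmx.
Proof.
move=> /Bezout_eq1_coprimepP[[u v]] /= E.
have := congr1 (horner_sqmx A) E.
rewrite horner_sqmxD !horner_sqmxM horner_sqmx_char mulmx0 addr0 horner_sqmx1 => H.
by have [] := mulmx1_unit H.
Qed.

Lemma char_poly_conj a b (M : 'M[F]_(a, b)) (N : 'M[F]_(b, a)) (A : 'M[F]_b) :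
  M *m N = 1%:M -> N *m M = 1%:M -> char_poly (M *m A *m N) = char_poly A.
Proof.
move=> MN NM.
have E : a = b.
  apply/eqP; rewrite eqn_leq -{1}(mxrank1 F a) -MN -{3}(mxrank1 F b) -NM.
  rewrite (leq_trans (mxrankM_maxl _ _)) ?rank_leq_col//.
  by rewrite (leq_trans (mxrankM_maxl _ _)) ?rank_leq_col.
case: b / E N M MN NM A => N M MN NM A.
have E : char_poly_mx (M *m A *m N) =
    map_mx polyC M *m char_poly_mx A *m map_mx polyC N.
  rewrite /char_poly_mx mulmxBr mulmxBl -!map_mxM; congr (_ - _).
  by rewrite -scalemx1 -scalemxAr mulmx1 -scalemxAl -map_mxM MN map_mx1.
rewrite /char_poly E !det_mulmx mulrAC -det_mulmx -map_mxM MN map_mx1 det1.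
by rewrite mul1r.
Qed.

Lemma char_poly_ublock a b (B : 'M[F]_a) (C : 'M[F]_(a, b)) (D : 'M[F]_b) :
  char_poly (block_mx B C 0 D) = char_poly B * char_poly D.
Proof.
rewrite /char_poly /char_poly_mx map_block_mx map_mx0 scalar_mx_block.
by rewrite opp_block_mx add_block_mx subr0 det_ublock.
Qed.

Lemma char_poly_trmx n (A : 'M[F]_n) : char_poly A^T = char_poly A.
Proof.
rewrite /char_poly -det_tr; congr (\det _).
by rewrite /char_poly_mx linearB /= tr_scalar_mx map_trmx trmxK.
Qed.

Lemma eigenvalue_trmx n (A : 'M[F]_n) a : eigenvalue A^T a = eigenvalue A a.
Proof. by rewrite !eigenvalue_root_char char_poly_trmx. Qed.

(** L and W are a left inverse of V and a lift of the quotient map Q; D is the map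
induced by Pi on the quotient, and in the basis (V, W) the matrix of Pi is block
triangular. *)
Lemma invariant_complement k d (Pi : 'M[F]_k) (V : 'M[F]_(k, d)) (B : 'M[F]_d) :
  \rank V = d -> Pi *m V = V *m B ->
  exists (r : nat) (L : 'M[F]_(d, k)) (Q : 'M[F]_(r, k)) (W : 'M[F]_(k, r)) (D : 'M[F]_r),
   [/\ L *m V = 1%:M, Q *m V = 0, V *m L + W *m Q = 1%:M,
       Q *m Pi = D *m Q & char_poly Pi = char_poly B * char_poly D].
Proof.
move=> rV PiV.
have /row_fullP[L LV] : row_full V by rewrite /row_full rV.
have [Q [QV eQ fQ]] : exists Q : 'M[F]_(\rank (kermx V), k),
    [/\ Q *m V = 0, (kermx V <= Q)%MS & row_free Q].
  exists (row_base (kermx V)); rewrite row_base_free eq_row_base submx_refl.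
  by split=> //; apply/sub_kermxP; rewrite eq_row_base.
have /submxP[W EW] : (1%:M - V *m L <= Q)%MS.
  apply: submx_trans eQ; apply/sub_kermxP.
  by rewrite mulmxBl mul1mx -mulmxA LV mulmx1 subrr.
have LW : L *m W = 0.
  apply: (row_free_inj fQ); rewrite /= -mulmxA -EW mulmxBr mulmx1 mulmxA LV.
  by rewrite mul1mx subrr mul0mx.
have QW : Q *m W = 1%:M.
  apply: (row_free_inj fQ); rewrite /= -mulmxA -EW mulmxBr mulmx1 mulmxA QV.
  by rewrite mul0mx subr0 mul1mx.
have VLWQ : V *m L + W *m Q = 1%:M by rewrite -EW addrC subrK.
exists (\rank (kermx V)), L, Q, W, (Q *m Pi *m W); split => //.
  rewrite -!mulmxA -EW !mulmxBr mulmx1 (mulmxA Pi) PiV -!mulmxA (mulmxA Q V) QV.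
  by rewrite mul0mx subr0.
have E : col_mx L Q *m Pi *m row_mx V W =
    block_mx B (L *m Pi *m W) 0 (Q *m Pi *m W).
  rewrite mul_col_mx mul_col_row; do 2 rewrite -(mulmxA _ Pi V) PiV.
  by rewrite (mulmxA L V) LV mul1mx (mulmxA Q V) QV mul0mx.
rewrite -(char_poly_ublock B (L *m Pi *m W)) -E char_poly_conj// ?mul_row_col//.
by rewrite mul_col_row LV LW QV QW -scalar_mx_block.
Qed.

(** Let p be the product of the characteristic polynomials of B and B^-1.  Then
p(Pi) kills V, and the row space T of V^T J, on which Pi acts through B^-T, is the
left kernel of p(Pi), since p is coprime to the rest of the spectrum.  A vector of V
annihilated by V^T J lies therefore in the range of p(Pi), which meets V trivially. *)
Lemma restricted_form_unit k d r (J Pi : 'M[F]_k) (V : 'M[F]_(k, d)) (B : 'M[F]_d)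
    (L : 'M[F]_(d, k)) (Q : 'M[F]_(r, k)) (W : 'M[F]_(k, r)) (D : 'M[F]_r) :
  J \in unitmx -> Pi^T *m J *m Pi = J -> B \in unitmx ->
  Pi *m V = V *m B ->
  L *m V = 1%:M -> Q *m V = 0 -> V *m L + W *m Q = 1%:M -> Q *m Pi = D *m Q ->
  coprimep (char_poly B) (char_poly D) ->
  coprimep (char_poly (invmx B)) (char_poly D) ->
  V^T *m J *m V \in unitmx.
Proof.
move=> uJ symp uB PiV LV QV VLWQ QPi cBD cB'D.
pose C := (invmx B)^T.
pose T := V^T *m J.
have TPi : T *m Pi = C *m T.
  have -> : C *m T = C *m (B^T *m (T *m Pi)).
    have VB : V^T *m Pi^T = B^T *m V^T by rewrite -!trmx_mul PiV.
    by congr (_ *m _); rewrite /T -{1}symp !mulmxA VB.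
  by rewrite (mulmxA C) {1}/C -trmx_mul mulmxV// trmx1 mul1mx.
pose p := char_poly B * char_poly (invmx B).
have uhD : horner_sqmx D p \in unitmx.
  by apply: horner_sqmx_unit; rewrite coprimepMl cBD cB'D.
have hB : horner_sqmx B p = 0 by rewrite horner_sqmxM horner_sqmx_char mul0mx.
have hC : horner_sqmx C p = 0.
  by rewrite horner_sqmxM -(char_poly_trmx (invmx B)) horner_sqmx_char mulmx0.
pose h := horner_sqmx Pi p.
have Qh : Q *m h = horner_sqmx D p *m Q by rewrite (horner_sqmx_intertwine (A := D) p (esym QPi)).
have hV : h *m V = 0 by rewrite (horner_sqmx_intertwine p PiV) hB mulmx0.
have Th : T *m h = 0.
  by rewrite -(horner_sqmx_intertwine p (esym TPi)) hC mul0mx.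
have kerh m (Y : 'M[F]_(k, m)) : h *m Y = 0 -> Y = V *m (L *m Y).
  move=> hY; have QY : Q *m Y = 0.
    have := congr1 (mulmx Q) hY; rewrite mulmx0 mulmxA Qh -mulmxA.
    by move=> /(congr1 (mulmx (invmx (horner_sqmx D p)))); rewrite mulKmx// mulmx0.
  by rewrite mulmxA -[LHS]mul1mx -VLWQ mulmxDl -(mulmxA W) QY mulmx0 addr0.
have rT : \rank T = d.
  rewrite /T mxrankMfree ?row_free_unit// mxrank_tr.
  apply/eqP; rewrite eqn_leq rank_leq_col/=.
  by rewrite -{1}(mxrank1 F d) -LV mxrankM_maxr.
have kT : (kermx h <= T)%MS.
  have TK : (T <= kermx h)%MS by apply/sub_kermxP.
  have [le1 <-] := mxrank_leqif_sup TK.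
  rewrite eqn_leq le1 /= rT mxrank_ker -mxrank_tr -mxrank_ker.
  have hK : h *m (kermx h^T)^T = 0 by apply: trmx_inj; rewrite trmx_mul trmxK mulmx_ker trmx0.
  have := kerh _ _ hK => /(congr1 trmx); rewrite trmxK => ->.
  by rewrite mxrank_tr (leq_trans (mxrankM_maxl _ _))// rank_leq_col.
rewrite -row_full_unit -cokermx_eq0; apply/eqP.
set Y := cokermx _.
have TVY : T *m (V *m Y) = 0 by rewrite mulmxA mulmx_coker.
have /submxP[u Eu] : ((V *m Y)^T <= h^T)%MS.
  rewrite submxE; apply/eqP.
  have : ((cokermx h^T)^T <= kermx h)%MS.
    by apply/sub_kermxP; apply: trmx_inj; rewrite trmx_mul trmxK mulmx_coker trmx0.
  move=> /submx_trans/(_ kT)/submxP[z Ez].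
  by rewrite -[cokermx _]trmxK Ez -trmx_mul -mulmxA TVY mulmx0 trmx0.
have {}Eu : V *m Y = h *m u^T by rewrite -[LHS]trmxK Eu trmx_mul trmxK.
have hhu : h *m (h *m u^T) = 0 by rewrite -Eu mulmxA hV mul0mx.
have Qhu : Q *m u^T = 0.
  have : horner_sqmx D p *m (horner_sqmx D p *m (Q *m u^T)) = 0.
    by rewrite (mulmxA _ Q) -Qh -mulmxA (mulmxA _ Q) -Qh -mulmxA hhu mulmx0.
  move=> /(congr1 (mulmx (invmx (horner_sqmx D p)))); rewrite mulKmx// mulmx0.
  by move=> /(congr1 (mulmx (invmx (horner_sqmx D p)))); rewrite mulKmx// mulmx0.
have uV : u^T = V *m (L *m u^T).
  by rewrite mulmxA -[LHS]mul1mx -VLWQ mulmxDl -(mulmxA W) Qhu mulmx0 addr0.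
have VY0 : V *m Y = 0 by rewrite Eu uV mulmxA hV mul0mx.
by rewrite -[LHS]mul1mx -LV -mulmxA VY0 mulmx0.
Qed.

End LinearAlgebra.

(** * Spectral consequences of strong invariance *)

Section Spectral.
Context {R : realType}.

Lemma cmx_char_poly n (A : 'M[R]_n) :
  char_poly (cmx A) = map_poly (real_complex R) (char_poly A).
Proof. by rewrite map_char_poly. Qed.

Lemma unit_circle_conj (z : R[i]) : `|z| = 1 -> (z^*)%C = z^-1.
Proof.
move=> z1; have z0 : z != 0 by rewrite -normr_eq0 z1 oner_eq0.
have E : z * (z^*)%C = 1.
  by case: z z1 {z0} => a b z1; rewrite -sqr_normc z1 expr1n.
by apply: (mulfI z0); rewrite E mulfV.
Qed.

(** An eigenvalue of B has its full multiplicity in B, so it is not an eigenvalue of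
the quotient D.  The eigenvalues of B^-1 are the inverses, that is the conjugates
since they are on the circle, of those of the real matrix B: the same set. *)
Lemma strongly_invariant_coprime k r v (Pi : 'M[R]_k) (V : {vspace 'cV[R]_k})
    (RV : 'M[R]_(k, v + v)) (BV : 'M[R]_(v + v)) (D : 'M[R]_r) :
  strongly_invariant Pi V RV BV -> spectrum_on_circle Pi ->
  char_poly Pi = char_poly BV * char_poly D ->
  coprimep (char_poly BV) (char_poly D) /\
  coprimep (char_poly (invmx BV)) (char_poly D).
Proof.
move=> [_ _ det1B mult] circ E.
have uB : BV \in unitmx by rewrite unitmxE det1B unitr1.
have Ec : char_poly (cmx Pi) = char_poly (cmx BV) * char_poly (cmx D).
  by rewrite !cmx_char_poly E rmorphM.
have key z : root (char_poly (cmx BV)) z -> ~~ root (char_poly (cmx D)) z.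
  rewrite -eigenvalue_root_char => /mult; rewrite /alg_mult Ec.
  rewrite mupM ?monic_neq0 ?char_poly_monic// => /esym/eqP.
  rewrite -{2}[mup z (char_poly (cmx BV))]addn0 eqn_add2l => /eqP m0.
  by rewrite -dvdp_XsubCl XsubC_dvd ?monic_neq0 ?char_poly_monic// m0.
split.
  rewrite -(coprimep_map (real_complex R)) -!cmx_char_poly.
  by apply: Pdiv.ClosedField.root_coprimep => z /key; rewrite -rootE.
rewrite -(coprimep_map (real_complex R)) -!cmx_char_poly.
apply: Pdiv.ClosedField.root_coprimep => z; rewrite -rootE => rz; apply: key.
move: rz; rewrite -eigenvalue_root_char => /eigenvalueP[w wz w0].
have ucB : cmx BV \in unitmx by rewrite map_unitmx.
have wE : w = z *: (w *m cmx BV).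
  rewrite scalemxAl -wz -mulmxA /cmx map_invmx mulVmx// ?mulmx1//.
have z0 : z != 0.
  by apply: contraNneq w0 => z0; rewrite wE z0 scale0r.
have evB : eigenvalue (cmx BV) z^-1.
  apply/eigenvalueP; exists w => //.
  by rewrite {2}wE scalerA mulVf// scale1r.
have nz : `|z^-1| = 1.
  apply: circ; rewrite eigenvalue_root_char Ec rootM -eigenvalue_root_char.
  by rewrite evB.
have nz' : `|z| = 1 by move: nz; rewrite normfV => /(congr1 GRing.inv); rewrite invrK invr1.
have : root (map_poly conjc (char_poly (cmx BV))) z.
  by rewrite complex_root_conj unit_circle_conj// -eigenvalue_root_char.
rewrite cmx_char_poly -map_poly_comp (eq_map_poly (g := real_complex R))//.
by move=> x; rewrite /= oppr0.
Qed.

Lemma sympl_form_unit k r v (J Pi : 'M[R]_k) (V : {vspace 'cV[R]_k})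
    (RV : 'M[R]_(k, v + v)) (BV : 'M[R]_(v + v)) (L : 'M[R]_(v + v, k))
    (Q : 'M[R]_(r, k)) (W : 'M[R]_(k, r)) (D : 'M[R]_r) :
  J \in unitmx -> Pi^T *m J *m Pi = J ->
  strongly_invariant Pi V RV BV -> spectrum_on_circle Pi ->
  L *m RV = 1%:M -> Q *m RV = 0 -> RV *m L + W *m Q = 1%:M -> Q *m Pi = D *m Q ->
  char_poly Pi = char_poly BV * char_poly D ->
  RV^T *m J *m RV \in unitmx.
Proof.
move=> uJ symp si circ LV QV VLWQ QPi E.
have [c1 c2] := strongly_invariant_coprime si circ E.
have [_ PiV det1B _] := si.
have uB : BV \in unitmx by rewrite unitmxE det1B unitr1.
exact: (restricted_form_unit uJ symp uB PiV LV QV VLWQ QPi c1 c2).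
Qed.

Lemma det_norm_le1 d (B : 'M[R]_d) :
  (forall z : R[i], eigenvalue (cmx B) z -> `|z| <= 1) -> `|\det B| <= 1.
Proof.
move=> H.
have [s Es] := closed_field_poly_normal (char_poly (cmx B)).
move: Es; rewrite (monicP (char_poly_monic _)) scale1r => Es.
have dB : `|\det (cmx B)| <= 1.
  have -> : `|\det (cmx B)| = `|(char_poly (cmx B))`_0|.
    by rewrite char_poly_det normrM normrX normrN1 expr1n mul1r.
  rewrite -horner_coef0 Es horner_prod normr_prod big_seq.
  apply: prodr_ile1 => z zs; rewrite normr_ge0/= !hornerE normrN.
  by apply: H; rewrite eigenvalue_root_char Es root_prod_XsubC.
move: dB; rewrite /cmx det_map_mx /= normc_def /= expr0n/= addr0 sqrtr_sqr.
by rewrite -[1]/((1 : R)%:C)%C lecR.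
Qed.

Lemma eigenvalue_sub k d (Phi : 'M[R]_k) (V : 'M[R]_(k, d)) (B : 'M[R]_d)
    (L : 'M[R]_(d, k)) z :
  L *m V = 1%:M -> Phi *m V = V *m B ->
  eigenvalue (cmx B) z -> eigenvalue (cmx Phi) z.
Proof.
move=> LV PV; rewrite -eigenvalue_trmx => /eigenvalueP[w wz w0].
rewrite -eigenvalue_trmx; apply/eigenvalueP; exists (w *m (map_mx (real_complex R) V)^T).
  rewrite -mulmxA -trmx_mul /cmx -map_mxM PV map_mxM trmx_mul mulmxA.
  by rewrite wz scalemxAl.
apply: contraNneq w0 => /(congr1 (mulmx^~ (map_mx (real_complex R) L)^T)).
by rewrite mul0mx -mulmxA -trmx_mul /cmx -map_mxM LV map_mx1 trmx1 mulmx1 => ->.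
Qed.

End Spectral.

(** * First-order expansion of the determinant *)

Section DetExpansion.
Context {R : realType}.
Variables (T : Type) (F : set_system T) (FF : Filter F).
Variables (e : T -> R).
Hypothesis (e0 : e x @[x --> F] --> 0) (eN0 : \forall x \near F, e x != 0).

Lemma cvg_prod1D (I : Type) (r : seq I) (x : I -> T -> R) (x0 : I -> R) :
  (forall i, x i t @[t --> F] --> x0 i) ->
  (e t)^-1 * (\prod_(i <- r) (1 + e t * x i t) - 1) @[t --> F] --> \sum_(i <- r) x0 i.
Proof.
move=> xx; elim: r => [|i r IH].
  under eq_fun do rewrite big_nil subrr mulr0.
  by rewrite big_nil; exact: cvg_cst.
have Q1 : \prod_(i <- r) (1 + e t * x i t) @[t --> F] --> (1 : R).
  rewrite [X in _ --> X](_ : (1 : R) = \prod_(i <- r) (1 + 0 * x0 i)); last first.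
    by rewrite big1// => j _; rewrite mul0r addr0.
  apply: (@cvg_prod_ord R T F FF I r xpredT (fun i t => 1 + e t * x i t)
    (fun i => 1 + 0 * x0 i)) => j _.
  by apply: cvgD; [exact: cvg_cst | apply: cvgM].
have E : \forall t \near F, x i t * \prod_(i <- r) (1 + e t * x i t)
     + (e t)^-1 * (\prod_(i <- r) (1 + e t * x i t) - 1) =
   (e t)^-1 * (\prod_(i <- i :: r) (1 + e t * x i t) - 1).
  apply: filterS eN0 => t et; by rewrite big_cons; field.
apply: cvg_trans (near_eq_cvg E) _.
rewrite big_cons; apply: cvgD => //.
by rewrite -[X in _ --> X]mulr1; apply: cvgM.
Qed.

(** In the Leibniz expansion a permutation other than the identity moves at least two
indices, so that its term is of order e^2; the identity contributes the product of
the diagonal, whose first-order term is the trace. *)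
Lemma cvg_det1D n (N : T -> 'M[R]_n) (N0 : 'M[R]_n) :
  N t @[t --> F] --> N0 ->
  (e t)^-1 * (\det (1%:M + e t *: N t) - 1) @[t --> F] --> \tr N0.
Proof.
move=> /cvg_mxP NN.
pose g t (s : 'S_n) := (-1) ^+ s * \prod_i (1%:M + e t *: N t) i (s i).
have E : (fun t => (e t)^-1 * (\det (1%:M + e t *: N t) - 1)) =
  (fun t => (e t)^-1 * (\prod_(i < n) (1 + e t * N t i i) - 1) +
    \sum_(s : 'S_n | s != 1%g) (e t)^-1 * g t s).
  apply/funext => t; rewrite /determinant (bigD1 1%g)//= odd_perm1 mul1r.
  rewrite addrAC mulrDr big_distrr /=; congr (_ * (_ - _) + _).
  by apply: eq_bigr => i _; rewrite !mxE perm1 eqxx.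
rewrite E -[\tr N0]addr0; apply: cvgD.
  by apply: cvg_prod1D.
rewrite [X in _ --> X](_ : (0 : R) = \sum_(s : 'S_n | s != 1%g) 0); last by rewrite big1.
apply: cvg_sum => s s1.
have [i si] : exists i, s i != i.
  apply/existsP; rewrite -negb_forall; apply: contra s1 => /forallP h.
  by apply/eqP/permP => i; apply/eqP; rewrite perm1.
pose j := s i.
have sj : s j != j by rewrite (inj_eq perm_inj).
have rest : \prod_(k | (k != i) && (k != j)) (1%:M + e t *: N t) k (s k) @[t --> F]
    --> \prod_(k | (k != i) && (k != j)) ((1%:M : 'M[R]_n) k (s k) + 0 * N0 k (s k)).
  apply: (@cvg_prod_ord R T F FF _ _ _ (fun k t => (1%:M + e t *: N t) k (s k))
    (fun k => (1%:M : 'M[R]_n) k (s k) + 0 * N0 k (s k))) => k _; under eq_fun do rewrite !mxE.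
  by rewrite mxE; apply: cvgD; [exact: cvg_cst | apply: cvgM].
have alg (c a b p x : R) : x != 0 ->
    c * (a * (x * b) * p) = x^-1 * (c * (x * a * (x * b * p))).
  by move=> x0; field.
have E2 : \forall t \near F, (-1) ^+ s * (N t i (s i) * (e t * N t j (s j)) *
     \prod_(k | (k != i) && (k != j)) (1%:M + e t *: N t) k (s k)) = (e t)^-1 * g t s.
  apply: filterS eN0 => t et; rewrite /g [in RHS](bigD1 i)//= [in RHS](bigD1 j)//=.
  rewrite !mxE (eq_sym i) (negbTE si) (eq_sym j) (negbTE sj) !add0r.
  exact: alg.
apply: (cvg_trans (near_eq_cvg E2)).
suff : (-1) ^+ s * (N t i (s i) * (e t * N t j (s j)) *
     \prod_(k | (k != i) && (k != j)) (1%:M + e t *: N t) k (s k)) @[t --> F] --> (0 : R) by [].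
rewrite -[X in _ --> X](mulr0 ((-1) ^+ s)); apply: cvgM; first exact: cvg_cst.
rewrite -[X in _ --> X](mul0r (\prod_(k | (k != i) && (k != j)) ((1%:M : 'M[R]_n) k (s k) + 0 * N0 k (s k)))).
apply: cvgM => //.
rewrite -[X in _ --> X](mulr0 (N0 i (s i))); apply: cvgM => //.
by rewrite -[X in _ --> X](mul0r (N0 j (s j))); apply: cvgM.
Qed.

End DetExpansion.

HB.instance Definition _ (R : realType) (m n : nat) :=
  Uniform_isComplete.Build 'M[R]_(m, n) (@mx_complete R m n).

(** * Persistence of a spectrally separated invariant subspace *)

Section Persistence.
Context {R : realType}.

Lemma mxvec_norm m n (A : 'M[R]_(m, n)) : `|mxvec A| <= `|A|.
Proof.
apply/mx_norm_le_iff => // i j; rewrite (ord1 i).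
by case/mxvec_indexP: j => p q; rewrite mxvecE mx_entry_le.
Qed.

Lemma vec_mx_norm m n (u : 'rV[R]_(m * n)) : `|vec_mx u| <= `|u|.
Proof. by apply/mx_norm_le_iff => // i j; rewrite mxE mx_entry_le. Qed.

(** The linear operator Y |-> A1 Y - A2 Y B acts on a finite-dimensional space, so
injectivity gives a bounded inverse. *)
Lemma sylvester_inverse k d (A1 A2 : 'M[R]_k) (B : 'M[R]_d) :
  (forall Y : 'M[R]_(k, d), A1 *m Y - A2 *m (Y *m B) = 0 -> Y = 0) ->
  exists (c : R) (G : 'M[R]_(k, d) -> 'M[R]_(k, d)),
    [/\ 0 < c, forall Y, A1 *m G Y - A2 *m (G Y *m B) = Y,
        forall X Y, G (X - Y) = G X - G Y & forall Y, `|G Y| <= c * `|Y|].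
Proof.
move=> inj.
pose Lm : 'M[R]_(k * d) := lin_mulmx A1 - lin_mulmxr B *m lin_mulmx A2.
have LmE Y : mxvec Y *m Lm = mxvec (A1 *m Y - A2 *m (Y *m B)).
  by rewrite mulmxBr (mulmxA (mxvec Y)) !mul_vec_lin /= -linearB.
have uL : Lm \in unitmx.
  rewrite -row_free_unit -kermx_eq0; apply/eqP/row_matrixP => i.
  rewrite row0; set u := row i _.
  have uL : u *m Lm = 0 by rewrite -row_mul mulmx_ker row0.
  have := LmE (vec_mx u); rewrite vec_mxK uL => /esym/eqP.
  rewrite mxvec_eq0 => /eqP/inj H.
  by rewrite -[u]vec_mxK H linear0.
exists ((k * d)%:R * `|invmx Lm| + 1), (fun Y => vec_mx (mxvec Y *m invmx Lm)); split.
- by rewrite ltr_wpDl// mulr_ge0.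
- by move=> Y; apply: (can_inj mxvecK); rewrite -LmE vec_mxK mulmxKV.
- by move=> X Y; rewrite !linearB /= mulmxBl linearB.
- move=> Y; apply: le_trans (vec_mx_norm _) _; apply: le_trans (mulmx_norm_le _ _) _.
  rewrite mulrAC mulrDl mul1r mulrAC.
  apply: (@le_trans _ _ ((k * d)%:R * `|invmx Lm| * `|Y|)).
    by rewrite mulrAC ler_wpM2l ?mulr_ge0// mxvec_norm.
  by rewrite lerDl.
Qed.

(** Y is sought in the kernel of S, with B' = S Phi (V + Y).  The part along V of the
invariance equation then holds by the choice of B', and the other part reads
Pi Y - Y B = N(Y), N(Y) being O(|Phi - Pi|) plus a quadratic term.  The separation
hypothesis inverts the left-hand side, and N composed with that inverse is a
contraction of a ball of radius O(|Phi - Pi|). *)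
Lemma invariant_subspace_persists k d (Pi : 'M[R]_k) (V : 'M[R]_(k, d)) (B : 'M[R]_d)
    (S : 'M[R]_(d, k)) :
  S *m V = 1%:M -> S *m Pi = B *m S -> Pi *m V = V *m B ->
  (forall Y : 'M[R]_(k, d), Pi *m Y = Y *m B -> S *m Y = 0 -> Y = 0) ->
  exists C rho : R, 0 < rho /\ forall Phi : 'M[R]_k, `|Phi - Pi| < rho ->
    exists (Y : 'M[R]_(k, d)) (B' : 'M[R]_d),
      [/\ `|Y| <= C * `|Phi - Pi|, S *m Y = 0 & Phi *m (V + Y) = (V + Y) *m B'].
Proof.
move=> SV SPi PiV sep.
pose E := V *m S.
pose P := 1%:M - E.
have SP : S *m P = 0 by rewrite mulmxBr mulmx1 mulmxA SV mul1mx subrr.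
have SE : S *m E = S by rewrite mulmxA SV mul1mx.
have [|c [G [c0 LG Gadd Gc]]] := @sylvester_inverse k d (P *m Pi + E) P B.
  move=> Y H; have SY : S *m Y = 0.
    have := congr1 (mulmx S) H.
    rewrite mulmx0 mulmxBr mulmxDl mulmxDr (mulmxA S E) SE (mulmxA S P (Y *m B)) SP.
    by rewrite mul0mx subr0 -(mulmxA P) (mulmxA S P) SP mul0mx add0r.
  apply: sep => //; apply/eqP; rewrite -subr_eq0; apply/eqP.
  have EX : E *m (Pi *m Y - Y *m B) = 0.
    rewrite /E -mulmxA mulmxBr !mulmxA SPi SY -(mulmxA B) SY.
    by rewrite mulmx0 mul0mx subrr mulmx0.
  have EY : E *m Y = 0 by rewrite /E -mulmxA SY mulmx0.
  rewrite -H mulmxDl EY addr0 -mulmxA -mulmxBr /P mulmxBl mul1mx EX subr0.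
  by [].
pose kR : R := k%:R; pose dR : R := d%:R.
have k0 : 0 <= kR by exact: ler0n.
have d0 : 0 <= dR by exact: ler0n.
pose s := `|S|; pose p := `|P|; pose q := `|V|; pose w := `|Pi| + 1.
have w0 : 0 <= w by rewrite addr_ge0.
have s0 : 0 <= s by exact: normr_ge0.
have p0 : 0 <= p by exact: normr_ge0.
have q0 : 0 <= q by exact: normr_ge0.
pose c1 := kR * p * (kR * q).
pose a1 := kR * p * (kR + dR * (kR * s * (kR * q))).
pose a2 := kR * p * (dR * (kR * (kR * s * w))).
have c10 : 0 <= c1 by rewrite !mulr_ge0 ?normr_ge0.
have a10 : 0 <= a1 by rewrite !(mulr_ge0, addr_ge0) ?normr_ge0.
have a20 : 0 <= a2 by rewrite !mulr_ge0 ?normr_ge0.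
(* The fixed-point map sends 0 to norm at most c c1 |Dl|, half the radius of the
   ball, and is Lipschitz there with constant D |Dl| <= 1/2. *)
pose C := 2 * c * c1.
have C0 : 0 <= C by rewrite !mulr_ge0// ltW.
pose D := c * (a1 + a2 * (2 * C)).
have D0 : 0 <= D.
  by rewrite mulr_ge0 ?(ltW c0)// addr_ge0// mulr_ge0// mulr_ge0.
exists C, (2 * D + 1)^-1; split; first by rewrite invr_gt0 ltr_wpDl// mulr_ge0.
move=> Phi hPhi.
have h : 0 < 2 * D + 1 by rewrite ltr_wpDl// mulr_ge0.
pose Dl := Phi - Pi.
have Dl1 : `|Dl| <= 1.
  by apply: (le_trans (ltW hPhi)); rewrite invf_le1// lerDr mulr_ge0.
have DDl : D * `|Dl| <= 2^-1.
  have : `|Dl| * (2 * D + 1) <= 1 by rewrite -ler_pdivlMr// div1r ltW.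
  have := normr_ge0 Dl; nra.
have Phiw : `|Phi| <= w.
  by rewrite /w -(subrK Pi Phi) addrC (le_trans (ler_normD _ _))// lerD2l.
(* N Y is the complementary part of the invariance equation for V + Y; its
   term quadratic in Y comes from Y *m B'. *)
pose N Y := P *m (- (Dl *m V) - Dl *m Y + Y *m (S *m (Dl *m V)) + Y *m (S *m (Phi *m Y))).
pose f Y := G (N Y).
pose r := C * `|Dl|.
have r0 : 0 <= r by rewrite mulr_ge0.
have G0 : G 0 = 0 by rewrite -{1}(subrr 0) Gadd subrr.
have lip Y Y' : `|Y| <= r -> `|Y'| <= r -> `|f Y - f Y'| <= 2^-1 * `|Y - Y'|.
  move=> hY hY'; rewrite /f -Gadd.
  apply: (le_trans (Gc _)).
  have -> : N Y - N Y' = P *m (- (Dl *m (Y - Y')) + (Y - Y') *m (S *m (Dl *m V))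
     + (Y *m (S *m (Phi *m (Y - Y'))) + (Y - Y') *m (S *m (Phi *m Y')))).
    rewrite /N -mulmxBr; congr (_ *m _).
    rewrite !mulmxBr !mulmxBl; move: (Dl *m V) (Dl *m Y) (Dl *m Y') => x1 x2 x3.
    move: (Y *m (S *m x1)) (Y' *m (S *m x1)) => x4 x5.
    move: (Y *m (S *m (Phi *m Y))) (Y *m (S *m (Phi *m Y'))) => x6 x7.
    move: (Y' *m (S *m (Phi *m Y'))) => x8.
    by apply/matrixP => i j; rewrite !mxE; ring.
  set X := Y - Y'.
  have b1 : `|Dl *m X| <= kR * `|Dl| * `|X| by exact: mulmx_norm_le.
  have b2 : `|X *m (S *m (Dl *m V))| <= dR * (kR * s * (kR * q)) * `|Dl| * `|X|.
    apply: (le_trans (mulmx_norm_le _ _)).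
    rewrite [leRHS](_ : _ = dR * `|X| * (kR * s * (kR * `|Dl| * q))); last by ring.
    rewrite ler_wpM2l ?mulr_ge0 ?normr_ge0//.
    apply: (le_trans (mulmx_norm_le _ _)); rewrite ler_wpM2l ?mulr_ge0 ?normr_ge0//.
    exact: mulmx_norm_le.
  have bq (Z Z' : 'M[R]_(k, d)) : `|Z *m (S *m (Phi *m Z'))| <=
       dR * (kR * (kR * s * w)) * `|Z| * `|Z'|.
    apply: (le_trans (mulmx_norm_le _ _)).
    rewrite [leRHS](_ : _ = dR * `|Z| * (kR * s * (kR * w * `|Z'|))); last by ring.
    rewrite ler_wpM2l ?mulr_ge0 ?normr_ge0//.
    apply: (le_trans (mulmx_norm_le _ _)); rewrite ler_wpM2l ?mulr_ge0 ?normr_ge0//.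
    apply: (le_trans (mulmx_norm_le _ _)).
    by rewrite ler_wpM2r ?normr_ge0// ler_wpM2l.
  have b3 : `|Y *m (S *m (Phi *m X))| <= dR * (kR * (kR * s * w)) * r * `|X|.
    apply: (le_trans (bq _ _)); rewrite ler_wpM2r ?normr_ge0// ler_wpM2l//.
    by rewrite !mulr_ge0 ?normr_ge0.
  have b4 : `|X *m (S *m (Phi *m Y'))| <= dR * (kR * (kR * s * w)) * r * `|X|.
    apply: (le_trans (bq _ _)); rewrite [leRHS]mulrAC ler_wpM2l//.
    by rewrite !mulr_ge0 ?normr_ge0.
  have key : `|P *m (- (Dl *m X) + X *m (S *m (Dl *m V))
     + (Y *m (S *m (Phi *m X)) + X *m (S *m (Phi *m Y'))))| <=
      (a1 * `|Dl| + a2 * (2 * r)) * `|X|.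
    apply: (le_trans (mulmx_norm_le _ _)).
    rewrite [leRHS](_ : _ = kR * p * (kR * `|Dl| * `|X| +
      dR * (kR * s * (kR * q)) * `|Dl| * `|X| +
      (dR * (kR * (kR * s * w)) * r * `|X| + dR * (kR * (kR * s * w)) * r * `|X|)));
      last by rewrite /a1 /a2; ring.
    rewrite ler_wpM2l ?mulr_ge0 ?normr_ge0//.
    apply: (le_trans (ler_normD _ _)); apply: lerD.
      by apply: (le_trans (ler_normD _ _)); rewrite normrN lerD.
    by apply: (le_trans (ler_normD _ _)); rewrite lerD.
  apply: (@le_trans _ _ (c * ((a1 * `|Dl| + a2 * (2 * r)) * `|X|))).
    by rewrite ler_wpM2l// ltW.
  rewrite mulrA ler_wpM2r ?normr_ge0//.
  by apply: le_trans DDl; rewrite /D /r le_eqVlt; apply/orP; left; apply/eqP; ring.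
have f0 : `|f 0| <= 2^-1 * r.
  rewrite /f /N mulmx0 subr0 !mul0mx !addr0.
  apply: (le_trans (Gc _)); rewrite /r /C.
  have -> : 2^-1 * (2 * c * c1 * `|Dl|) = c * (c1 * `|Dl|) by field.
  rewrite ler_wpM2l ?(ltW c0)//.
  apply: (le_trans (mulmx_norm_le _ _)); rewrite normrN.
  rewrite [leRHS](_ : _ = kR * p * (kR * `|Dl| * q)); last by rewrite /c1; ring.
  by rewrite ler_wpM2l ?mulr_ge0// mulmx_norm_le.
pose U := [set Y : 'M[R]_(k, d) | `|Y| <= r].
have fU : {homo f : x / U x >-> U x}.
  move=> Y hY; suff : `|f Y| <= r by [].
  rewrite -(subrK (f 0) (f Y)) (le_trans (ler_normD _ _))//.
  have h0 : `|0 : 'M[R]_(k, d)| <= r by rewrite normr0.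
  have := lip Y 0 hY h0; rewrite subr0; move: f0 hY; rewrite /U /=; lra.
pose fF : {fun U >-> U} := mkfun fU.
have half_ge0 : 0 <= (2^-1 : R) by rewrite invr_ge0.
have ctr : is_contraction fF.
  exists (NngNum half_ge0); split => /=; first by rewrite invf_lt1// ltr1n.
  by move=> [x y] /= [hx hy]; exact: lip.
have cU : closed U.
  have -> : U = [set Y | Num.norm Y <= r] by [].
  rewrite (_ : mkset _ = (@Num.norm R 'M[R]_(k, d)) @^-1` [set x | x <= r])//.
  apply: preimage_closed; last exact: closed_le.
  by move=> x _; exact: norm_continuous.
have [|Y UY fY] := banach_fixed_point ctr cU.
  by exists 0; rewrite /U /= normr0.
have EY : P *m Pi *m Y + E *m Y - P *m (Y *m B) = N Y.
  have GE : G (N Y) = Y by exact: (esym fY).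
  by have := LG (N Y); rewrite GE mulmxDl.
have SY : S *m Y = 0.
  have := congr1 (mulmx S) EY.
  rewrite /N (mulmxA S P) SP mul0mx mulmxBr mulmxDr (mulmxA S E) SE.
  rewrite (mulmxA S P (Y *m B)) SP mul0mx subr0 -(mulmxA P) (mulmxA S P) SP.
  by rewrite mul0mx add0r.
exists Y, (S *m (Phi *m (V + Y))); split => //.
have PX (X : 'M[R]_(k, d)) : S *m X = 0 -> P *m X = X.
  by move=> SX; rewrite /P mulmxBl mul1mx /E -mulmxA SX mulmx0 subr0.
move: EY; rewrite /E -(mulmxA V) SY mulmx0 addr0 -mulmxA -mulmxBr PX; last first.
  by rewrite mulmxBr !mulmxA SPi SY -mulmxA SY mulmx0 mul0mx subrr.
move=> EY.
have SPiY : S *m (Pi *m Y) = 0 by rewrite mulmxA SPi -mulmxA SY mulmx0.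
have EPhi (X : 'M[R]_(k, d)) : Phi *m X = Pi *m X + Dl *m X.
  by rewrite /Dl mulmxBl addrC subrK.
have SM : S *m (Phi *m (V + Y)) = B + S *m (Dl *m V) + S *m (Dl *m Y).
  rewrite mulmxDr !EPhi PiV !mulmxDr SPiY add0r mulmxA SV mul1mx.
  by [].
rewrite SM mulmxDr !EPhi PiV.
have {EY} : Pi *m Y - Y *m B = - (Dl *m V) - Dl *m Y + Y *m (S *m (Dl *m V))
    + Y *m (S *m (Dl *m Y)) + V *m (S *m (Dl *m V)) + V *m (S *m (Dl *m Y)).
  rewrite EY /N EPhi mulmxDr SPiY add0r /P mulmxBl mul1mx /E -(mulmxA V S).
  have -> : S *m (- (Dl *m V) - Dl *m Y + Y *m (S *m (Dl *m V)) + Y *m (S *m (Dl *m Y)))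
      = - (S *m (Dl *m V)) - S *m (Dl *m Y).
    rewrite !mulmxDr !mulmxN; do 2 rewrite (mulmxA S Y) SY mul0mx.
    by rewrite !addr0.
  by rewrite mulmxBr mulmxN opprD !opprK !addrA.
move: (Dl *m V) (Dl *m Y) => x1 x2.
rewrite mulmxDl !mulmxDr.
move: (V *m B) (Y *m B) (Pi *m Y) (Y *m (S *m x1)) (Y *m (S *m x2)) => x3 x4 x5 x6 x7.
move: (V *m (S *m x1)) (V *m (S *m x2)) => x8 x9 H.
rewrite -[x5](subrK x4) H.
by apply/matrixP => i j; rewrite !mxE; ring.
Qed.

End Persistence.

(** * Two criteria for an eigenvalue outside the unit disk *)

Section Instability.
Context {R : realType}.

(** J restricted to the perturbed subspace is multiplied by 1 + e N under Phi, so that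
(det B')^2 = det (1 + e N) > 1, which is incompatible with |det B'| <= 1. *)
Lemma unstable_of_expanding_form (T : Type) (F : set_system T) (FF : Filter F) k d
    (e : T -> R) (Phi G : T -> 'M[R]_k) (J Pi G0 : 'M[R]_k)
    (V : 'M[R]_(k, d)) (B : 'M[R]_d) :
  e t @[t --> F] --> 0 -> (\forall t \near F, 0 < e t) ->
  Phi t @[t --> F] --> Pi -> G t @[t --> F] --> G0 ->
  (\forall t \near F, (Phi t)^T *m J *m Phi t = J + e t *: G t) ->
  let Om := V^T *m J *m V in let S := invmx Om *m V^T *m J in
  Om \in unitmx -> S *m Pi = B *m S -> Pi *m V = V *m B ->
  (forall Y : 'M[R]_(k, d), Pi *m Y = Y *m B -> S *m Y = 0 -> Y = 0) ->
  0 < \tr (invmx Om *m (V^T *m G0 *m V)) ->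
  \forall t \near F, exists2 lam : R[i], eigenvalue (cmx (Phi t)) lam & 1 < `|lam|.
Proof.
move=> ce e0 cPhi cG sym Om S uOm SPi PiV sep tr0.
have SV : S *m V = 1%:M by rewrite /S -!mulmxA (mulmxA V^T) mulVmx.
have [C [rho [rho0 H]]] := invariant_subspace_persists SV SPi PiV sep.
(* Choice of the perturbed subspace as a function of the matrix; far from Pi the
   value is irrelevant. *)
have H' (X : 'M[R]_k) : exists YB : 'M[R]_(k, d) * 'M[R]_d, `|X - Pi| < rho ->
   [/\ `|YB.1| <= C * `|X - Pi|, S *m YB.1 = 0 & X *m (V + YB.1) = (V + YB.1) *m YB.2].
  have [/H[Y [B' h]]|h] := pselect (`|X - Pi| < rho); first by exists (Y, B').
  by exists (0, 0) => /h.
have [yb Hyb] := choice H'.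
pose Y t := (yb (Phi t)).1; pose B' t := (yb (Phi t)).2.
have near_rho : \forall t \near F, `|Phi t - Pi| < rho.
  by have /cvgrPdistC_lt := cPhi; apply.
have cY : Y t @[t --> F] --> (0 : 'M[R]_(k, d)).
  apply/cvgr0Pnorm_le => eta eta0.
  have C1 : 0 < `|C| + 1 by rewrite ltr_wpDl.
  have near_eta : \forall t \near F, `|Phi t - Pi| < eta / (`|C| + 1).
    by have /cvgrPdistC_lt := cPhi; apply; rewrite divr_gt0.
  apply: filterS2 near_rho near_eta => t /Hyb[h _ _] h2.
  apply: (le_trans h); apply: (@le_trans _ _ ((`|C| + 1) * `|Phi t - Pi|)).
    by rewrite ler_wpM2r// (le_trans (ler_norm _))// lerDl.
  by rewrite mulrC -ler_pdivlMr// ltW.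
pose Vt t := V + Y t.
have cV : Vt t @[t --> F] --> V.
  by rewrite -[X in _ --> X]addr0; apply: cvgD => //; exact: cvg_cst.
pose Omt t := (Vt t)^T *m J *m Vt t.
have cOm : Omt t @[t --> F] --> Om.
  apply: cvg_mulmx => //; apply: cvg_mulmx; last exact: cvg_cst.
  exact: cvg_trmx.
have near_unit : \forall t \near F, \det (Omt t) != 0.
  have cd : \det (Omt t) @[t --> F] --> \det Om by exact: cvg_det.
  by apply: (cvgr_neq0 _ cd); rewrite -unitfE -unitmxE.
pose N t := invmx (Omt t) *m ((Vt t)^T *m G t *m Vt t).
have cN : N t @[t --> F] --> invmx Om *m (V^T *m G0 *m V).
  apply: cvg_mulmx; first exact: cvg_invmx.
  by apply: cvg_mulmx => //; apply: cvg_mulmx => //; exact: cvg_trmx.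
have eN0 : \forall t \near F, e t != 0.
  by apply: filterS e0 => t /lt0r_neq0.
have near_det : \forall t \near F, 0 < (e t)^-1 * (\det (1%:M + e t *: N t) - 1).
  have cd := cvg_det1D FF ce eN0 cN.
  exact: (cvgr_gt _ cd).
near=> t.
have [|no] := pselect (exists2 lam : R[i], eigenvalue (cmx (Phi t)) lam & 1 < `|lam|) => //.
have hr : `|Phi t - Pi| < rho by near: t.
have [_ SY PhiV] := Hyb _ hr.
have SVt : S *m Vt t = 1%:M by rewrite mulmxDr SV SY addr0.
have dB : `|\det (B' t)| <= 1.
  apply: det_norm_le1 => z evz; rewrite real_leNgt ?normr_real ?real1//.
  apply/negP => z1; apply: no; exists z => //; exact: (eigenvalue_sub SVt PhiV).
have uOt : \det (Omt t) != 0 by near: t.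
have E : (B' t)^T *m Omt t *m B' t = Omt t *m (1%:M + e t *: N t).
  rewrite mulmxDr mulmx1 -scalemxAr /N mulKVmx; last first.
    by rewrite unitmxE unitfE.
  have -> : (B' t)^T *m Omt t *m B' t = (Vt t)^T *m ((Phi t)^T *m J *m Phi t) *m Vt t.
    have PhiV' : Phi t *m Vt t = Vt t *m B' t by exact: PhiV.
    have E1 : (Vt t)^T *m (Phi t)^T = (B' t)^T *m (Vt t)^T.
      by rewrite -!trmx_mul PhiV'.
    by rewrite /Omt !mulmxA E1 -!mulmxA PhiV'.
  have -> : (Phi t)^T *m J *m Phi t = J + e t *: G t by near: t.
  by rewrite (mulmxDr (Vt t)^T J) mulmxDl -scalemxAr -scalemxAl.
have := congr1 determinant E; rewrite !det_mulmx det_tr => /eqP.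
rewrite mulrAC mulrC (inj_eq (mulfI uOt)) => /eqP dE.
have et : 0 < e t by near: t.
have : 0 < (e t)^-1 * (\det (1%:M + e t *: N t) - 1) by near: t.
rewrite pmulr_rgt0 ?invr_gt0// subr_gt0 -dE -expr2 -real_normK ?num_real//.
by rewrite ltNge exprn_ile1.
Unshelve. all: by end_near. Qed.

Lemma char_poly_horner k (A : 'M[R]_k) (a : R) : (char_poly A).[a] = \det (a%:M - A).
Proof.
rewrite -[LHS]/(horner_eval a _) /char_poly -det_map_mx; congr (\det _).
by apply/matrixP => i j; rewrite /char_poly_mx !mxE /= /horner_eval !(hornerE, hornerMn).
Qed.

(** A monic polynomial is positive at infinity. *)
Lemma monic_neg_root (p : {poly R}) : p \is monic -> p.[1] < 0 -> exists2 x, 1 < x & root p x.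
Proof.
move=> mp p1.
have lc : 0 < lead_coef p by rewrite (monicP mp).
have [b Hb] := polyrcf.poly_pinfty_gt_lc lc.
pose c := Num.max b 1.
have c1 : 1 <= c by rewrite le_max lexx orbT.
have pc : 0 <= p.[c] by rewrite (le_trans (ltW lc))// Hb// le_max lexx.
have /(poly_ivt c1) [x /andP[x1 xc] rx] : p.[1] <= 0 <= p.[c] by rewrite ltW.
exists x => //; rewrite lt_neqAle x1 andbT; apply/eqP => E.
by move: rx; rewrite -E rootE lt_eqF.
Qed.

(** q is monic with no root at 1 and none beyond 1, since a real root x > 1 would be
an eigenvalue off the circle; so q cannot be negative at 1. *)
Lemma double_root_quotient k (Pi : 'M[R]_k) : spectrum_on_circle Pi -> alg_mult 1 Pi = 2%N ->
  exists q : {poly R}, char_poly Pi = ('X - 1%:P) ^+ 2 * q /\ 0 < q.[1].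
Proof.
move=> circ m2.
have nz : char_poly Pi != 0 by rewrite monic_neq0 ?char_poly_monic.
have : ('X - 1%:P) ^+ 2 %| char_poly Pi by rewrite -mup_geq// -m2.
rewrite dvdp_eq => /eqP; set q := _ %/ _ => E.
have mq : q \is monic.
  move: (char_poly_monic Pi); rewrite E !monicE lead_coefM.
  by rewrite (monicP (monic_exp _ (monicXsubC _))) mulr1.
exists q; split; first by rewrite mulrC.
have q1 : ~~ root q 1.
  apply/negP => r1.
  have : (2 < mup 1 (char_poly Pi))%N.
    by rewrite mup_geq// exprS mulrC E mulrC dvdp_mul// ?dvdp_XsubCl// mulrC.
  by rewrite -/(alg_mult 1 Pi) m2.
rewrite ltNge le_eqVlt; apply/negP => /orP[|/(monic_neg_root mq)[x x1 rx]].
  by apply/negP.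
have rc : root (char_poly Pi) x by rewrite E rootM rx.
have : eigenvalue (cmx Pi) (real_complex R x).
  by rewrite eigenvalue_root_char cmx_char_poly fmorph_root.
move=> /circ; rewrite normc_def /= expr0n/= addr0 sqrtr_sqr => -[] /eqP.
by rewrite gtr0_norm ?(lt_trans ltr01)// gt_eqF.
Qed.

Lemma scalemx_inj (D : idomainType) m n (a : D) (A B : 'M[D]_(m, n)) :
  a != 0 -> a *: A = a *: B -> A = B.
Proof.
move=> a0 /matrixP E; apply/matrixP => i j.
by have := E i j; rewrite !mxE => /(mulfI a0).
Qed.

(** The identity is proved for the polynomial matrix x - Pi, where one may divide by
x - 1: from (x - Pi) f = (x - 1) f and (x - Pi) g = (x - 1) g + a f, multiplication by
the adjugate gives adj (x - Pi) g = (x - 1) q g - a q f, to be evaluated at x = 1. *)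
Lemma adj_at_double_root k (Pi : 'M[R]_k) (f g : 'cV[R]_k) (a : R) (q : {poly R}) :
  char_poly Pi = ('X - 1%:P) ^+ 2 * q ->
  Pi *m f = f -> (1%:M - Pi) *m g = a *: f ->
  \adj (1%:M - Pi) *m g = - (a * q.[1]) *: f.
Proof.
move=> E Pif Pig.
pose A := char_poly_mx Pi.
pose c := map_mx (@polyC R).
have adjA : \adj A *m A = (char_poly Pi)%:M by rewrite mul_adj_mx.
have Af : A *m c _ _ f = ('X - 1%:P) *: c _ _ f.
  by rewrite /A /char_poly_mx mulmxBl mul_scalar_mx -map_mxM Pif scalerBl scale1r.
have Ag : A *m c _ _ g = ('X - 1%:P) *: c _ _ g + a%:P *: c _ _ f.
  rewrite /A /char_poly_mx mulmxBl mul_scalar_mx -map_mxM scalerBl scale1r.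
  rewrite -map_mxZ -Pig mulmxBl mul1mx map_mxB.
  by rewrite addrA subrK.
have X1 : 'X - 1%:P != 0 :> {poly R} by rewrite polyXsubC_eq0.
have Bf : \adj A *m c _ _ f = (('X - 1%:P) * q) *: c _ _ f.
  apply: (scalemx_inj X1); rewrite scalemxAr -Af mulmxA adjA mul_scalar_mx E.
  by rewrite scalerA mulrA expr2.
have Bg : \adj A *m c _ _ g = (('X - 1%:P) * q) *: c _ _ g - (a%:P * q) *: c _ _ f.
  apply: (scalemx_inj X1); rewrite scalemxAr -[_ *: c _ _ g](addrK (a%:P *: c _ _ f)) -Ag.
  rewrite mulmxBr mulmxA adjA mul_scalar_mx -scalemxAr Bf E scalerBr !scalerA.
  by congr (_ *: _ - _ *: _); ring.
have := congr1 (map_mx (horner_eval 1)) Bg.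
rewrite map_mxM map_mx_adj /= => H.
have -> : \adj (1%:M - Pi) *m g = \adj (map_mx (horner_eval 1) A) *m map_mx (horner_eval 1) (c _ _ g).
  by congr (\adj _ *m _); apply/matrixP => i j; rewrite /A /char_poly_mx !mxE /= /horner_eval !(hornerE, hornerMn).
rewrite H; apply/matrixP => i j; rewrite !mxE /horner_eval /=.
rewrite !hornerE /=; ring.
Qed.

(** Pairing w (1 - Phi) = - e be with adj (1 - Phi) g gives
det (1 - Phi) (w g) = - e (be adj (1 - Phi) g), of the sign of a (be0 f). *)
Lemma unstable_of_real_multiplier (T : Type) (F : set_system T) (FF : Filter F) k
    (e : T -> R) (Phi : T -> 'M[R]_k) (Pi : 'M[R]_k)
    (w be : T -> 'rV[R]_k) (w0 be0 : 'rV[R]_k) (f g : 'cV[R]_k) (a : R) :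
  (\forall t \near F, 0 < e t) ->
  Phi t @[t --> F] --> Pi -> w t @[t --> F] --> w0 -> be t @[t --> F] --> be0 ->
  (\forall t \near F, w t *m Phi t - w t = e t *: be t) ->
  spectrum_on_circle Pi -> alg_mult 1 Pi = 2%N ->
  (w0 *m g) 0 0 = 1 -> Pi *m f = f -> (1%:M - Pi) *m g = a *: f ->
  a * (be0 *m f) 0 0 < 0 ->
  \forall t \near F, exists2 lam : R[i], eigenvalue (cmx (Phi t)) lam & 1 < `|lam|.
Proof.
move=> e0 cPhi cw cbe H circ m2 wg Pif Pig neg.
have [q [E q1]] := double_root_quotient circ m2.
have adjg := adj_at_double_root E Pif Pig.
have cadj : \adj (1%:M - Phi t) @[t --> F] --> \adj (1%:M - Pi).
  by apply: cvg_adj; apply: cvgB => //; exact: cvg_cst.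
have near1 : \forall t \near F, (be t *m (\adj (1%:M - Phi t) *m g)) 0 0 > 0.
  have c1 : be t *m (\adj (1%:M - Phi t) *m g) @[t --> F] --> be0 *m (\adj (1%:M - Pi) *m g).
    by apply: cvg_mulmx => //; apply: cvg_mulmx => //; exact: cvg_cst.
  have c2 : (be t *m (\adj (1%:M - Phi t) *m g)) 0 0 @[t --> F] -->
      (be0 *m (\adj (1%:M - Pi) *m g)) 0 0 by exact: (cvg_entry c1).
  apply: (cvgr_gt _ c2); rewrite adjg -scalemxAr mxE mulNr oppr_gt0 mulrAC.
  by rewrite nmulr_rlt0.
have near2 : \forall t \near F, (w t *m g) 0 0 > 0.
  have c1 : w t *m g @[t --> F] --> w0 *m g.
    by apply: cvg_mulmx => //; exact: cvg_cst.
  have c2 : (w t *m g) 0 0 @[t --> F] --> (w0 *m g) 0 0 by exact: (cvg_entry c1).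
  by apply: (cvgr_gt _ c2); rewrite wg.
near=> t.
have Ht : w t *m Phi t - w t = e t *: be t by near: t.
have h1 : (be t *m (\adj (1%:M - Phi t) *m g)) 0 0 > 0 by near: t.
have h2 : (w t *m g) 0 0 > 0 by near: t.
have et : 0 < e t by near: t.
have key : \det (1%:M - Phi t) * (w t *m g) 0 0 =
    - (e t * (be t *m (\adj (1%:M - Phi t) *m g)) 0 0).
  have wA : w t *m (1%:M - Phi t) = - (e t *: be t).
    by rewrite -Ht mulmxBr mulmx1 opprB.
  have := congr1 (mulmx^~ (\adj (1%:M - Phi t) *m g)) wA.
  rewrite mulmxA -(mulmxA (w t)) mul_mx_adj mul_mx_scalar -scalemxAl mulNmx -scalemxAl.
  by move=> /(congr1 (fun M : 'M[R]_1 => M 0 0)); rewrite !mxE.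
have dneg : \det (1%:M - Phi t) < 0.
  by rewrite -(pmulr_llt0 _ h2) key oppr_lt0 mulr_gt0.
have [x x1 rx] := monic_neg_root (char_poly_monic (Phi t)) (eq_ind_r (fun y => y < 0) dneg (char_poly_horner (Phi t) 1)).
exists (real_complex R x).
  by rewrite eigenvalue_root_char cmx_char_poly fmorph_root.
rewrite normc_def /= expr0n/= addr0 sqrtr_sqr -[1]/((1 : R)%:C)%C ltcR.
by rewrite (lt_le_trans x1)// ler_norm.
Unshelve. all: by end_near. Qed.

End Instability.

(** * Nondegeneracy and separation for strongly invariant subspaces *)

Section Splitting.
Context {R : realType}.

(** S is the projection onto V along its J-orthogonal complement, which is invariant
because Pi preserves J.  A solution Y of Pi Y = Y B factors through V by coprimality,
and S Y = 0 kills it. *)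
Lemma strongly_invariant_split k v (J Pi : 'M[R]_k) (V : {vspace 'cV[R]_k})
    (RV : 'M[R]_(k, v + v)) (BV : 'M[R]_(v + v)) :
  J \in unitmx -> Pi^T *m J *m Pi = J ->
  strongly_invariant Pi V RV BV -> spectrum_on_circle Pi ->
  let Om := RV^T *m J *m RV in let S := invmx Om *m RV^T *m J in
  [/\ Om \in unitmx, S *m Pi = BV *m S &
    forall Y : 'M[R]_(k, v + v), Pi *m Y = Y *m BV -> S *m Y = 0 -> Y = 0].
Proof.
move=> uJ symp si circ Om S.
have [[rV _] PiV det1B _] := si.
have uB : BV \in unitmx by rewrite unitmxE det1B unitr1.
have [r [L [Q [W [D [LV QV VLWQ QPi E]]]]]] := invariant_complement rV PiV.
have uOm : Om \in unitmx by apply: (sympl_form_unit uJ symp si circ LV QV VLWQ QPi E).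
have [c1 _] := strongly_invariant_coprime si circ E.
have SV : S *m RV = 1%:M by rewrite /S -!mulmxA (mulmxA RV^T) mulVmx.
have OmS : Om *m S = RV^T *m J by rewrite /S -(mulmxA (invmx Om)) mulKVmx.
have VPi : RV^T *m Pi^T = BV^T *m RV^T by rewrite -!trmx_mul PiV.
split => //.
  have uBO : BV^T *m Om \in unitmx by rewrite unitmx_mul unitmx_tr uB.
  have e1 : BV^T *m Om *m (S *m Pi) = RV^T *m J.
    rewrite -mulmxA (mulmxA Om) OmS -[in RHS]symp !mulmxA.
    by rewrite -VPi.
  have e2 : BV^T *m Om *m (BV *m S) = RV^T *m J.
    rewrite mulmxA -OmS; congr (_ *m _).
    by rewrite /Om -!mulmxA -PiV !mulmxA -VPi -(mulmxA _ _ J) -(mulmxA _ _ Pi) symp.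
  by rewrite -[LHS](mulKmx uBO) e1 -e2 mulKmx.
move=> Y PiY SY.
have QY : Q *m Y = 0.
  have ub : horner_sqmx D (char_poly BV) \in unitmx by exact: horner_sqmx_unit.
  have h : horner_sqmx D (char_poly BV) *m (Q *m Y) = 0.
    rewrite mulmxA (horner_sqmx_intertwine _ (esym QPi)) -mulmxA (horner_sqmx_intertwine _ PiY).
    by rewrite horner_sqmx_char !mulmx0.
  by rewrite -[LHS](mulKmx ub) h mulmx0.
have YE : Y = RV *m (L *m Y).
  by rewrite mulmxA -[LHS]mul1mx -VLWQ mulmxDl -(mulmxA W) QY mulmx0 addr0.
by rewrite YE -[L *m Y]mul1mx -SV -(mulmxA S) -YE SY mulmx0.
Qed.

End Splitting.

(** * Trajectories near a given one, and quantities conserved up to order eps *)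

Section Flow.
Context {R : realType}.

(** A first-order Taylor estimate uniform along a compact piece of the curve. *)
Lemma C1_tube k (U : set 'cV[R]_k) (g : 'cV[R]_k -> 'cV[R]_k) (x0 : R -> 'cV[R]_k) (L : R) :
  C1 U g -> (forall t, U (x0 t)) -> continuous x0 ->
  forall eta, 0 < eta -> exists2 rho, 0 < rho & forall t y, 0 <= t <= L ->
    `|y - x0 t| < rho ->
    `|g y - g (x0 t) - jac g (x0 t) *m (y - x0 t)| <= eta * `|y - x0 t|.
Proof.
move=> cg Ux cx eta eta0.
have k1 : (0 : R) < k%:R + 1 by rewrite ltr_wpDl.
have H : \forall rho \near (0 : R)^'+, forall t, 0 <= t <= L -> forall y,
    `|y - x0 t| < rho ->
    `|g y - g (x0 t) - jac g (x0 t) *m (y - x0 t)| <= eta * `|y - x0 t|.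
  apply: near_segment => t tL.
  have [r0 r00 Hr] := C1_strict cg (Ux t) (divr_gt0 eta0 (@ltr0Sn R 1)).
  have cx' : x0 s @[s --> t] --> x0 t := cx t.
  have cj : jac g y @[y --> x0 t] --> jac g (x0 t) := C1_jac_continuous cg (Ux t).
  have cjx : jac g (x0 s) @[s --> t] --> jac g (x0 t) := cvg_comp _ _ cx' cj.
  have n1 : \forall s \near t, `|x0 s - x0 t| < r0 / 2.
    by have /cvgrPdistC_lt := cx'; apply; rewrite divr_gt0.
  have n2 : \forall s \near t, `|jac g (x0 t) - jac g (x0 s)| < eta / 2 / (k%:R + 1).
    by have /cvgrPdist_lt := cjx; apply; rewrite !divr_gt0.
  exists ([set s | `|x0 s - x0 t| < r0 / 2 /\
     `|jac g (x0 t) - jac g (x0 s)| < eta / 2 / (k%:R + 1)], [set r | r < r0 / 2]).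
    by split => /=; [exact: filterI | apply: nbhs_right_lt; rewrite divr_gt0].
  move=> [s r] /= [[h1 h2] h3] _ y hy.
  have hs : `|x0 s - x0 t| < r0.
    by apply: (lt_le_trans h1); rewrite ger_pMr// invf_le1// ler1n.
  have hy' : `|y - x0 t| < r0.
    rewrite -(subrKA (x0 s)) (le_lt_trans (ler_normD _ _))//.
    by rewrite (splitr r0) ltrD// (lt_trans hy).
  have := Hr _ _ hy' hs; set u := y - x0 s => h4.
  have -> : g y - g (x0 s) - jac g (x0 s) *m u =
    (g y - g (x0 s) - jac g (x0 t) *m u) + (jac g (x0 t) - jac g (x0 s)) *m u.
    by rewrite mulmxBl addrA subrK.
  apply: (le_trans (ler_normD _ _)); rewrite (splitr eta) mulrDl lerD//.
  apply: (le_trans (mulmx_norm_le _ _)); rewrite ler_wpM2r//.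
  apply: (@le_trans _ _ (k%:R * (eta / 2 / (k%:R + 1)))); first by rewrite ler_wpM2l// ltW.
  rewrite mulrCA ger_pMr ?divr_gt0// ler_pdivrMr// mul1r lerDl//.
have [r [Hr r0]] := filter_ex (filterI H (nbhs_right_gt (0 : R))).
by exists r => // t y tL; exact: Hr.
Qed.

(** C and rho0 depend on the reference trajectory alone.  The residual r is bounded
only while y stays in the tube, as a perturbation defined on an open set must be. *)
Lemma trajectory_close k (J : 'M[R]_k) (U : set 'cV[R]_k) (g : 'cV[R]_k -> 'cV[R]_k)
    (x0 : R -> 'cV[R]_k) (L : R) : 0 <= L ->
  C1 U g -> (forall t, U (x0 t)) ->
  (forall t, is_derive t (1 : R) x0 (J *m g (x0 t))) ->
  exists C rho0 : R, [/\ 0 < C, 0 < rho0 &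
    forall (y r : R -> 'cV[R]_k) (rho eta : R), rho <= rho0 -> 0 <= eta ->
      (forall t, is_derive t (1 : R) y (J *m g (y t) + r t)) ->
      (forall t, 0 <= t <= L -> `|y t - x0 t| < rho -> `|r t| <= eta) ->
      C * (`|y 0 - x0 0| + eta) < rho ->
      forall t, 0 <= t <= L -> `|y t - x0 t| <= C * (`|y 0 - x0 0| + eta)].
Proof.
move=> L0 cg Ux dx.
have cx : continuous x0 by move=> t; exact: is_derive_cont (dx t).
have [rho0 rho00 Hr] := C1_tube L cg Ux cx ltr01.
have cjx t : 0 <= t <= L -> {for t, continuous (fun s => jac g (x0 s))}.
  move=> _; have cx' : x0 s @[s --> t] --> x0 t := cx t.
  have cj : jac g y @[y --> x0 t] --> jac g (x0 t) := C1_jac_continuous cg (Ux t).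
  exact: (cvg_comp _ _ cx' cj).
have [B B0 HB] := segment_bounded cjx.
pose K := k%:R * `|J| * (1 + k%:R * B).
have K0 : 0 <= K by rewrite !mulr_ge0// addr_ge0// mulr_ge0// ltW.
have [C C0 HC] := @gronwall_tube R k 1 K L K0 L0.
exists C, rho0; split => // y r rho eta rho_le eta0 dy hr hrho t tL.
apply: (HC (fun t => y t - x0 t) (fun t => J *m g (y t) + r t - J *m g (x0 t)) rho) => //.
move=> s sL hs.
have -> : J *m g (y s) + r s - J *m g (x0 s) =
  J *m ((g (y s) - g (x0 s) - jac g (x0 s) *m (y s - x0 s)) + jac g (x0 s) *m (y s - x0 s)) + r s.
  by rewrite subrK mulmxBr addrAC.
apply: (le_trans (ler_normD _ _)); rewrite lerD ?hr//.
apply: (le_trans (mulmx_norm_le _ _)); rewrite /K -[leRHS]mulrA.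
rewrite ler_wpM2l ?mulr_ge0//; apply: (le_trans (ler_normD _ _)).
rewrite mulrDl lerD ?Hr ?(lt_le_trans hs)//.
by apply: (le_trans (mulmx_norm_le _ _)); rewrite ler_wpM2r// ler_wpM2l// HB.
Qed.

(** The Hamiltonian part J H of the linear system preserves the form, because H is
symmetric; only the perturbation e q contributes. *)
Lemma is_derive_pullback_form k (J H q : 'M[R]_k) (X : R -> 'M[R]_k) t (e : R) :
  J^T = - J -> J *m J = - 1%:M -> H^T = H ->
  is_derive t (1 : R) X ((J *m H + e *: q) *m X t) ->
  is_derive t (1 : R) (fun s => (X s)^T *m J *m X s)
    (e *: ((X t)^T *m (q^T *m J + J *m q) *m X t)).
Proof.
move=> JT JJ HT dX.
have d1 := is_derive_mulmx (is_derive_trmx dX) (is_derive_cst J t 1).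
have d2 := is_derive_mulmx d1 dX.
apply: is_derive_eq d2 _.
rewrite mulmx0 addr0 trmx_mul linearD linearZ /= trmx_mul HT JT.
set Y := X t.
have key : (H *m - J + e *: q^T) *m J + J *m (J *m H + e *: q) =
    e *: (q^T *m J + J *m q).
  rewrite mulmxDl mulmxDr mulmxN mulNmx -mulmxA JJ mulmxN mulmx1 opprK mulmxA JJ.
  by rewrite mulNmx mul1mx scalerDr -scalemxAl -scalemxAr addrACA subrr add0r.
transitivity (Y^T *m ((H *m - J + e *: q^T) *m J + J *m (J *m H + e *: q)) *m Y).
  move: (H *m - J + e *: q^T) (J *m H + e *: q) => M1 M2.
  by rewrite mulmxDr mulmxDl !mulmxA.
by rewrite key -scalemxAr -scalemxAl.
Qed.

(** For e = 0 this is the derivative of the energy H(x(t; xi)) with respect to xi, a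
first integral of the variational equation. *)
Lemma is_derive_energy_covector k (U : set 'cV[R]_k) (J q : 'M[R]_k) (g : 'cV[R]_k -> 'cV[R]_k)
   (x : R -> 'cV[R]_k) (X : R -> 'M[R]_k) (p : 'cV[R]_k) t (e : R) :
  J^T = - J -> C1 U g -> U (x t) -> (jac g (x t))^T = jac g (x t) ->
  is_derive t (1 : R) x (J *m g (x t) + e *: p) ->
  is_derive t (1 : R) X ((J *m jac g (x t) + e *: q) *m X t) ->
  is_derive t (1 : R) (fun s => (g (x s))^T *m X s)
    (e *: ((p^T *m jac g (x t) + (g (x t))^T *m q) *m X t)).
Proof.
move=> JT cg Ux HT dx dX.
have d1 := is_derive_mulmx (is_derive_trmx (C1_chain cg Ux dx)) dX.
apply: is_derive_eq d1 _.
set H := jac g (x t) in HT *.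
rewrite trmx_mul HT linearD linearZ /= trmx_mul JT.
rewrite (mulmxA _ _ (X t)) -mulmxDl scalemxAl; congr (_ *m _).
rewrite mulmxDl mulmxDr -!scalemxAl -!scalemxAr scalerDr.
by rewrite mulmxN mulNmx -(mulmxA _ J) addrACA addNr add0r.
Qed.

End Flow.

(** * Regularity of the mechanical system *)

Section Regularity.
Context {R : realType} {n : nat}.
Variables (S : mech R n) (U : set 'cV[R]_(n + n)) (r0 : nat).
Hypotheses (hr0 : (3 <= r0)%N) (hS : admissible S U r0).
Local Notation phase := 'cV[R]_(n + n).

(** Coordinatewise criterion, in the form in which the regularity hypotheses come. *)
Lemma C1_intro k l (A : set 'cV[R]_k) (f : 'cV[R]_k -> 'cV[R]_l) : open A ->
  (forall i x, A x -> forall j, derivable (fun y => f y i 0) x (delta_mx j 0)) ->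
  (forall i x, A x -> forall j,
    {for x, continuous (fun y => 'D_(delta_mx j 0) (fun y => f y i 0) y)}) ->
  C1 A f.
Proof.
move=> oA df cf; split => // x Ax j.
have dmx y : A y -> derivable f y (delta_mx j 0).
  by move=> Ay; apply/derivable_mxP => i q; rewrite (ord1 q); exact: df.
split; first exact: dmx.
suff : 'D_(delta_mx j 0) f y @[y --> x] --> 'D_(delta_mx j 0) f x by [].
apply: (@cvg_mx _ _ (nbhs x) (nbhs_filter x)) => i q; rewrite (ord1 q).
have E : \forall y \near x, 'D_(delta_mx j 0) (fun y => f y i 0) y = 'D_(delta_mx j 0) f y i 0.
  have : \forall y \near x, A y by exact: open_nbhs_nbhs.
  by apply: filterS => y Ay; rewrite (derive_mx (dmx y Ay)) mxE.
rewrite -(nbhs_singleton E).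
apply: (cvg_trans (near_eq_cvg E)).
exact: cf.
Qed.

Lemma ham_C1 : [/\ open U, C1 U (grad (ham S)),
  forall y, U y -> forall i, derivable (ham S) y (delta_mx i 0) &
  forall y, U y -> forall i, {for y, continuous (fun y => 'D_(delta_mx i 0) (ham S) y)}].
Proof.
have [oU _ _ CH _] := hS.
move: hr0 CH; case: r0 => [//|[//|k]] _ /= [_ H1].
have H2 v : forall x, U x -> derivable (ham S) x v by have [] := H1 v I.
have H3 v : forall x, U x -> {for x, continuous (fun x => 'D_v (ham S) x)}.
  by have [_ []] := H1 v I.
split => //; [|by move=> y Uy i; exact: H2|by move=> y Uy i; exact: H3].
apply: C1_intro => // i x Ux j.
  have [_ [_ /(_ (delta_mx j 0) I)[H _]]] := H1 (delta_mx i 0) I.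
  rewrite (_ : (fun y => _) = (fun y => 'D_(delta_mx i 0) (ham S) y)); first exact: H.
  by apply/funext => y; rewrite mxE.
have [_ [_ /(_ (delta_mx j 0) I)[_ [H _]]]] := H1 (delta_mx i 0) I.
rewrite (_ : (fun y => grad _ _ _ _) = (fun y => 'D_(delta_mx i 0) (ham S) y)); first exact: H.
by apply/funext => y; rewrite mxE.
Qed.

(** A basis direction of the phase space, inside the space of all the arguments of
the perturbation. *)
Definition state_dir (j : 'I_(n + n)) : phase * R^o * R^o * R^o :=
  (((delta_mx j 0, 0), 0), 0).

(** The extension to an open set is what allows limits from eps >= 0 at eps = 0. *)
Lemma pert_extension : exists (O : set (phase * R^o * R^o * R^o))
    (p : phase * R^o * R^o * R^o -> phase),
  [/\ open O,
     forall x t d e, U x -> 0 < d -> 0 <= e -> O (x, t, d, e) /\ pert S x t d e = p (x, t, d, e),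
     forall y, O y -> {for y, continuous p},
     forall j y, O y -> derivable p y (state_dir j) &
     forall j y, O y -> {for y, continuous (fun y => 'D_(state_dir j) p y)}].
Proof.
have [_ _ _ _ /= [_ [W [p [oW AW Cp pE]]]]] := hS.
move: hr0 Cp; case: r0 => [//|k] _ /= [c0 H1].
exists W, p; split => //.
- by move=> x t d e Ux d0 e0; split; [exact: AW | by rewrite pE].
- by move=> j; have [] := H1 (state_dir j) erefl.
- move=> j; have [_] := H1 (state_dir j) erefl.
  by case: (k) => [|k0]; case.
Qed.

Lemma cvg_quad (T : Type) (F : set_system T) (FF : Filter F)
    (c : T -> phase) (t d e : T -> R^o) (c0 : phase) (t0 d0 e0 : R^o) :
  c i @[i --> F] --> c0 -> t i @[i --> F] --> t0 -> d i @[i --> F] --> d0 ->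
  e i @[i --> F] --> e0 ->
  (c i, t i, d i, e i) @[i --> F] --> ((c0, t0, d0, e0) : phase * R^o * R^o * R^o).
Proof.
move=> cc ct cd ce.
have h1 : (c i, t i) @[i --> F] --> ((c0, t0) : phase * R^o).
  exact: (@cvg_pair _ _ _ _ (nbhs c0) (nbhs t0) _ _ _ c t cc ct).
have h2 : (c i, t i, d i) @[i --> F] --> ((c0, t0, d0) : phase * R^o * R^o).
  exact: (@cvg_pair _ _ _ _ (nbhs (c0, t0)) (nbhs d0) _ _ _ (fun i => (c i, t i)) d h1 cd).
exact: (@cvg_pair _ _ _ _ (nbhs (c0, t0, d0)) (nbhs e0) _ _ _ (fun i => (c i, t i, d i)) e h2 ce).
Qed.

(** The extension p and its partial Jacobian q in the state variables are continuous
in all arguments jointly and agree with the perturbation and its Jacobian where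
these are meaningful. *)
Lemma pert_slices : exists (O : set (phase * R^o * R^o * R^o))
    (p : phase * R^o * R^o * R^o -> phase)
    (q : phase * R^o * R^o * R^o -> 'M[R]_(n + n)),
  [/\ forall x t d e, U x -> 0 < d -> 0 <= e ->
      [/\ O (x, t, d, e), pert S x t d e = p (x, t, d, e) & jac_pert S x t d e = q (x, t, d, e)],
    forall y, O y -> {for y, continuous p} /\ {for y, continuous q} &
    forall t d e, 0 < d -> 0 <= e -> C1 U (fun x => pert S x t d e)].
Proof.
have [W [p [oW Wp cp dp cdp]]] := pert_extension.
have [oU _ _ _ _] := hS.
pose q y := \matrix_(i, j) ('D_(state_dir j) p y) i 0.
have cq y : W y -> {for y, continuous q}.
  move=> Wy; suff : q z @[z --> y] --> q y by [].
  apply: (@cvg_mx _ _ (nbhs y) (nbhs_filter y)) => i j; rewrite mxE.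
  under eq_fun do rewrite mxE.
  have cj : 'D_(state_dir j) p z @[z --> y] --> 'D_(state_dir j) p y := cdp j _ Wy.
  exact: (@cvg_entry _ _ (nbhs y) (nbhs_filter y) _ _ _ _ cj).
have dE t d e x j : 0 < d -> 0 <= e -> U x ->
    is_derive x (delta_mx j 0) (fun y => pert S y t d e) ('D_(state_dir j) p (x, t, d, e)).
  move=> d0 e0 Ux.
  have E : \forall y \near x, p (y, t, d, e) = pert S y t d e.
    have : \forall y \near x, U y by exact: open_nbhs_nbhs.
    by apply: filterS => y Uy; have [_ ->] := Wp y t d e Uy d0 e0.
  apply: (near_eq_is_derive E).
  have EQ : (fun h : R => h^-1 *: (p (h *: delta_mx j 0 + x, t, d, e) - p (x, t, d, e))) =
      (fun h => h^-1 *: (p (h *: state_dir j + (x, t, d, e)) - p (x, t, d, e))).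
    apply/funext => h; congr (_ *: (p _ - _)).
    rewrite -[RHS]/((h *: delta_mx j 0 + x, h *: (0 : R^o) + (t : R^o),
      h *: (0 : R^o) + (d : R^o), h *: (0 : R^o) + (e : R^o)) :
      phase * R^o * R^o * R^o).
    by rewrite !scaler0 !add0r.
  have [Wy _] := Wp x t d e Ux d0 e0.
  have dpx := dp j _ Wy.
  by apply: DeriveDef; rewrite /derivable /derive /= EQ.
exists W, p, q; split.
- move=> x t d e Ux d0 e0; have [Wy py] := Wp x t d e Ux d0 e0; split => //.
  apply/matrixP => i j; rewrite !mxE.
  by rewrite (@derive_val _ _ _ _ _ _ _ (dE t d e x j d0 e0 Ux)).
- by move=> y Wy; split; [exact: cp | exact: cq].
move=> t d e d0 e0; split => // x Ux j; have H := dE t d e x j d0 e0 Ux.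
split; first by case: H.
have [Wy _] := Wp x t d e Ux d0 e0.
have cj : 'D_(state_dir j) p y @[y --> (x, t, d, e)] --> 'D_(state_dir j) p (x, t, d, e) := cdp j _ Wy.
suff : 'D_(delta_mx j 0) (fun x => pert S x t d e) y @[y --> x] -->
   'D_(delta_mx j 0) (fun x => pert S x t d e) x by [].
rewrite (@derive_val _ _ _ _ _ _ _ H).
have E : \forall y \near x, 'D_(state_dir j) p (y, t, d, e) =
    'D_(delta_mx j 0) (fun x => pert S x t d e) y.
  have : \forall y \near x, U y by exact: open_nbhs_nbhs.
  apply: filterS => y Uy.
  by rewrite (@derive_val _ _ _ _ _ _ _ (dE t d e y j d0 e0 Uy)).
apply: (cvg_trans (near_eq_cvg E)).
apply: (@cvg_comp _ _ _ (fun y : phase => (y, t, d, e) : phase * R^o * R^o * R^o)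
  (fun y => 'D_(state_dir j) p y)); last exact: cj.
apply: (@cvg_quad _ (nbhs x) (nbhs_filter x) id (fun=> t) (fun=> d) (fun=> e));
  [exact: cvg_id | exact: cvg_cst ..].
Qed.

Lemma pert_C1 (t d e : R) : 0 < d -> 0 <= e -> C1 U (fun x => pert S x t d e).
Proof. by have [W [p [q [_ _ H]]]] := pert_slices; exact: H. Qed.

Lemma pert_cvg (T : Type) (F : set_system T) (FF : Filter F)
    (c : T -> phase) (t d e : T -> R) (c0 : phase) (t0 d0 : R) :
  c i @[i --> F] --> c0 -> t i @[i --> F] --> t0 -> d i @[i --> F] --> d0 ->
  e i @[i --> F] --> 0 ->
  (\forall i \near F, [/\ U (c i), 0 < d i & 0 <= e i]) -> U c0 -> 0 < d0 ->
  pert S (c i) (t i) (d i) (e i) @[i --> F] --> pert S c0 t0 d0 0 /\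
  jac_pert S (c i) (t i) (d i) (e i) @[i --> F] --> jac_pert S c0 t0 d0 0.
Proof.
move=> cc ct cd ce nA Uc0 d00.
have [W [p [q [HW Hc _]]]] := pert_slices.
have [W0 p0 q0] := HW c0 t0 d0 0 Uc0 d00 (lexx 0).
have [cp cq] := Hc _ W0.
have {}cp : p y @[y --> (c0, t0, d0, 0)] --> p (c0, t0, d0, 0) := cp.
have {}cq : q y @[y --> (c0, t0, d0, 0)] --> q (c0, t0, d0, 0) := cq.
have cy : (c i, t i, d i, e i) @[i --> F] --> ((c0, t0, d0, 0) : phase * R^o * R^o * R^o).
  exact: cvg_quad.
rewrite p0 q0; split.
  have E : \forall i \near F, p (c i, t i, d i, e i) = pert S (c i) (t i) (d i) (e i).
    by apply: filterS nA => i [h1 h2 h3]; have [_ ->] := HW (c i) (t i) (d i) (e i) h1 h2 h3.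
  exact: (cvg_trans (near_eq_cvg E) (cvg_comp _ _ cy cp)).
have E : \forall i \near F, q (c i, t i, d i, e i) = jac_pert S (c i) (t i) (d i) (e i).
  by apply: filterS nA => i [h1 h2 h3]; have [_ _ ->] := HW (c i) (t i) (d i) (e i) h1 h2 h3.
exact: (cvg_trans (near_eq_cvg E) (cvg_comp _ _ cy cq)).
Qed.

End Regularity.

(** * The standard symplectic matrix *)

Section Standard.
Context {R : realType} {n : nat}.
Local Notation J := (@Jmx R n).

Lemma Jmx_tr : J^T = - J.
Proof.
by rewrite /Jmx tr_block_mx !trmx0 linearN /= trmx1 opp_block_mx !oppr0 opprK.
Qed.

Lemma Jmx_sqr : J *m J = - 1%:M.
Proof.
rewrite /Jmx mulmx_block !mul0mx !mulmx0 !addr0 !add0r mul1mx mulmx1.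
by rewrite (scalar_mx_block n n) opp_block_mx oppr0.
Qed.

Lemma Jmx_unit : J \in unitmx.
Proof.
have : J *m (- J) = 1%:M by rewrite mulmxN Jmx_sqr opprK.
by move=> /mulmx1_unit[].
Qed.

Lemma sympl_inv (X : 'M[R]_(n + n)) : X^T *m J *m X = J ->
  X \in unitmx /\ X *m J *m X^T = J.
Proof.
move=> H.
have H2 : (- J *m X^T *m J) *m X = 1%:M.
  by rewrite -!mulmxA (mulmxA X^T) H mulNmx Jmx_sqr opprK.
have uX : X \in unitmx by have [] := mulmx1_unit H2.
split => //.
have H3 : X *m (- J *m X^T *m J) = 1%:M by rewrite (mulmx1C H2).
have H4 : X *m J *m X^T *m J = - 1%:M.
  by rewrite -H3 !mulmxA !mulmxN !mulNmx opprK.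
have := congr1 (mulmx^~ (- J)) H4.
by rewrite -mulmxA mulmxN Jmx_sqr opprK mulmx1 mulNmx mulmxN mul1mx opprK.
Qed.

End Standard.

Lemma derive0_const (R : realType) m k (G : R -> 'M[R]_(m, k)) :
  (forall t : R, 0 <= t -> is_derive t (1 : R) G 0) -> forall t, 0 <= t -> G t = G 0.
Proof.
move=> dG t t0.
have d s : 0 <= s <= t -> is_derive s (1 : R) G 0 by move=> /andP[s0 _]; exact: dG.
have b s : 0 <= s <= t -> `|0 : 'M[R]_(m, k)| <= 0 by rewrite normr0.
have t0t : 0 <= t <= t by rewrite t0 lexx.
have := mean_value_ineq d b t0t.
by rewrite mul0r normr_le0 subr_eq0 => /eqP.
Qed.

(** * The conservative variational flow *)

Section Unperturbed.
Context {R : realType} {n : nat}.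
Variables (S : mech R n) (U : set 'cV[R]_(n + n)) (r0 : nat).
Hypotheses (hr0 : (3 <= r0)%N) (hS : admissible S U r0).
Local Notation phase := 'cV[R]_(n + n).
Local Notation J := (@Jmx R n).
Local Notation H := (ham S).
Variables (x0 : R -> phase) (hx0 : solution U (fun y _ => cons_field S y) x0).
Variables (X0 : R -> 'M[R]_(n + n))
  (hX0 : fundamental (fun t => J *m hessian H (x0 t)) X0).

Lemma x0_in t : U (x0 t). Proof. by have [] := hx0 t. Qed.

Lemma x0_derive t : is_derive t (1 : R) x0 (J *m grad H (x0 t)).
Proof. by have [] := hx0 t. Qed.

Lemma X0_derive t : is_derive t (1 : R) X0 (J *m hessian H (x0 t) *m X0 t).
Proof. by have [_] := hX0; apply. Qed.

Lemma X0_at0 : X0 0 = 1%:M. Proof. by have [] := hX0. Qed.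

Lemma x0_continuous : continuous x0. Proof. by move=> t; exact: is_derive_cont (x0_derive t). Qed.

Lemma X0_continuous : continuous X0. Proof. by move=> t; exact: is_derive_cont (X0_derive t). Qed.

Lemma grad_C1 : C1 U (grad H). Proof. by have [] := ham_C1 hr0 hS. Qed.

Lemma grad_continuous y : U y -> {for y, continuous (grad H)}.
Proof. exact: C1_continuous grad_C1. Qed.

Lemma hessian_continuous y : U y -> {for y, continuous (hessian H)}.
Proof. exact: C1_jac_continuous grad_C1. Qed.

Lemma ham_hessian_sym y : U y -> (jac (grad H) y)^T = jac (grad H) y.
Proof. by have [oU c d _] := ham_C1 hr0 hS => Uy; exact: hessian_sym c d Uy. Qed.

(** Conservation is stated for t >= 0 only, the times that occur in the
period map. *)
Lemma X0_symplectic t : 0 <= t -> (X0 t)^T *m J *m X0 t = J.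
Proof.
move=> t0; rewrite (@derive0_const _ _ _ (fun s => (X0 s)^T *m J *m X0 s) _ t t0).
  by rewrite X0_at0 trmx1 mul1mx mulmx1.
move=> s _.
have dX : is_derive s (1 : R) X0 ((J *m jac (grad H) (x0 s) + 0 *: 0) *m X0 s).
  by rewrite scaler0 addr0; exact: X0_derive.
have := is_derive_pullback_form Jmx_tr Jmx_sqr (ham_hessian_sym (x0_in s)) dX.
by rewrite scale0r.
Qed.

Lemma energy_covector t : 0 <= t -> (grad H (x0 t))^T *m X0 t = (grad H (x0 0))^T.
Proof.
move=> t0; rewrite (@derive0_const _ _ _ (fun s => (grad H (x0 s))^T *m X0 s) _ t t0).
  by rewrite X0_at0 mulmx1.
move=> s _.
have dX : is_derive s (1 : R) X0 ((J *m jac (grad H) (x0 s) + 0 *: 0) *m X0 s).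
  by rewrite scaler0 addr0; exact: X0_derive.
have dx : is_derive s (1 : R) x0 (J *m grad H (x0 s) + 0 *: (0 : phase)).
  by rewrite scaler0 addr0; exact: x0_derive.
have := is_derive_energy_covector Jmx_tr grad_C1 (x0_in s) (ham_hessian_sym (x0_in s)) dx dX.
by rewrite scale0r.
Qed.

(** The transpose of [energy_covector] through J: the variational flow carries the
flow direction along. *)
Lemma flow_direction t : 0 <= t ->
  X0 t *m (J *m grad H (x0 0)) = J *m grad H (x0 t).
Proof.
move=> t0; have [_ XJX] := sympl_inv (X0_symplectic t0).
have -> : grad H (x0 0) = (X0 t)^T *m grad H (x0 t).
  by apply: trmx_inj; rewrite trmx_mul trmxK energy_covector.
by rewrite !mulmxA XJX.
Qed.

Lemma grad_x0_continuous : continuous (fun t => grad H (x0 t)).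
Proof.
move=> t; have c1 : x0 s @[s --> t] --> x0 t := @x0_continuous t.
have c2 : grad H y @[y --> x0 t] --> grad H (x0 t) := grad_continuous (x0_in t).
exact: (cvg_comp _ _ c1 c2).
Qed.

Lemma hessian_x0_continuous : continuous (fun t => hessian H (x0 t)).
Proof.
move=> t; have c1 : x0 s @[s --> t] --> x0 t := @x0_continuous t.
have c2 : hessian H y @[y --> x0 t] --> hessian H (x0 t) := hessian_continuous (x0_in t).
exact: (cvg_comp _ _ c1 c2).
Qed.

Lemma pert_x0_continuous d0 : 0 < d0 -> continuous (fun t => pert S (x0 t) t d0 0) /\
  continuous (fun t => jac_pert S (x0 t) t d0 0).
Proof.
move=> d00; have K t : pert S (x0 s) s d0 0 @[s --> t] --> pert S (x0 t) t d0 0 /\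
    jac_pert S (x0 s) s d0 0 @[s --> t] --> jac_pert S (x0 t) t d0 0.
  apply: (@pert_cvg _ _ S U r0 hr0 hS _ _ (nbhs_filter t) x0 id (fun=> d0) (fun=> 0)) => //.
  - exact: x0_continuous.
  - exact: cvg_cst.
  - exact: cvg_cst.
  - by apply: nearW => s; split => //; exact: x0_in.
  - exact: x0_in.
by split => t; have [] := K t.
Qed.

End Unperturbed.

(** * Convergence of the perturbed solutions *)

Section Perturbed.
Context {R : realType} {n : nat}.
Variables (S : mech R n) (U : set 'cV[R]_(n + n)) (r0 : nat).
Hypotheses (hr0 : (3 <= r0)%N) (hS : admissible S U r0).
Local Notation phase := 'cV[R]_(n + n).
Local Notation J := (@Jmx R n).
Local Notation H := (ham S).
Variables (x0 : R -> phase) (hx0 : solution U (fun y _ => cons_field S y) x0).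
Variables (X0 : R -> 'M[R]_(n + n))
  (hX0 : fundamental (fun t => J *m hessian H (x0 t)) X0).
Variables (d0 : R) (d00 : 0 < d0) (delta : R -> R) (xi : R -> phase)
  (xe : R -> R -> phase) (Xe : R -> R -> 'M[R]_(n + n)).
Hypotheses (Hd : delta e @[e --> 0^'+] --> d0) (Hxi : xi e @[e --> 0^'+] --> x0 0).
Hypothesis Hsol : \forall e \near 0^'+,
  [/\ 0 < delta e, solution U (forced_field S (delta e) e) (xe e), xe e 0 = xi e
    & fundamental (var_matrix S (delta e) e (xe e)) (Xe e)].
Variables (L : R) (L0 : 0 <= L).

(** A single bound near the orbit for all small eps, which the comparison of
trajectories needs before it is known that the perturbed orbit stays in the tube. *)
Lemma pert_tube_bound : exists2 B, 0 <= B & exists2 rho, 0 < rho &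
  \forall e \near 0^'+, forall t y, 0 <= t <= L -> `|y - x0 t| < rho ->
     `|pert S y t (delta e) e| <= B.
Proof.
have [oU _ _ _] := ham_C1 hr0 hS.
have key : \forall i \near filter_prod +oo (filter_prod (0 : R)^'+ (0 : R)^'+),
   forall t, 0 <= t <= L -> forall y : phase, `|y - x0 t| < i.2.1 ->
     `|pert S y t (delta i.2.2) i.2.2| <= i.1.
  apply: near_segment => t tL.
  pose F3 := filter_prod (nbhs (x0 t)) (filter_prod (nbhs t) (0 : R)^'+).
  have nU : \forall y \near x0 t, U y.
    by apply: open_nbhs_nbhs; split => //; exact: (x0_in hx0).
  have n0 : \forall e \near (0 : R)^'+, 0 < delta e /\ 0 <= e.
    have ge0 : \forall e \near (0 : R)^'+, 0 < e by exact: nbhs_right_gt.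
    by apply: filterS2 Hsol ge0 => e [h1 _ _ _] h2; split => //; exact: ltW.
  have s1 : i.2 @[i --> F3] --> filter_prod (nbhs t) (0 : R)^'+ by exact: cvg_snd.
  have s3 : i.2.2 @[i --> F3] --> (0 : R)^'+ by exact: (cvg_comp snd snd s1 cvg_snd).
  have [cp _] : pert S i.1 i.2.1 (delta i.2.2) i.2.2 @[i --> F3] --> pert S (x0 t) t d0 0 /\
     jac_pert S i.1 i.2.1 (delta i.2.2) i.2.2 @[i --> F3] --> jac_pert S (x0 t) t d0 0.
    apply: (@pert_cvg _ _ S U r0 hr0 hS _ F3 _ (fun i => i.1) (fun i => i.2.1)
       (fun i => delta i.2.2) (fun i => i.2.2)) => //.
    - exact: cvg_fst.
    - exact: (cvg_comp snd fst s1 cvg_fst).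
    - exact: (cvg_comp _ _ s3 Hd).
    - exact: (cvg_trans s3 (cvg_within _)).
    - exists ([set y | U y], setT `*` [set e | 0 < delta e /\ 0 <= e]).
        split => //=; exists (setT, [set e | 0 < delta e /\ 0 <= e]) => //=.
        by split => //; exact: filterT.
      by move=> [y [s e]] /= [Uy [_ [h1 h2]]]; split.
    - exact: (x0_in hx0).
  have [[A1 B1] /= [nA1 [[A2 A3] /= [nA2 nA3] B1s] Hs]] :
    \forall i \near F3, `|pert S i.1 i.2.1 (delta i.2.2) i.2.2| < `|pert S (x0 t) t d0 0| + 1.
    by apply: (cvgr_norm_lt _ cp); rewrite ltrDl.
  have /nbhs_normP[r /= r00 Hr] := nA1.
  have cx' : x0 s @[s --> t] --> x0 t := @x0_continuous _ _ S U x0 hx0 t.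
  have n1 : \forall s \near t, `|x0 s - x0 t| < r / 2.
    by have /cvgrPdistC_lt := cx'; apply; rewrite divr_gt0.
  exists ([set s | `|x0 s - x0 t| < r / 2 /\ A2 s],
     [set M | `|pert S (x0 t) t d0 0| + 1 <= M] `*` ([set rho | rho < r / 2] `*` A3)).
    split => /=; first exact: filterI.
    exists ([set M | `|pert S (x0 t) t d0 0| + 1 <= M], [set rho | rho < r / 2] `*` A3) => //=.
    split; first exact: nbhs_pinfty_ge.
    exists ([set rho | rho < r / 2], A3) => //=; split => //.
    by apply: nbhs_right_lt; rewrite divr_gt0.
  move=> [s [M [rho e]]] /= [[h1 h2] [h3 [h4 h5]]] sL y hy.
  apply: le_trans h3; apply: ltW; apply: (Hs (y, (s, e))); split => /=; last exact: (B1s (s, e)).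
  apply: Hr => /=; rewrite distrC -(subrKA (x0 s)) (le_lt_trans (ler_normD _ _))//.
  by rewrite (splitr r) ltrD// (lt_trans hy).
have [[AM AB] /= [nM [[Ar Ae] /= [nr ne] ABs] Hs]] := key.
have [M [AMM M0]] := filter_ex (filterI nM (nbhs_pinfty_ge (num_real (0 : R)))).
have [rho [Arr rho0]] := filter_ex (filterI nr (nbhs_right_gt (0 : R))).
exists M => //; exists rho => //.
apply: filterS ne => e Aee t y tL hy.
by apply: (Hs (M, (rho, e))) => //; split => //=; exact: (ABs (rho, e)).
Unshelve. all: by end_near. Qed.

Lemma xe_jcvg : jcvg L 0^'+ xe x0.
Proof.
have [B B0 [rho1 rho10 Hp]] := pert_tube_bound.
have [C [rho0 [C0 rho00 HC]]] := trajectory_close L0 (grad_C1 hr0 hS) (x0_in hx0) (x0_derive hx0).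
pose rho := Num.min rho0 rho1.
have rhop : 0 < rho by rewrite lt_min rho00.
apply: uniform_jcvg; first by move=> t _; exact: (x0_continuous hx0).
move=> eta eta0.
pose m := Num.min rho eta.
have m0 : 0 < m by rewrite lt_min rhop.
have cs : C * (`|xi e - x0 0| + e * B) @[e --> 0^'+] --> C * (0 + 0 * B).
  apply: cvgM; first exact: cvg_cst.
  apply: cvgD; last by apply: cvgM; [exact: cvg_within | exact: cvg_cst].
  have : xi e - x0 0 @[e --> 0^'+] --> x0 0 - x0 0 by apply: cvgB => //; exact: cvg_cst.
  by rewrite subrr => /cvg_norm; rewrite normr0.
have small : \forall e \near 0^'+, C * (`|xi e - x0 0| + e * B) < m.
  by apply: (cvgr_lt _ cs); rewrite mul0r addr0 mulr0.
have ge0 : \forall e \near (0 : R)^'+, 0 < e by exact: nbhs_right_gt.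
near=> e => t tL.
have e0 : 0 < e by near: e.
have [de sol xe0 fund] : [/\ 0 < delta e, solution U (forced_field S (delta e) e) (xe e),
  xe e 0 = xi e & fundamental (var_matrix S (delta e) e (xe e)) (Xe e)].
  by near: e; exact: Hsol.
have Hpe : forall t y, 0 <= t <= L -> `|y - x0 t| < rho1 -> `|pert S y t (delta e) e| <= B.
  by near: e.
have sm : C * (`|xi e - x0 0| + e * B) < m by near: e; exact: small.
have smr : C * (`|xe e 0 - x0 0| + e * B) < rho.
  by rewrite xe0; apply: (lt_le_trans sm); rewrite /m ge_min lexx.
have eB : 0 <= e * B by rewrite mulr_ge0// ltW.
have := HC (xe e) (fun t => e *: pert S (xe e t) t (delta e) e) rho (e * B) _ eB _ _ smr t tL.
rewrite xe0 => h; apply: (le_trans (h _ _ _)).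
- by rewrite /rho ge_min lexx.
- by move=> s; have [_] := sol s.
- move=> s sL hs; rewrite normrZ gtr0_norm// ler_wpM2l ?(ltW e0)//.
  by apply: Hpe => //; apply: (lt_le_trans hs); rewrite /rho ge_min lexx orbT.
- by apply: ltW; apply: (lt_le_trans sm); rewrite /m ge_min lexx orbT.
Unshelve. all: by end_near. Qed.

Lemma xe_in : \forall e \near 0^'+, forall t, U (xe e t).
Proof. by apply: filterS Hsol => e [_ sol _ _] t; have [] := sol t. Qed.

Lemma pert_jcvg :
  jcvg L 0^'+ (fun e t => pert S (xe e t) t (delta e) e) (fun t => pert S (x0 t) t d0 0) /\
  jcvg L 0^'+ (fun e t => jac_pert S (xe e t) t (delta e) e) (fun t => jac_pert S (x0 t) t d0 0).
Proof.
have K t : 0 <= t <= L ->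
   pert S (xe p.1 p.2) p.2 (delta p.1) p.1 @[p --> filter_prod 0^'+
      (within [set s | 0 <= s <= L] (nbhs t))] --> pert S (x0 t) t d0 0 /\
   jac_pert S (xe p.1 p.2) p.2 (delta p.1) p.1 @[p --> filter_prod 0^'+
      (within [set s | 0 <= s <= L] (nbhs t))] --> jac_pert S (x0 t) t d0 0.
  move=> tL.
  apply: (@pert_cvg _ _ S U r0 hr0 hS _ _ _ (fun p => xe p.1 p.2) (fun p => p.2)
       (fun p => delta p.1) (fun p => p.1)) => //.
  - exact: xe_jcvg.
  - exact: (cvg_trans cvg_snd (cvg_within _)).
  - exact: (cvg_comp fst _ cvg_fst Hd).
  - exact: (cvg_trans cvg_fst (cvg_within _)).
  - exists ([set e | [/\ forall t, U (xe e t), 0 < delta e & 0 < e]], setT) => /=.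
      split; last exact: filterT.
      have ge0 : \forall e \near (0 : R)^'+, 0 < e by exact: nbhs_right_gt.
      apply: filterS3 xe_in Hsol ge0 => e h1 [h2 _ _ _] h3; split => //.
    by move=> [e s] /= [[h1 h2 h3] _]; split => //; exact: ltW.
  - exact: (x0_in hx0).
by split => t tL; have [] := K t tL.
Qed.

Lemma grad_jcvg : jcvg L 0^'+ (fun e t => grad H (xe e t)) (fun t => grad H (x0 t)).
Proof.
apply: jcvg_comp xe_jcvg _ => t _.
exact: (grad_continuous hr0 hS (x0_in hx0 t)).
Qed.

Lemma hess_jcvg : jcvg L 0^'+ (fun e t => hessian H (xe e t)) (fun t => hessian H (x0 t)).
Proof.
apply: jcvg_comp xe_jcvg _ => t _.
exact: (hessian_continuous hr0 hS (x0_in hx0 t)).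
Qed.

Lemma var_jcvg : jcvg L 0^'+ (fun e => var_matrix S (delta e) e (xe e))
  (fun t => J *m hessian H (x0 t)).
Proof.
move=> t tL.
have -> : J *m hessian H (x0 t) = J *m hessian H (x0 t) + 0 *: jac_pert S (x0 t) t d0 0.
  by rewrite scale0r addr0.
apply: cvgD.
  by apply: cvg_mulmx; [exact: cvg_cst | exact: hess_jcvg].
apply: cvgZ; first exact: (cvg_trans cvg_fst (cvg_within _)).
by have [_] := pert_jcvg; apply.
Qed.

Lemma Xe_jcvg : jcvg L 0^'+ Xe X0.
Proof.
have cA t : 0 <= t <= L -> {for t, continuous (fun t => J *m hessian H (x0 t))}.
  move=> _; have c : hessian H (x0 s) @[s --> t] --> hessian H (x0 t)
    by exact: (hessian_x0_continuous hr0 hS hx0).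
  suff : J *m hessian H (x0 s) @[s --> t] --> J *m hessian H (x0 t) by [].
  by apply: cvg_mulmx => //; exact: cvg_cst.
have cX t : 0 <= t <= L -> {for t, continuous X0} by move=> _; exact: (X0_continuous hX0).
have [BA BA0 HBA] := segment_bounded cA.
have [BX BX0 HBX] := segment_bounded cX.
pose k : R := (n + n)%:R.
have k0 : 0 <= k by exact: ler0n.
pose K := k * (BA + 1).
have K0 : 0 <= K by rewrite mulr_ge0// addr_ge0// ltW.
have [C C0 HC] := @gronwall_tube R (n + n) (n + n) K L K0 L0.
apply: uniform_jcvg => // eta eta0.
have den : 0 < C * (k * BX) + 1 by rewrite ltr_wpDl// !mulr_ge0// ltW.
pose a := Num.min 1 (eta / (C * (k * BX) + 1)).
have a0 : 0 < a by rewrite lt_min ltr01 divr_gt0.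
have small := jcvg_uniform _ cA var_jcvg a0.
near=> e => t tL.
have [de sol xe0 [X1 dX]] : [/\ 0 < delta e, solution U (forced_field S (delta e) e) (xe e),
  xe e 0 = xi e & fundamental (var_matrix S (delta e) e (xe e)) (Xe e)].
  by near: e; exact: Hsol.
have sm : forall t, 0 <= t <= L -> `|var_matrix S (delta e) e (xe e) t - J *m hessian H (x0 t)| <= a.
  by near: e; exact: small.
pose V := fun t => Xe e t - X0 t.
pose V' := fun t => var_matrix S (delta e) e (xe e) t *m Xe e t - J *m hessian H (x0 t) *m X0 t.
have dV s : is_derive s (1 : R) V (V' s) := is_deriveB (dX s) (X0_derive hX0 s).
have V0 : V 0 = 0 by rewrite /V X1 (X0_at0 hX0) subrr.
have e1 : 0 <= k * a * BX by rewrite !mulr_ge0// ltW.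
(* The equation for X is linear, so the tube may have any radius; this one
   exceeds the final bound by 1. *)
have hV s : 0 <= s <= L -> `|V s| < C * (`|V 0| + k * a * BX) + 1 ->
    `|V' s| <= K * `|V s| + k * a * BX.
  move=> sL _; pose A := var_matrix S (delta e) e (xe e) s.
  have -> : V' s = A *m V s + (A - J *m hessian H (x0 s)) *m X0 s.
    by rewrite /V' /V -/A mulmxBr mulmxBl addrA subrK.
  have hA : `|A| <= BA + 1.
    rewrite -(subrK (J *m hessian H (x0 s)) A) addrC (le_trans (ler_normD _ _))//.
    by rewrite lerD ?HBA// (le_trans (sm s sL))// /a ge_min lexx.
  apply: (le_trans (ler_normD _ _)); apply: lerD; apply: (le_trans (mulmx_norm_le _ _)).
    by rewrite ler_wpM2r// ler_wpM2l.
  by rewrite ler_pM ?mulr_ge0// ?ler_wpM2l ?sm// HBX.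
have := HC V V' _ _ e1 dV hV _ t tL; rewrite V0 normr0 add0r => h.
apply: (le_trans (h _)); first by rewrite ltrDl.
rewrite [leLHS](_ : _ = a * (C * (k * BX))); last by ring.
apply: (@le_trans _ _ (a * (C * (k * BX) + 1))).
  by rewrite ler_wpM2l ?(ltW a0)// lerDl.
by rewrite -ler_pdivlMr// /a ge_min lexx orbT.
Unshelve. all: by end_near. Qed.

End Perturbed.

(** * Derivative of the Melnikov function *)

Section Melnikov.
Context {R : realType} {n : nat}.
Variables (S : mech R n) (U : set 'cV[R]_(n + n)) (r0 : nat).
Hypotheses (hr0 : (3 <= r0)%N) (hS : admissible S U r0).
Local Notation phase := 'cV[R]_(n + n).
Local Notation J := (@Jmx R n).
Local Notation H := (ham S).
Local Notation mu := (@lebesgue_measure R).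
Variables (x0 : R -> phase) (hx0 : solution U (fun y _ => cons_field S y) x0).
Variables (d0 P : R) (d00 : 0 < d0) (P0 : 0 < P).

Lemma translated_orbit_cvg (t : R) (T : Type) (F : set_system T) (FF : Filter F) (s r : T -> R) :
  s i @[i --> F] --> (0 : R) -> r i @[i --> F] --> t ->
  [/\ x0 (r i + s i) @[i --> F] --> x0 t,
      grad H (x0 (r i + s i)) @[i --> F] --> grad H (x0 t),
      hessian H (x0 (r i + s i)) @[i --> F] --> hessian H (x0 t),
      pert S (x0 (r i + s i)) (r i) d0 0 @[i --> F] --> pert S (x0 t) t d0 0 &
      jac_pert S (x0 (r i + s i)) (r i) d0 0 @[i --> F] --> jac_pert S (x0 t) t d0 0].
Proof.
move=> cs cr.
have cx : x0 (r i + s i) @[i --> F] --> x0 t.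
  have crs : r i + s i @[i --> F] --> t by rewrite -[X in _ --> X]addr0; exact: cvgD.
  have c0 : x0 s @[s --> t] --> x0 t by exact: (x0_continuous hx0).
  exact: (cvg_comp _ _ crs c0).
have cg : grad H y @[y --> x0 t] --> grad H (x0 t) := grad_continuous hr0 hS (x0_in hx0 t).
have ch : hessian H y @[y --> x0 t] --> hessian H (x0 t) := hessian_continuous hr0 hS (x0_in hx0 t).
have [cp cq] : pert S (x0 (r i + s i)) (r i) d0 0 @[i --> F] --> pert S (x0 t) t d0 0 /\
      jac_pert S (x0 (r i + s i)) (r i) d0 0 @[i --> F] --> jac_pert S (x0 t) t d0 0.
  apply: (@pert_cvg _ _ S U r0 hr0 hS _ _ _ (fun i => x0 (r i + s i)) r (fun=> d0) (fun=> 0)) => //.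
  - exact: cvg_cst.
  - exact: cvg_cst.
  - by apply: nearW => i; split => //; exact: (x0_in hx0).
  - exact: (x0_in hx0).
exact: And5 cx (cvg_comp _ _ cx cg) (cvg_comp _ _ cx ch) cp cq.
Qed.

Definition mel_integrand (s t : R) : R :=
  dot (grad H (x0 (t + s))) (pert S (x0 (t + s)) t d0 0).

(** The derivative of [mel_integrand] in s: the point x0(t + s) moves with velocity
v = J DH and the explicit time t of the perturbation stays fixed. *)
Definition mel_integrand_slope (s t : R) : R :=
  let x := x0 (t + s) in let v := J *m grad H x in
  ((hessian H x *m v)^T *m pert S x t d0 0
    + (grad H x)^T *m (jac_pert S x t d0 0 *m v)) 0 0.

Lemma mel_integrand_derive s t :
  is_derive s (1 : R) (mel_integrand ^~ t) (mel_integrand_slope s t).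
Proof.
have dx : is_derive s (1 : R) (fun r => x0 (t + r)) (J *m grad H (x0 (t + s))).
  have dd := x0_derive hx0 (t + s).
  have := is_derive_translate (f := x0) (b := t) (p := s) (v := (1 : R)).
  have [dv <-] := dd; apply; exact: dv.
have d1 := C1_chain (grad_C1 hr0 hS) (x0_in hx0 (t + s)) dx.
have d2 := C1_chain (c := fun r => x0 (t + r)) (pert_C1 hr0 hS t d00 (lexx 0)) (x0_in hx0 (t + s)) dx.
have d3 := is_derive_mulmx (is_derive_trmx d1) d2.
by have /is_derive_mxP := d3; apply.
Qed.

Lemma mel_integrand_slope_cvg t : mel_integrand_slope p.1 p.2 @[p --> filter_prod (nbhs (0 : R)) (nbhs t)] -->
  mel_integrand_slope 0 t.
Proof.
have [cx cg ch cp cq] := @translated_orbit_cvg t _ (filter_prod (nbhs (0 : R)) (nbhs t)) _ fst snd cvg_fst cvg_snd.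
have cv : J *m grad H (x0 (p.2 + p.1)) @[p --> filter_prod (nbhs (0 : R)) (nbhs t)] -->
   J *m grad H (x0 t) by exact: cvg_mulmx (cvg_cst J) cg.
rewrite /mel_integrand_slope addr0.
apply: cvg_entry; apply: cvgD.
  exact: cvg_mulmx (cvg_trmx (cvg_mulmx ch cv)) cp.
exact: cvg_mulmx (cvg_trmx cg) (cvg_mulmx cq cv).
Qed.

Lemma mel_integrand_slope_continuous : continuous (mel_integrand_slope 0).
Proof.
move=> t; have c := @mel_integrand_slope_cvg t.
have cp : ((0 : R), s) @[s --> t] --> filter_prod (nbhs (0 : R)) (nbhs t).
  exact: (@cvg_pair _ _ _ (nbhs t) (nbhs (0 : R)) (nbhs t) _ _ _ (fun=> 0) id (cvg_cst _) cvg_id).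
exact: (cvg_comp _ _ cp c).
Qed.

Lemma mel_integrand_continuous s : continuous (mel_integrand s).
Proof.
move=> t; have crs : r + s @[r --> t] --> t + s by apply: cvgD; [exact: cvg_id | exact: cvg_cst].
have c0 : x0 r @[r --> t + s] --> x0 (t + s) by exact: (x0_continuous hx0).
have cx := cvg_comp _ _ crs c0.
have cg : grad H y @[y --> x0 (t + s)] --> grad H (x0 (t + s)) := grad_continuous hr0 hS (x0_in hx0 _).
have [cp _] : pert S (x0 (r + s)) r d0 0 @[r --> t] --> pert S (x0 (t + s)) t d0 0 /\
      jac_pert S (x0 (r + s)) r d0 0 @[r --> t] --> jac_pert S (x0 (t + s)) t d0 0.
  apply: (@pert_cvg _ _ S U r0 hr0 hS _ _ _ (fun r => x0 (r + s)) id (fun=> d0) (fun=> 0)) => //.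
  - exact: cvg_cst.
  - exact: cvg_cst.
  - by apply: nearW => i; split => //; exact: (x0_in hx0).
  - exact: (x0_in hx0).
have cgx := cvg_comp _ _ cx cg.
suff : mel_integrand s r @[r --> t] --> mel_integrand s t by [].
by apply: cvg_entry; exact: cvg_mulmx (cvg_trmx cgx) cp.
Qed.

(** Differentiation under the integral sign; the domination near s = 0 comes from
joint continuity and compactness of the period. *)
Lemma melnikov_derive :
  derive1 (melnikov S x0 P d0) 0 = \int[mu]_(t in `[0, P]) mel_integrand_slope 0 t.
Proof.
have cc t : 0 <= t <= P -> {for t, continuous (mel_integrand_slope 0)}.
  by move=> _; exact: mel_integrand_slope_continuous.
have [M M0 HM] := segment_bounded cc.
have bnd : \forall s \near (0 : R), forall t, 0 <= t <= P -> `|mel_integrand_slope s t| <= M + 1.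
  apply: (@near_segment R P R (nbhs (0 : R)) (nbhs_filter _)
    (fun s t => `|mel_integrand_slope s t| <= M + 1)) => t tP.
  have : \forall p \near filter_prod (nbhs (0 : R)) (nbhs t), `|mel_integrand_slope p.1 p.2| < M + 1.
    apply: (cvgr_norm_lt _ (@mel_integrand_slope_cvg t)).
    by rewrite (le_lt_trans (HM _ tP))// ltrDl.
  move=> [[A B] /= [nA nB] AB].
  by exists (B, A) => //= -[s r] /= [Bs Ar] _; apply: ltW; exact: (AB (r, s)).
have /nbhs_normP[r /= r00 Hr] := bnd.
have integ s : mu.-integrable `[0, P] (EFin \o mel_integrand s).
  apply: continuous_compact_integrable; first exact: segment_compact.
  by apply: continuous_subspaceT; exact: mel_integrand_continuous.
have integM : mu.-integrable `[0, P] (EFin \o (cst (M + 1))).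
  apply: continuous_compact_integrable; first exact: segment_compact.
  by apply: continuous_subspaceT => ?; exact: cvg_cst.
have := @differentiation_under_integral R _ _ mu mel_integrand `[0, P]%classic
  (measurable_itv _) 0 (- r) r _ _ _ (cst (M + 1)) _ integM _.
rewrite /melnikov => ->.
- by apply: eq_Rintegral => t _; rewrite partial1of2E (@derive_val _ _ _ _ _ _ _ (mel_integrand_derive 0 t)).
- by rewrite /= in_itv/= oppr_lt0 r00.
- by move=> s _; exact: integ.
- by move=> s t _ _; have [] := mel_integrand_derive s t.
- by move=> t; rewrite addr_ge0// ltW.
- move=> s t; rewrite /= !in_itv/= => sr tP.
  rewrite partial1of2E (@derive_val _ _ _ _ _ _ _ (mel_integrand_derive s t)).
  by apply: Hr => //=; rewrite sub0r normrN ltr_norml.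
Qed.

End Melnikov.

Lemma col_dotC (R : comPzRingType) k (u v : 'cV[R]_k) : (u^T *m v) 0 0 = (v^T *m u) 0 0.
Proof. by rewrite -[LHS](mxE trmx_key (fun i j => (u^T *m v) j i)) -/(trmx _) trmx_mul trmxK. Qed.

Lemma is_derive_mxtrace (R : realType) k (A : R -> 'M[R]_k) (t : R) (D : 'M[R]_k) :
  is_derive t (1 : R) A D -> is_derive t (1 : R) (fun r => \tr (A r)) (\tr D).
Proof.
move=> /is_derive_mxP dA.
have -> : (fun r => \tr (A r)) = \sum_(i < k) (fun r => A r i i).
  by apply/funext => r; rewrite fct_sumE.
exact: is_derive_sum.
Qed.

(** * First-order drift over one period *)

Section Limits.
Context {R : realType} {n : nat}.
Variables (S : mech R n) (U : set 'cV[R]_(n + n)) (r0 : nat).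
Hypotheses (hr0 : (3 <= r0)%N) (hS : admissible S U r0).
Local Notation phase := 'cV[R]_(n + n).
Local Notation J := (@Jmx R n).
Local Notation H := (ham S).
Local Notation mu := (@lebesgue_measure R).
Variables (x0 : R -> phase) (hx0 : solution U (fun y _ => cons_field S y) x0).
Variables (X0 : R -> 'M[R]_(n + n))
  (hX0 : fundamental (fun t => J *m hessian H (x0 t)) X0).
Variables (d0 : R) (d00 : 0 < d0) (delta : R -> R) (xi : R -> phase)
  (xe : R -> R -> phase) (Xe : R -> R -> 'M[R]_(n + n)).
Hypotheses (Hd : delta e @[e --> 0^'+] --> d0) (Hxi : xi e @[e --> 0^'+] --> x0 0).
Hypothesis Hsol : \forall e \near 0^'+,
  [/\ 0 < delta e, solution U (forced_field S (delta e) e) (xe e), xe e 0 = xi e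
    & fundamental (var_matrix S (delta e) e (xe e)) (Xe e)].
Variables (P : R) (P0 : 0 < P) (s : R -> R) (sP : s e @[e --> 0^'+] --> P).

Let L := P + 1.
Let L0 : 0 <= L. Proof. exact: addr_ge0 (ltW P0) ler01. Qed.
Let PL : 0 < P < L. Proof. by rewrite /L P0 ltrDl ltr01. Qed.

(** The upper bound P + 1 leaves room for the perturbed period s e, which may
exceed P. *)
Lemma primitive_limit k p (G : R -> R -> 'M[R]_(k, p)) (g : R -> R -> 'M[R]_(k, p))
    (g0 : R -> 'M[R]_(k, p)) : continuous g0 -> jcvg L 0^'+ g g0 ->
  (\forall e \near 0^'+, G e 0 = 0 /\ forall t, is_derive t (1 : R) (G e) (g e t)) ->
  exists2 G0 : R -> 'M[R]_(k, p), G e (s e) @[e --> 0^'+] --> G0 P &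
    G0 0 = 0 /\ forall t, 0 <= t <= L -> is_derive t (1 : R) G0 (g0 t).
Proof.
move=> cg0 jg HG.
have [G0 G00 dG0] := primitive_mx_exists L cg0.
exists G0 => //.
have jG : jcvg L 0^'+ G G0.
  apply: (@jcvg_primitive R L R 0^'+ _ k p G g G0 g0 L0 _ jg dG0).
    by move=> t _; exact: cg0.
  by apply: filterS HG => e [h1 h2]; rewrite G00; split.
exact: (@jcvg_at R L R 0^'+ _ _ G G0 s P jG PL sP).
Qed.

Lemma continuous_mulmx m k p (f : R -> 'M[R]_(m, k)) (g : R -> 'M[R]_(k, p)) :
  continuous f -> continuous g -> continuous (fun t => f t *m g t).
Proof.
move=> cf cg t; have c1 : f r @[r --> t] --> f t := cf t.
have c2 : g r @[r --> t] --> g t := cg t.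
suff : f r *m g r @[r --> t] --> f t *m g t by [].
exact: cvg_mulmx c1 c2.
Qed.

Lemma continuous_trmx m k (f : R -> 'M[R]_(m, k)) :
  continuous f -> continuous (fun t => (f t)^T).
Proof.
move=> cf t; have c1 : f r @[r --> t] --> f t := cf t.
suff : (f r)^T @[r --> t] --> (f t)^T by [].
exact: cvg_trmx c1.
Qed.

Lemma continuous_addmx m k (f g : R -> 'M[R]_(m, k)) :
  continuous f -> continuous g -> continuous (fun t => f t + g t).
Proof.
move=> cf cg t; have c1 : f r @[r --> t] --> f t := cf t.
have c2 : g r @[r --> t] --> g t := cg t.
suff : f r + g r @[r --> t] --> f t + g t by [].
exact: cvgD c1 c2.
Qed.

(** The rate of change, to first order in eps, of the energy covector. *)
Definition covector_rate (t : R) : 'rV[R]_(n + n) :=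
  ((pert S (x0 t) t d0 0)^T *m hessian H (x0 t)
    + (grad H (x0 t))^T *m jac_pert S (x0 t) t d0 0) *m X0 t.

Lemma covector_rate_continuous : continuous covector_rate.
Proof.
have [cp cq] := pert_x0_continuous hr0 hS hx0 d00.
have cg := grad_x0_continuous hr0 hS hx0.
have ch := hessian_x0_continuous hr0 hS hx0.
have cX : continuous X0 := X0_continuous hX0.
apply: continuous_mulmx cX; apply: continuous_addmx.
  exact: continuous_mulmx (continuous_trmx cp) ch.
exact: continuous_mulmx (continuous_trmx cg) cq.
Qed.

(** Since X0 carries the flow direction along the orbit, the drift of the covector in
that direction is the slope of the Melnikov integrand. *)
Lemma covector_rate_direction t : 0 <= t ->
  (covector_rate t *m (J *m grad H (x0 0))) 0 0 = mel_integrand_slope S x0 d0 0 t.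
Proof.
move=> t0; rewrite /covector_rate -mulmxA (flow_direction hr0 hS hx0 hX0 t0).
rewrite /mel_integrand_slope addr0; set p := pert _ _ _ _ _; set v := J *m _; set h := hessian _ _.
rewrite mulmxDl -!mulmxA [LHS]mxE [RHS]mxE; congr (_ + _).
by rewrite -/(dot p (h *m v)) /dot col_dotC.
Qed.

(** The drift of the covector over one period is eps times an integral that converges
to its unperturbed value, since the integrands converge jointly. *)
Lemma covector_limit : exists2 be0 : 'rV[R]_(n + n),
  e^-1 *: ((grad H (xe e (s e)))^T *m Xe e (s e) - (grad H (xi e))^T) @[e --> 0^'+]
    --> be0 &
  (be0 *m (J *m grad H (x0 0))) 0 0 = derive1 (melnikov S x0 P d0) 0.
Proof.
pose w e (t : R) := (grad H (xe e t))^T *m Xe e t.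
have jx := xe_jcvg hr0 hS hx0 d00 Hd Hxi Hsol L0.
have [jp jq] := pert_jcvg hr0 hS hx0 d00 Hd Hxi Hsol L0.
have jg := grad_jcvg hr0 hS hx0 d00 Hd Hxi Hsol L0.
have jh := hess_jcvg hr0 hS hx0 d00 Hd Hxi Hsol L0.
have jX := Xe_jcvg hr0 hS hx0 hX0 d00 Hd Hxi Hsol L0.
have ge0 : \forall e \near (0 : R)^'+, 0 < e by exact: nbhs_right_gt.
have [||B cB [B00 dB]] := @primitive_limit _ _ (fun e t => e^-1 *: (w e t - w e 0))
  (fun e t => ((pert S (xe e t) t (delta e) e)^T *m hessian H (xe e t)
    + (grad H (xe e t))^T *m jac_pert S (xe e t) t (delta e) e) *m Xe e t)
  covector_rate covector_rate_continuous.
- apply: jcvg_mulmx jX; apply: jcvgD; apply: jcvg_mulmx => //; exact: jcvg_trmx.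
- apply: filterS2 Hsol ge0 => e [de sol xe0 [Xe0 dXe]] e0; rewrite subrr scaler0; split => // t.
  have [Ux dx] := sol t.
  have := is_derive_energy_covector (Jmx_tr (R := R)) (grad_C1 hr0 hS) Ux (ham_hessian_sym hr0 hS Ux) dx (dXe t).
  set D := (_ *m Xe e t) => dw.
  have dB := is_deriveB dw (is_derive_cst (w e 0) t 1).
  have dZ := is_deriveZ e^-1 dB.
  by apply: is_derive_eq dZ _; rewrite subr0 scalerA mulVf ?scale1r ?gt_eqF.
exists (B P).
  apply: cvg_trans cB; apply: near_eq_cvg.
  apply: filterS Hsol => e [_ _ xe0 [Xe0 _]].
  by rewrite /w xe0 Xe0 mulmx1.
rewrite (melnikov_derive hr0 hS hx0 P d00).
have cm : continuous (mel_integrand_slope S x0 d0 0) by exact: (mel_integrand_slope_continuous hr0 hS hx0 d00).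
have dF t : 0 <= t <= P -> is_derive t (1 : R) (fun t => (B t *m (J *m grad H (x0 0))) 0 0)
   (mel_integrand_slope S x0 d0 0 t).
  move=> /andP[t0 tP].
  have tL : 0 <= t <= L by rewrite t0 (le_trans tP)// lerDl.
  rewrite -(covector_rate_direction t0).
  have := is_derive_mulmx (dB t tL) (is_derive_cst (J *m grad H (x0 0)) t (1 : R)).
  by rewrite mulmx0 addr0 => /is_derive_mxP; apply.
by rewrite (Rintegral_FTC2 P0 cm dF) B00 mul0mx [X in _ - X]mxE subr0.
Qed.

(** The rate of change, to first order in eps, of the pulled-back symplectic form. *)
Definition form_rate (t : R) : 'M[R]_(n + n) :=
  let q := jac_pert S (x0 t) t d0 0 in (X0 t)^T *m (q^T *m J + J *m q) *m X0 t.

Lemma form_rate_continuous : continuous form_rate.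
Proof.
have [_ cq] := pert_x0_continuous hr0 hS hx0 d00.
have cX : continuous X0 := X0_continuous hX0.
have cJ : continuous (fun _ : R => J) by move=> ?; exact: cvg_cst.
have cXT := continuous_trmx cX.
apply: continuous_mulmx cX; apply: (continuous_mulmx cXT).
exact: (continuous_addmx (continuous_mulmx (continuous_trmx cq) cJ) (continuous_mulmx cJ cq)).
Qed.

(** The two terms of the rate have equal traces, being transposes of each other up to
the skew-symmetry of Om and J; X^T J = J X^-1 turns them into the integrand of the
volume contraction. *)
Lemma form_rate_trace v (RV : 'M[R]_(n + n, v + v)) t : 0 <= t ->
  RV^T *m J *m RV \in unitmx ->
  \tr (invmx (RV^T *m J *m RV) *m (RV^T *m form_rate t *m RV)) =
  2 * \tr (sympl_linv RV *m invmx (X0 t) *m jac_pert S (x0 t) t d0 0 *m X0 t *m RV).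
Proof.
move=> t0; rewrite /sympl_linv /form_rate; set Om := RV^T *m J *m RV => uO.
set q := jac_pert _ _ _ _ _; set X := X0 t.
have OmT : (invmx Om)^T = - invmx Om.
  have -> : (invmx Om)^T = invmx (- Om).
    by rewrite trmx_inv /Om !trmx_mul trmxK Jmx_tr mulNmx mulmxN mulmxA.
  have uN : -1 *: Om \in unitmx by rewrite unitmxZ ?unitrN1.
  by rewrite -scaleN1r invmxZ// invrN1 scaleN1r.
have [uX _] := sympl_inv (X0_symplectic hr0 hS hx0 hX0 t0).
have JX : J *m invmx X = X^T *m J.
  by rewrite -[RHS](mulmxK uX) (X0_symplectic hr0 hS hx0 hX0 t0).
have E2 : \tr (invmx Om *m (RV^T *m (X^T *m (J *m q) *m X) *m RV)) =
   \tr (invmx Om *m RV^T *m J *m invmx X *m q *m X *m RV).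
  by congr (\tr _); rewrite -(mulmxA (invmx Om *m RV^T) J) JX !mulmxA.
have E1 : \tr (invmx Om *m (RV^T *m (X^T *m (q^T *m J) *m X) *m RV)) =
   \tr (invmx Om *m (RV^T *m (X^T *m (J *m q) *m X) *m RV)).
  rewrite -[LHS]mxtrace_tr trmx_mul OmT mulmxN -mulNmx mxtrace_mulC.
  congr (\tr (_ *m _)).
  by rewrite !trmx_mul !trmxK Jmx_tr !(mulNmx, mulmxN) opprK !mulmxA.
by rewrite mulmxDr mulmxDl mulmxDr mulmxDl mulmxDr linearD /= E1 E2 mulrDl mul1r.
Qed.

Lemma form_limit : exists2 G0 : 'M[R]_(n + n),
  e^-1 *: ((Xe e (s e))^T *m J *m Xe e (s e) - J) @[e --> 0^'+] --> G0 &
  forall v (RV : 'M[R]_(n + n, v + v)), RV^T *m J *m RV \in unitmx -> (0 < v)%N ->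
    \tr (invmx (RV^T *m J *m RV) *m (RV^T *m G0 *m RV)) =
      - (2 * P * v%:R) * vol_contraction S x0 X0 P d0 RV.
Proof.
pose w e (t : R) := (Xe e t)^T *m J *m Xe e t.
have [_ jq] := pert_jcvg hr0 hS hx0 d00 Hd Hxi Hsol L0.
have jX := Xe_jcvg hr0 hS hx0 hX0 d00 Hd Hxi Hsol L0.
have ge0 : \forall e \near (0 : R)^'+, 0 < e by exact: nbhs_right_gt.
have jJ : jcvg L 0^'+ (fun _ _ : R => J) (fun=> J).
  by apply: jcvg_cst => t _; exact: cvg_cst.
have [||B cB [B00 dB]] := @primitive_limit _ _ (fun e t => e^-1 *: (w e t - w e 0))
  (fun e t => (Xe e t)^T *m ((jac_pert S (xe e t) t (delta e) e)^T *m J +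
     J *m jac_pert S (xe e t) t (delta e) e) *m Xe e t)
  form_rate form_rate_continuous.
- apply: (jcvg_mulmx _ _ jX); apply: (jcvg_mulmx _ (jcvg_trmx _ jX)).
  exact: (jcvgD _ (jcvg_mulmx _ (jcvg_trmx _ jq) jJ) (jcvg_mulmx _ jJ jq)).
- apply: filterS2 Hsol ge0 => e [de sol xe0 [Xe0 dXe]] e0; rewrite subrr scaler0; split => // t.
  have [Ux _] := sol t.
  have := is_derive_pullback_form (Jmx_tr (R := R)) (Jmx_sqr (R := R)) (ham_hessian_sym hr0 hS Ux) (dXe t).
  set D := (_ *m Xe e t) => dw.
  have dB := is_deriveB dw (is_derive_cst (w e 0) t 1).
  have dZ := is_deriveZ e^-1 dB.
  by apply: is_derive_eq dZ _; rewrite subr0 scalerA mulVf ?scale1r ?gt_eqF.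
exists (B P).
  apply: cvg_trans cB; apply: near_eq_cvg.
  apply: filterS Hsol => e [_ _ xe0 [Xe0 _]].
  by rewrite /w Xe0 trmx1 mul1mx mulmx1.
move=> v RV uO v0; rewrite /vol_contraction.
set Om := RV^T *m J *m RV in uO *.
(* f is the integrand of the volume contraction on [0, P], in a form that is
   continuous at all times. *)
pose f t := 2^-1 * \tr (invmx Om *m (RV^T *m form_rate t *m RV)).
pose F t := 2^-1 * \tr (invmx Om *m (RV^T *m B t *m RV)).
have cf : continuous f.
  have cc p k (A : 'M[R]_(p, k)) : continuous (fun _ : R => A) by move=> ?; exact: cvg_cst.
  have cg : continuous (fun t => invmx Om *m (RV^T *m form_rate t *m RV)).
    apply: (continuous_mulmx (cc _ _ _)); apply: continuous_mulmx (cc _ _ _).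
    exact: (continuous_mulmx (cc _ _ _) form_rate_continuous).
  move=> t; have c : _ @[r --> t] --> _ := cg t.
  suff : f r @[r --> t] --> f t by [].
  by apply: cvgM; [exact: cvg_cst | exact: cvg_mxtrace c].
have dF t : 0 <= t <= P -> is_derive t (1 : R) F (f t).
  move=> /andP[t0 tP].
  have tL : 0 <= t <= L by rewrite t0 (le_trans tP)// lerDl.
  have dc p k (A : 'M[R]_(p, k)) : is_derive t (1 : R) (fun _ : R => A) 0 by exact: is_derive_cst.
  have d1 := is_derive_mulmx (is_derive_mulmx (dc _ _ RV^T) (dB t tL)) (dc _ _ RV).
  have d2 := is_derive_mulmx (dc _ _ (invmx Om)) d1.
  have d3 := is_deriveZ (2^-1 : R) (is_derive_mxtrace d2).
  by apply: is_derive_eq d3 _; rewrite !mulmx0 !mul0mx ?addr0 ?add0r.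
have int := Rintegral_FTC2 P0 cf dF.
have -> : \int[mu]_(t in `[0, P]) \tr (sympl_linv RV *m invmx (X0 t) *m
    jac_pert S (x0 t) t d0 0 *m X0 t *m RV) = \int[mu]_(t in `[0, P]) f t.
  apply: eq_Rintegral => t /set_mem; rewrite /= in_itv => /andP[t0 _].
  by rewrite /f form_rate_trace// mulrA mulVf ?mul1r// pnatr_eq0.
rewrite int /F B00 mulmx0 mul0mx mulmx0 mxtrace0 mulr0 subr0.
have v00 : (v%:R : R) != 0 by rewrite pnatr_eq0 -lt0n.
by field; rewrite v00 gt_eqF.
Qed.

End Limits.

Lemma derive_eq0_of_little_o (R : realType) m1 k1 m2 k2 (E : R -> 'M[R]_(m1, k1)) (G : R -> 'M[R]_(m2, k2))
    (h0 : R) V W :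
  is_derive h0 (1 : R) E V -> is_derive h0 (1 : R) G W -> E h0 = 0 -> G h0 = 0 ->
  (forall eta, 0 < eta -> \forall h \near h0, `|E h| <= eta * `|G h|) -> V = 0.
Proof.
move=> /is_derive_cvgP dE /is_derive_cvgP dG E0 G0 H.
have key eta : 0 < eta -> `|V| <= eta * `|W|.
  move=> eta0.
  have c1 : `|k^-1 *: (E (k + h0) - E h0)| @[k --> 0^'] --> `|V| by exact: cvg_norm.
  have c2 : eta * `|k^-1 *: (G (k + h0) - G h0)| @[k --> 0^'] --> eta * `|W|.
    by exact: cvgM (cvg_cst eta) (cvg_norm dG).
  apply: (ler_cvg_to c1 c2).
  have c3 : k + h0 @[k --> (0 : R)^'] --> h0.
    have c0 : k @[k --> (0 : R)^'] --> (0 : R) by exact: cvg_within.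
    have c4 : k + h0 @[k --> (0 : R)^'] --> 0 + h0 by exact: cvgD c0 (cvg_cst h0).
    by move: c4; rewrite add0r.
  have near0 : \forall k \near (0 : R)^', `|E (k + h0)| <= eta * `|G (k + h0)|.
    exact: (c3 _ (H _ eta0)).
  apply: filterS near0 => k Hk.
  by rewrite E0 G0 !subr0 !normrZ mulrCA ler_wpM2l.
apply/eqP; rewrite -normr_le0 leNgt; apply/negP => V0.
have W1 : 0 < `|W| + 1 by rewrite ltr_wpDl.
have := key (`|V| / (2 * (`|W| + 1))); rewrite divr_gt0 ?mulr_gt0// => /(_ isT).
rewrite mulrAC ler_pdivlMr ?mulr_gt0// ler_pM2l//; have := normr_ge0 W; lra.
Qed.

Lemma is_derive_comp_mx (R : realType) m k (f : R -> 'M[R]_(m, k)) (g : R -> R) (x b : R) a :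
  is_derive (g x) (1 : R) f a -> is_derive x (1 : R) g b ->
  is_derive x (1 : R) (fun s => f (g s)) (b *: a).
Proof.
move=> /is_derive_mxP df dg; apply/is_derive_mxP => i j; rewrite mxE mulrC.
exact: is_derive1_comp (df i j) dg.
Qed.

(** The left-hand side is the derivative of X^T J (y - x0) along two trajectories; J H
cancels by symmetry of H and leaves the second-order remainder of DH. *)
Lemma transported_defect_algebra (R : realType) k (J h X : 'M[R]_k) (u g1 g2 : 'cV[R]_k) :
  J^T = - J -> J *m J = - 1%:M -> h^T = h ->
  (J *m h *m X)^T *m J *m u + X^T *m J *m (J *m g1 - J *m g2) =
  - (X^T *m (g1 - g2 - h *m u)).
Proof.
move=> JT JJ hT; have E1 : (J *m h *m X)^T *m J = X^T *m h.
  by rewrite !trmx_mul JT hT mulmxN mulmxN mulNmx -!mulmxA JJ !mulmxN opprK mulmx1.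
have E2 : X^T *m J *m (J *m g1 - J *m g2) = - (X^T *m (g1 - g2)).
  by rewrite -mulmxBr -mulmxA (mulmxA J) JJ mulNmx mul1mx mulmxN.
by rewrite E1 E2 -mulmxA [in RHS]mulmxBr opprB.
Qed.

(** * The family of periodic orbits *)

Section Family.
Context {R : realType} {n : nat}.
Variables (S : mech R n) (U : set 'cV[R]_(n + n)) (r0 : nat).
Hypotheses (hr0 : (3 <= r0)%N) (hS : admissible S U r0).
Local Notation phase := 'cV[R]_(n + n).
Local Notation J := (@Jmx R n).
Local Notation H := (ham S).
Local Notation csol := (solution U (fun y _ => cons_field S y)).

Lemma solution_shift (y : R -> phase) a : csol y -> csol (fun t => y (t + a)).
Proof.
move=> sy t; have [Uy dy] := sy (a + t); rewrite (addrC t); split => //.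
have [dv <-] := dy.
have := is_derive_translate dv.
by under eq_fun do rewrite addrC.
Qed.

Lemma solution_unique (y1 y2 : R -> phase) : csol y1 -> csol y2 -> y1 0 = y2 0 ->
  forall t, 0 <= t -> y1 t = y2 t.
Proof.
move=> s1 s2 e0 t t0.
have [C [rho0 [C0 rho00 HC]]] := trajectory_close t0 (grad_C1 hr0 hS) (x0_in s2) (x0_derive s2).
have t0t : 0 <= t <= t by rewrite t0 lexx.
have d1 s : is_derive s (1 : R) y1 (J *m grad H (y1 s) + (0 : phase)).
  by rewrite addr0; exact: x0_derive s1 s.
have := HC y1 (fun=> 0) rho0 0 (lexx _) (lexx _) d1 _ _ t t0t.
rewrite e0 subrr normr0 addr0 mulr0 => h.
apply/eqP; rewrite -subr_eq0 -normr_le0; apply: h => //.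
Qed.

(** The two solutions agree for nonnegative times; periodicity of y2 moves any time
there, so that a period of y1 is one of y2. *)
Lemma minimal_period_le (y1 y2 : R -> phase) T1 T2 : csol y1 -> csol y2 -> y1 0 = y2 0 ->
  minimal_period T1 y1 -> minimal_period T2 y2 -> T2 <= T1.
Proof.
move=> s1 s2 e0 [T10 p1 _] [T20 p2 m2].
rewrite leNgt; apply/negP => T12.
apply: (m2 T1); first by rewrite T10.
have pk k t : y2 (t + k%:R * T2) = y2 t.
  elim: k => [|k IHk]; first by rewrite mul0r addr0.
  by rewrite -natr1 mulrDl mul1r addrA p2.
move=> t; pose k := Num.bound (`|t| / T2).
have tk : 0 <= t + k%:R * T2.
  have h : `|t| / T2 < k%:R by apply: archi_boundP; rewrite divr_ge0// ltW.
  rewrite ltr_pdivrMr// in h; have := ler_norm (- t); rewrite normrN; lra.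
rewrite -(pk k (t + T1)) -(pk k t) addrAC.
rewrite -!(solution_unique s1 s2 e0) ?p1//.
by apply: addr_ge0 => //; exact: ltW.
Qed.

Lemma minimal_period_shift (y : R -> phase) T a : minimal_period T y ->
  minimal_period T (fun t => y (t + a)).
Proof.
move=> [T0 p m]; split => // [t|s sT ps]; first by rewrite /= addrAC p.
apply: (m s sT) => t; have : y (t - a + s + a) = y (t - a + a) := ps (t - a).
by rewrite (addrAC (t - a)) !subrK.
Qed.

(** The orbit of the family at the level H(z) and the orbit Z pass through the same
point, so they have the same minimal period. *)
Lemma orbit_period (tau : R) (Z : set phase) z gam T x0 :
  conservative_orbit S U tau Z -> Z z -> csol x0 -> x0 0 = z -> orbit_family S U z gam T ->
  [/\ 0 < tau, T (ham S z) = tau & forall m : nat, x0 (m%:R * tau) = z].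
Proof.
move=> [x [sx mx ZE]] Zz s0 x00 [gz [N [_ Nz _ _ HN]]].
have [a _ xa] : range x z by rewrite -ZE.
have sa := solution_shift a sx.
have ma := minimal_period_shift a mx.
have [_ [y [sy y0] my]] := HN _ Nz.
have ay : (fun t => x (t + a)) 0 = y 0 by rewrite /= add0r xa y0.
have [tau0 pa _] := ma.
split => //.
  apply/eqP; rewrite eq_le (minimal_period_le sa sy ay ma my).
  by rewrite (minimal_period_le sy sa (esym ay) my ma).
move=> m.
have -> : x0 (m%:R * tau) = x (m%:R * tau + a).
  apply: (solution_unique s0 sa); first by rewrite x00 /= add0r xa.
  by rewrite mulr_ge0// ltW.
elim: m => [|m IHm]; first by rewrite mul0r add0r xa.
by rewrite -natr1 mulrDl mul1r -IHm; exact: pa.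
Qed.

(** Differentiate H(gam h) = h. *)
Lemma family_energy_transverse z gam T : U z -> orbit_family S U z gam T ->
  exists mg : phase, is_derive (ham S z) (1 : R) gam mg /\ ((grad H z)^T *m mg) 0 0 = 1.
Proof.
move=> Uz [gz [N [oN Nz [_ Cg] _ HN]]].
have [dg _] := Cg 1 I.
exists ('D_1 gam (ham S z)).
have dgam : is_derive (ham S z) (1 : R) gam ('D_1 gam (ham S z)) by apply: DeriveDef => //; exact: dg.
split => //.
have [oU _ d1 d2] := ham_C1 hr0 hS.
have Ug : U (gam (ham S z)) by rewrite gz.
have d3 : is_derive (ham S z) (1 : R) (fun h => ham S (gam h)) (dot (grad H z) ('D_1 gam (ham S z))).
  by have := chain_rule oU Ug d1 (d2 _ Ug) dgam; rewrite gz.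
have d4 : is_derive (ham S z) (1 : R) (fun h => ham S (gam h)) 1.
  have E : \forall h \near ham S z, id h = ham S (gam h).
    have nN : \forall h \near ham S z, N h by exact: open_nbhs_nbhs.
    by apply: filterS nN => h Nh; have [-> _] := HN h Nh.
  exact: (near_eq_is_derive E (is_derive_id _ _)).
have [_ e4] := d4; have [_ e3] := d3.
by rewrite -[LHS]e3.
Qed.

(** Formally this is the derivative in h of the periodicity relation
x(m T(h); gam h) = gam h, the derivative of the flow in its initial point being X0.
Differentiability of the flow is avoided by transporting the difference y - x0 to
time 0 with X0^T J, whose derivative is of second order. *)
Lemma family_monodromy (tau : R) (Z : set phase) z gam T x0 X0 mg (m : nat) :
  (0 < m)%N -> conservative_orbit S U tau Z -> Z z -> csol x0 -> x0 0 = z ->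
  fundamental (fun t => J *m hessian H (x0 t)) X0 -> orbit_family S U z gam T ->
  is_derive (ham S z) (1 : R) gam mg ->
  (1%:M - X0 (m%:R * tau)) *m mg = (m%:R * derive1 T (ham S z)) *: (J *m grad H z).
Proof.
move=> m0 hZ Zz s0 x00 hX0 hF dgam.
have [tau0 Th xm] := orbit_period hZ Zz s0 x00 hF.
have [gz [N [oN Nz [cgam _] [_ CT] HN]]] := hF.
set h0 := ham S z in dgam Th Nz *.
set P := m%:R * tau; set L := P + 1.
have P0 : 0 < P by rewrite mulr_gt0// ltr0n.
have L0 : 0 <= L by exact: addr_ge0 (ltW P0) ler01.
have dT : is_derive h0 (1 : R) T (derive1 T h0).
  by rewrite derive1E; apply: DeriveDef => //; have [+ _] := CT 1 I; apply.
set T' := derive1 T h0 in dT *.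
have dmT : is_derive h0 (1 : R) (fun h => m%:R * T h) (m%:R * T') by exact: is_deriveZ.
have PT : m%:R * T h0 = P by rewrite Th.
have xP : x0 P = z by exact: xm.
pose c1 h := gam h - x0 (m%:R * T h).
have dc1 : is_derive h0 (1 : R) c1 (mg - (m%:R * T') *: (J *m grad H z)).
  apply: (is_deriveB dgam); apply: (is_derive_comp_mx _ dmT).
  by rewrite PT -xP; exact: (x0_derive s0).
have c10 : c1 h0 = 0 by rewrite /c1 PT xP gz subrr.
have dX : is_derive h0 (1 : R) (fun h => X0 (m%:R * T h)) ((m%:R * T') *: (J *m hessian H (x0 P) *m X0 P)).
  by apply: (is_derive_comp_mx _ dmT); rewrite PT; exact: (X0_derive hX0).
(* E h is the change over m periods of X0^T J (y - x0) for the orbit y through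
   gam h. *)
pose E h := (X0 (m%:R * T h))^T *m J *m c1 h - J *m (gam h - z).
have dJ : is_derive h0 (1 : R) (fun _ : R => J) 0 by exact: is_derive_cst.
have dgz : is_derive h0 (1 : R) (fun h => gam h - z) mg.
  by have := is_deriveB dgam (is_derive_cst z h0 (1 : R)); rewrite subr0.
have dE : is_derive h0 (1 : R) E
    ((X0 P)^T *m J *m (mg - (m%:R * T') *: (J *m grad H z)) - J *m mg).
  have d1 := is_derive_mulmx (is_derive_mulmx (is_derive_trmx dX) dJ) dc1.
  have d2 := is_derive_mulmx dJ dgz.
  have d3 := is_deriveB d1 d2.
  by apply: is_derive_eq d3 _; rewrite c10 mulmx0 mul0mx PT !(add0r, addr0).
have E0 : E h0 = 0 by rewrite /E c10 gz subrr !mulmx0 subrr.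
have gz0 : gam h0 - z = 0 by rewrite gz subrr.
have small eta : 0 < eta -> \forall h \near h0, `|E h| <= eta * `|gam h - z|.
  move=> eta0.
  have [C [rho0 [C0 rho00 HC]]] := trajectory_close L0 (grad_C1 hr0 hS) (x0_in s0) (x0_derive s0).
  have cX t : 0 <= t <= L -> {for t, continuous X0} by move=> _; exact: (X0_continuous hX0).
  have [K K0 HK] := segment_bounded cX.
  (* The change of X0^T J (y - x0) is at most B times the Taylor constant times
     |gam h - z|, which dictates the choice of that constant. *)
  pose B := (n + n)%:R * K * C * L.
  have B0 : 0 <= B by rewrite !mulr_ge0// ltW.
  have eta1 : 0 < eta / (B + 1) by rewrite divr_gt0// ltr_wpDl.
  have [rho1 rho10 Hrem] := C1_tube L (grad_C1 hr0 hS) (x0_in s0) (x0_continuous s0) eta1.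
  pose rho := Num.min rho0 rho1.
  have rhop : 0 < rho by rewrite lt_min rho00.
  have cg : gam h @[h --> h0] --> z by rewrite -gz; exact: is_derive_cont dgam.
  have near1 : \forall h \near h0, `|gam h - z| < rho / C.
    by have /cvgrPdistC_lt := cg; apply; rewrite divr_gt0.
  have nearN : \forall h \near h0, N h by exact: open_nbhs_nbhs.
  have cT : m%:R * T h @[h --> h0] --> P by rewrite -PT; have [/derivable1_diffP/differentiable_continuous] := dmT.
  have near2 : \forall h \near h0, 0 < m%:R * T h by exact: (cvgr_gt _ cT).
  have near3 : \forall h \near h0, m%:R * T h < L by apply: (cvgr_lt _ cT); rewrite ltrDl.
  near=> h.
  have [_ [y [sy y0] [_ py _]]] : ham S (gam h) = h /\ exists2 y : R -> phase,
     csol y /\ y 0 = gam h & minimal_period (T h) y by apply: HN; near: h.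
  have ymT : y (m%:R * T h) = gam h.
    rewrite -y0; elim: (m) => [|k IHk]; first by rewrite mul0r.
    by rewrite -natr1 mulrDl mul1r py.
  have close t : 0 <= t <= L -> `|y t - x0 t| <= C * `|gam h - z|.
    have d1 s : is_derive s (1 : R) y (J *m grad H (y s) + (0 : phase)).
      by rewrite addr0; exact: x0_derive sy s.
    have := HC y (fun=> 0) rho0 0 (lexx _) (lexx _) d1.
    rewrite y0 x00 addr0 => h1; apply: h1; first by move=> *; rewrite normr0.
    have h2 : `|gam h - z| < rho / C by near: h.
    rewrite ltr_pdivlMr// mulrC in h2; apply: (lt_le_trans h2).
    by rewrite /rho ge_min lexx.
  have close1 t : 0 <= t <= L -> `|y t - x0 t| < rho1.
    move=> /close h1; apply: (le_lt_trans h1).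
    have h2 : `|gam h - z| < rho / C by near: h.
    rewrite ltr_pdivlMr// mulrC in h2; apply: (lt_le_trans h2).
    by rewrite /rho ge_min lexx orbT.
  pose D t := (X0 t)^T *m J *m (y t - x0 t).
  pose rem t := grad H (y t) - grad H (x0 t) - hessian H (x0 t) *m (y t - x0 t).
  have dD t : 0 <= t <= L -> is_derive t (1 : R) D (- ((X0 t)^T *m rem t)).
    move=> _.
    have d1 := is_derive_mulmx (is_derive_trmx (X0_derive hX0 t)) (is_derive_cst J t (1 : R)).
    have d2 := is_derive_mulmx d1 (is_deriveB (x0_derive sy t) (x0_derive s0 t)).
    apply: is_derive_eq d2 _.
    have Hs : (hessian H (x0 t))^T = hessian H (x0 t) by exact: (ham_hessian_sym hr0 hS (x0_in s0 t)).
    by rewrite mulmx0 addr0 (transported_defect_algebra _ _ _ _ (Jmx_tr (R := R)) (Jmx_sqr (R := R)) Hs).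
  have bD t : 0 <= t <= L -> `|- ((X0 t)^T *m rem t)| <= (n + n)%:R * K * (eta / (B + 1) * (C * `|gam h - z|)).
    move=> tL; rewrite normrN (le_trans (mulmx_norm_le _ _))//.
    rewrite -!mulrA ler_wpM2l// ler_pM//.
      by rewrite trmx_norm; exact: HK.
    by rewrite mulrA; apply: (le_trans (Hrem t (y t) tL (close1 t tL))); rewrite ler_wpM2l ?(ltW eta1)// close.
  have mL : 0 <= m%:R * T h <= L by rewrite !ltW//; near: h.
  have := mean_value_ineq dD bD mL.
  have -> : D (m%:R * T h) - D 0 = E h.
    by rewrite /D ymT y0 x00 (X0_at0 hX0) trmx1 mul1mx.
  move=> h1; apply: (le_trans h1).
  have h2 : eta / (B + 1) * B <= eta.
    by rewrite mulrAC ler_pdivrMr ?ltr_wpDl// ler_wpM2l ?(ltW eta0)// lerDl.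
  have /andP[_ h3] := mL.
  have h4 : 0 <= `|gam h - z| by [].
  have h5 : (n + n)%:R * K * (eta / (B + 1) * (C * `|gam h - z|)) * (m%:R * T h)
      <= (n + n)%:R * K * (eta / (B + 1) * (C * `|gam h - z|)) * L.
    by rewrite ler_wpM2l// !mulr_ge0// ?(ltW eta0) ?(ltW K0) ?(ltW C0)// invr_ge0 addr_ge0.
  apply: (le_trans h5).
  have -> : (n + n)%:R * K * (eta / (B + 1) * (C * `|gam h - z|)) * L =
     eta / (B + 1) * B * `|gam h - z| by rewrite /B; ring.
  by rewrite ler_wpM2r.
have V0 := derive_eq0_of_little_o dE dgz E0 gz0 small.
have [_ XJX] := sympl_inv (X0_symplectic hr0 hS s0 hX0 (ltW P0)).
have := congr1 (mulmx (X0 P *m J)) V0.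
set W := mg - _ in V0 *; rewrite mulmx0 mulmxBr !mulmxA XJX Jmx_sqr.
rewrite -(mulmxA (X0 P) J J) Jmx_sqr mulmxN mulmx1 !mulNmx mul1mx opprK addrC.
move=> /eqP; rewrite subr_eq0 => /eqP XW.
by rewrite mulmxBl mul1mx XW /W opprB addrC subrK.
Unshelve. all: by end_near. Qed.

End Family.

Lemma cvg_at_right0_bound (R : realType) (V : normedModType R) (f : R -> V) (a : V) (K : R) :
  (\forall e \near 0^'+, `|f e - a| <= K * e) -> f e @[e --> 0^'+] --> a.
Proof.
move=> H; apply/cvgrPdistC_le => eta eta0.
have c0 : e @[e --> (0 : R)^'+] --> (0 : R) by exact: cvg_within.
have c : K * e @[e --> (0 : R)^'+] --> K * 0 by exact: cvgM (cvg_cst K) c0.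
have n : \forall e \near (0 : R)^'+, K * e < eta by apply: (cvgr_lt _ c); rewrite mulr0.
by apply: filterS2 H n => e h1 h2; apply: (le_trans h1); exact: ltW.
Qed.

Theorem theorem4p2 (R : realType) (n : nat) (hn : (0 < n)%N)
    (S : mech R n) (U : set 'cV[R]_(n + n)) (r0 : nat) (hr0 : (3 <= r0)%N)
    (hS : admissible S U r0)
    (Z : set 'cV[R]_(n + n)) (tau : R) (hZ : conservative_orbit S U tau Z)
    (m l : nat) (hm : (0 < m)%N) (hl : (0 < l)%N) (hml : coprime m l)
    (z : 'cV[R]_(n + n)) (hz : Z z)
    (x0 : R -> 'cV[R]_(n + n))
    (hx0 : solution U (fun y _ => cons_field S y) x0) (hx0z : x0 0 = z)
    (X0 : R -> 'M[R]_(n + n))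
    (hX0 : fundamental (fun t => Jmx *m hessian (ham S) (x0 t)) X0) :
  let P := m%:R * tau in
  let d0 := m%:R * tau / l%:R in
  let Pi := X0 P in
  let Mel := melnikov S x0 P d0 in
  forall
    (A1 : [/\ m_normal S Pi z, Mel 0 = 0 & derive1 Mel 0 != 0])
    (A2 : spectrum_on_circle Pi)
    (A3 : alg_mult 1 Pi = 2%N /\ geo_mult 1 Pi = 1%N)
    (gam : R -> 'cV[R]_(n + n)) (T : R -> R)
    (hF : orbit_family S U z gam T)
    (r : 'cV[R]_(n + n) -> R -> R) (hr : parametrizes S U m z gam T r)
    (TT : {vspace 'cV[R]_(n + n)})
    (RT : 'M[R]_(n + n, 1 + 1)) (BT : 'M[R]_(1 + 1))
    (hTT : tangent_space Pi TT RT BT)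
    (e0 : R) (xi : R -> 'cV[R]_(n + n)) (delta : R -> R)
    (xe : R -> R -> 'cV[R]_(n + n)) (Xe : R -> R -> 'M[R]_(n + n))
    (hZe : perturbed_branch S U r l z P e0 xi delta xe Xe),
  let C v (RV : 'M[R]_(n + n, v + v)) := vol_contraction S x0 X0 P d0 RV in
  let T' := derive1 T (ham S z) in
  let M' := derive1 Mel 0 in
    (T' * M' < 0 \/ (0 < T' * M' /\ C 1%N RT < 0)) \/
    (exists (v : nat) (V : {vspace 'cV[R]_(n + n)})
       (RV : 'M[R]_(n + n, v + v)) (BV : 'M[R]_(v + v)),
       [/\ (0 < v)%N, strongly_invariant Pi V RV BV & C v RV < 0]) ->
  \forall e \near 0^'+, floquet_unstable (Xe e (l%:R * delta e)).
Proof.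
move=> P d0 Pi Mel A1 A2 [A3 _] gam T hF r hr TT RT BT hTT e0 xi delta xe Xe hZe C T' M' cases.
have [tau0 _ xm] := orbit_period hr0 hS hZ hz hx0 hx0z hF.
have P0 : 0 < P by rewrite mulr_gt0// ltr0n.
have l0 : 0 < l%:R :> R by rewrite ltr0n.
have d00 : 0 < d0 by rewrite divr_gt0.
have [e00 _ [K1 HK1] [K2 HK2] branch] := hZe.
pose s e := l%:R * delta e.
have cs : s e @[e --> 0^'+] --> P by exact: cvg_at_right0_bound HK2.
have cd : delta e @[e --> 0^'+] --> d0.
  have -> : delta = (fun e => s e * l%:R^-1).
    by apply/funext => e; rewrite /s mulrAC mulfV ?mul1r// gt_eqF.
  exact: cvgM cs (cvg_cst _).
have cxi : xi e @[e --> 0^'+] --> x0 0 by rewrite hx0z; exact: cvg_at_right0_bound HK1.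
have ge0 : \forall e \near (0 : R)^'+, 0 < e by exact: nbhs_right_gt.
have ne0 : \forall e \near (0 : R)^'+, e < e0 by exact: nbhs_right_lt.
have Hsol : \forall e \near 0^'+, [/\ 0 < delta e,
   solution U (forced_field S (delta e) e) (xe e), xe e 0 = xi e
    & fundamental (var_matrix S (delta e) e (xe e)) (Xe e)].
  apply: filterS2 ge0 ne0 => e e1 e2; have [|? _ [? ?] _ ?] := branch e; first by rewrite e1.
  by split.
have Hper : \forall e \near 0^'+, xe e (s e) = xi e.
  apply: filterS2 ge0 ne0 => e e1 e2; have [|_ _ [_ x1] per _] := branch e; first by rewrite e1.
  by rewrite -x1 -[s e]add0r per.
have L0 : 0 <= P + 1 by exact: addr_ge0 (ltW P0) ler01.
have PL : 0 < P < P + 1 by rewrite P0 ltrDl ltr01.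
have cPhi : Xe e (s e) @[e --> 0^'+] --> Pi.
  have jX := Xe_jcvg hr0 hS hx0 hX0 d00 cd cxi Hsol L0.
  exact: (@jcvg_at R (P + 1) R 0^'+ _ _ Xe X0 s P jX PL cs).
have expanding v (V : {vspace 'cV[R]_(n + n)}) (RV : 'M[R]_(n + n, v + v)) BV :
    (0 < v)%N -> strongly_invariant Pi V RV BV -> C v RV < 0 ->
    \forall e \near 0^'+, floquet_unstable (Xe e (l%:R * delta e)).
  move=> v0 si Cneg.
  have sympl := X0_symplectic hr0 hS hx0 hX0 (ltW P0).
  have [uO SPi sep] := strongly_invariant_split (@Jmx_unit R n) sympl si A2.
  have [_ PiV _ _] := si.
  have [G0 cG trG] := form_limit hr0 hS hx0 hX0 d00 cd cxi Hsol P0 cs.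
  have tr0 : 0 < \tr (invmx (RV^T *m Jmx *m RV) *m (RV^T *m G0 *m RV)).
    by rewrite trG// nmulr_rgt0// oppr_lt0 !mulr_gt0// ltr0n.
  apply: (@unstable_of_expanding_form _ _ _ _ _ _ id (fun e => Xe e (s e)) _ (@Jmx R n) Pi G0 RV BV
    _ ge0 cPhi cG _ uO SPi PiV sep tr0); first exact: cvg_within.
  apply: filterS ge0 => e e1.
  by rewrite scalerA mulfV ?gt_eqF// scale1r addrC subrK.
case: cases => [[neg|[_ Cneg]]|[v [V [RV [BV [v0 si Cneg]]]]]]; last 2 first.
- by apply: (expanding _ TT RT BT) => //; case: hTT.
- exact: expanding si Cneg.
have [be0 cbe be0f] := covector_limit hr0 hS hx0 hX0 d00 cd cxi Hsol P0 cs.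
have Uz : U z by rewrite -hx0z; exact: (x0_in hx0).
have [mg [dgam wmg]] := family_energy_transverse hr0 hS Uz hF.
have Pimg := family_monodromy hr0 hS hm hZ hz hx0 hx0z hX0 hF dgam.
have Pif : Pi *m (Jmx *m grad (ham S) z) = Jmx *m grad (ham S) z.
  by have := flow_direction hr0 hS hx0 hX0 (ltW P0); rewrite hx0z xm.
have cw : (grad (ham S) (xi e))^T @[e --> 0^'+] --> (grad (ham S) z)^T.
  have cg : grad (ham S) y @[y --> z] --> grad (ham S) z := grad_continuous hr0 hS Uz.
  apply: cvg_trmx; apply: (cvg_comp _ _ _ cg); by rewrite -hx0z.
apply: (unstable_of_real_multiplier _ ge0 cPhi cw cbe _ A2 A3 wmg Pif Pimg).
- apply: filterS2 ge0 Hper => e e1 ->.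
  by rewrite scalerA mulfV ?gt_eqF// scale1r.
- by rewrite hx0z in be0f; rewrite be0f -/T' -/Mel -/M' -mulrA pmulr_rlt0// ltr0n.
Qed.
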